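(* Let $T>0$, let $m\in\mathbb{N}$ and $\eta\in(0,1\wedge \frac{T}{m})$ with $m\eta\geq 1$, and set $N=\lfloor \frac{T}{m\eta}\rfloor$. Assume that for any $x,y\in\mathbb{R}^d$ one has $\nabla F(\cdot),\sigma(\cdot,y)\in\mathcal{G}^{2}$ and $\sigma(x,\cdot)\in\mathcal{G}^{1}$, and that $f_i$ is $M$-smooth for $i=1,\dots,n$. Let $(\tilde z_s)$ be the SVRG outer iterates and let $\tilde Y_s=Y_{sm\eta}$ be the sampled solution of the stochastic delay modified equation, started from $Y_0=\tilde z_0$. Then $\{\tilde Y_s\}$ is an order 1 weak approximation of the SVRG $\{\tilde z_s\}_{s=0,\dots,N}$, that is, for each $g\in\mathcal{G}^{2}_{1}$ there exists a constant $C>0$ independent of $m$ and $\eta$ such that $$\max_{s=0,\dots,N}\left|\mathbb{E}g(\tilde Y_s)-\mathbb{E}g(\tilde z_s)\right|\leq C\eta .$$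
   Context: Data: $f_1,\dots,f_n:\mathbb{R}^d\to\mathbb{R}$ are differentiable functions and $F=\frac1n\sum_{i=1}^n f_i$. A function $f$ is $M$-smooth ($M>0$) if $|\nabla f(x)-\nabla f(y)|\le M|x-y|$ for all $x,y\in\mathbb{R}^d$. The matrix $\sigma$: for $x,y\in\mathbb{R}^d$, with $*$ denoting transpose, $$\sigma(x,y)=\frac1n\sum_{i=1}^n(\nabla f_i(x)-\nabla f_i(y))(\nabla f_i(x)-\nabla f_i(y))^{*}-(\nabla F(x)-\nabla F(y))(\nabla F(x)-\nabla F(y))^{*},$$ i.e. the covariance matrix of $\nabla f_\gamma(x)-\nabla f_\gamma(y)$ with $\gamma$ uniform on $\{1,\dots,n\}$. It is symmetric positive semidefinite, and $A^{1/2}$ denotes the symmetric positive semidefinite square root of such a matrix. Function classes: $\mathcal{G}^k$ is the set of functions on $\mathbb{R}^d$ whose partial derivatives up to order $k$ exist and are continuous and bounded (for vector- or matrix-valued functions, componentwise). $\mathcal{G}^k_1$ is the subset of real-valued $g\in\mathcal G^k$ whose derivatives of orders $1,\dots,k$ are bounded by 1; in particular $g\in\mathcal{G}^2_1$ means $\sup_y|\nabla g(y)|\le 1$ and $\sup_y\|\nabla^2 g(y)\|_{\rm op}\le 1$. SVRG with epoch length $m\in\mathbb{N}$ and step size $\eta>0$: start from $z_0=\tilde z_0\in\mathbb{R}^d$; let $\gamma_1,\gamma_2,\dots$ be i.i.d. uniform on $\{1,\dots,n\}$; for $s\ge0$ and $sm<k\le (s+1)m$, $$z_k=z_{k-1}-\eta\left[\nabla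 f_{\gamma_k}(z_{k-1})-\nabla f_{\gamma_k}(z_{sm})+\nabla F(z_{sm})\right].$$ The outer iterates are $\tilde z_s=z_{sm}$, $s=0,1,2,\dots$ Stochastic delay modified equation: $(Y_t)_{t\ge0}$ solves, for each integer $s\ge0$ and $t\in(sm\eta,(s+1)m\eta]$, $$dY_t=-\nabla F(Y_t)\,dt+\left(\eta\,\sigma(Y_t,Y_{sm\eta})\right)^{1/2}dW_t,$$ where $W$ is a standard $d$-dimensional Brownian motion. *)

(* Defs.v *)
From HB Require Import structures.
From mathcomp Require Export all_boot all_order all_algebra.
From mathcomp Require Export all_classical all_reals all_analysis.

Set Implicit Arguments.
Unset Strict Implicit.
Unset Printing Implicit Defensive.

Import Order.TTheory GRing.Theory Num.Theory.
Import numFieldNormedType.Exports.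

Local Open Scope classical_set_scope.
Local Open Scope ring_scope.

Section calculus.
Context {R : realType} {d : nat}.
Implicit Types (f g : 'cV[R]_d -> R) (A B : 'M[R]_d).

(* The library norm on matrices is the sup norm, so the Euclidean one is
   defined here. *)
Definition enorm (x : 'cV[R]_d) : R := Num.sqrt (\sum_i x i 0 ^+ 2).

Definition opnorm A : R :=
  sup [set enorm (A *m v) | v in [set v | enorm v <= 1]].

Definition basis_vec (j : 'I_d) : 'cV[R]_d := delta_mx j 0.

Definition partial (j : 'I_d) f : 'cV[R]_d -> R :=
  fun x => 'D_(basis_vec j) f x.

Definition grad f (x : 'cV[R]_d) : 'cV[R]_d := \col_j partial j f x.

Definition hessian f (x : 'cV[R]_d) : 'M[R]_d :=
  \matrix_(i, j) partial i (partial j f) x.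

Definition smooth (M : R) f : Prop :=
  forall x y, enorm (grad f x - grad f y) <= M * enorm (x - y).

(* "Up to order k" includes order 0: the function itself is continuous and
   bounded. *)
Fixpoint classG (k : nat) f : Prop :=
  [/\ continuous f,
      exists B : R, forall x, `|f x| <= B
    & if k is k'.+1 then
        forall j, (forall x, derivable f x (basis_vec j)) /\
                  classG k' (partial j f)
      else True].

Definition classG_vec (k : nat) (f : 'cV[R]_d -> 'cV[R]_d) : Prop :=
  forall i, classG k (fun x => f x i 0).

Definition classG_mx (k : nat) (f : 'cV[R]_d -> 'M[R]_d) : Prop :=
  forall i j, classG k (fun x => f x i j).

Definition classG21 g : Prop :=
  [/\ classG 2 g, forall y, enorm (grad g y) <= 1
    & forall y, opnorm (hessian g y) <= 1].

Definition sym_psd A : Prop :=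
  A^T = A /\ forall v : 'cV[R]_d, 0 <= (v^T *m A *m v) 0 0.

(* For symmetric positive semidefinite A the set below is a singleton; the
   default value 0 is only used for other matrices. *)
Definition sqrtmx A : 'M[R]_d := xget 0 [set B | sym_psd B /\ B *m B = A].

End calculus.

Section data.
Context {R : realType} {n d : nat}.
Variable f : 'I_n -> 'cV[R]_d -> R.

Definition favg (x : 'cV[R]_d) : R := n%:R^-1 * \sum_i f i x.

Definition sigma (x y : 'cV[R]_d) : 'M[R]_d :=
  n%:R^-1 *: \sum_i (grad (f i) x - grad (f i) y)
                      *m (grad (f i) x - grad (f i) y)^T
  - (grad favg x - grad favg y) *m (grad favg x - grad favg y)^T.

End data.

Section svrg.
Context {R : realType} {n d : nat} {disp : measure_display}
  {T : measurableType disp}.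

Definition mutually_independent (P : probability T R)
    (gam : nat -> T -> 'I_n) : Prop :=
  forall (J : seq nat) (A : nat -> set 'I_n),
    uniq J -> (forall k, k \in J -> (0 < k)%N) ->
    P (\bigcap_(k in [set` J]) (gam k @^-1` A k)) =
      (\prod_(k <- J) P (gam k @^-1` A k))%E.

(* gam 1, gam 2, ... are the random indices; gam 0 plays no role. *)
Definition iid_uniform (P : probability T R) (gam : nat -> T -> 'I_n) : Prop :=
  [/\ forall k (A : set 'I_n), (0 < k)%N -> measurable (gam k @^-1` A),
      forall k (i : 'I_n), (0 < k)%N ->
        P (gam k @^-1` [set i]) = (n%:R^-1)%:E
    & mutually_independent P gam].

Definition is_svrg (f : 'I_n -> 'cV[R]_d -> R) (m : nat) (eta : R)
    (z0 : 'cV[R]_d) (gam : nat -> T -> 'I_n) (z : nat -> T -> 'cV[R]_d) : Prop :=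
  (forall w, z 0%N w = z0) /\
  forall s k w, (s * m < k <= s.+1 * m)%N ->
    z k w = z k.-1 w
      - eta *: (grad (f (gam k w)) (z k.-1 w)
                - grad (f (gam k w)) (z (s * m)%N w)
                + grad (favg f) (z (s * m)%N w)).

End svrg.

Section stochastic.
Context {R : realType} {d : nat} {disp : measure_display}
  {T : measurableType disp}.
Implicit Types (P : probability T R) (Ft : R -> set (set T)).

(* Only times t >= 0 are relevant. *)
Definition is_filtration Ft : Prop :=
  [/\ forall t, 0 <= t -> sigma_algebra setT (Ft t),
      forall t, 0 <= t -> Ft t `<=` measurable
    & forall s t, 0 <= s -> s <= t -> Ft s `<=` Ft t].

Definition measurable_wrt (G : set (set T)) (X : T -> R) : Prop :=
  forall B : set R, measurable B -> G (X @^-1` B).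

Definition adapted Ft (X : R -> T -> 'cV[R]_d) : Prop :=
  forall t i, 0 <= t -> measurable_wrt (Ft t) (fun w => X t w i 0).

Definition continuous_paths (X : R -> T -> 'cV[R]_d) : Prop :=
  forall w, {within [set t | 0 <= t], continuous (fun t => X t w)}.

(* The last clause says that W_t - W_s is independent of F_s and has the law
   N(0, (t - s) I_d), i.e. the d-fold product of N(0, t - s); the second
   argument of normal_prob is the standard deviation. *)
Definition brownian P Ft (W : R -> T -> 'cV[R]_d) : Prop :=
  [/\ {ae P, forall w, W 0 w = 0}, adapted Ft W, continuous_paths W
    & forall (s t : R) (A : set T) (B : 'I_d -> set R),
        0 <= s -> s < t -> Ft s A -> (forall j, measurable (B j)) ->
        P (A `&` [set w | forall j, B j (W t w j 0 - W s w j 0)]) =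
          (P A * \prod_j normal_prob 0 (Num.sqrt (t - s)) (B j))%E].

(* A simple process on [a, b] is
     \sum_(k < p) xi k * 1_{]t k, t k.+1]}
   with xi k bounded and F_(t k)-measurable. *)
Definition is_simple Ft (a b : R) (p : nat) (t : nat -> R)
    (xi : nat -> T -> R) : Prop :=
  [/\ t 0%N = a, t p = b, forall k, (k < p)%N -> t k <= t k.+1,
      forall k, (k < p)%N -> measurable_wrt (Ft (t k)) (xi k)
    & forall k, (k < p)%N -> exists c : R, forall w, `|xi k w| <= c].

Definition simple_process (p : nat) (t : nat -> R) (xi : nat -> T -> R) :
    R -> T -> R :=
  fun u w => \sum_(k < p) xi k w * \1_(`]t k, t k.+1]%classic) u.

Definition simple_integral (p : nat) (t : nat -> R) (xi : nat -> T -> R)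
    (B : R -> T -> R) : T -> R :=
  fun w => \sum_(k < p) xi k w * (B (t k.+1) w - B (t k) w).

(* I is (a version of) the Ito integral of H over [a, b] against the
   one-dimensional Brownian motion B: simple processes converge to H in
   L^2(du x P), and their elementary integrals converge to I in L^2(P). *)
Definition is_ito_integral P Ft (B H : R -> T -> R) (a b : R) (I : T -> R) :
    Prop :=
  measurable_fun setT I /\
  exists (p : nat -> nat) (t : nat -> nat -> R) (xi : nat -> nat -> T -> R),
    [/\ forall q, is_simple Ft a b (p q) (t q) (xi q),
        (fun q => \int[P]_w \int[lebesgue_measure]_(u in `[a, b])
           ((H u w - simple_process (p q) (t q) (xi q) u w) ^+ 2)%:E)%E
          @ \oo --> 0%E
      & (fun q => \int[P]_w
           ((I w - simple_integral (p q) (t q) (xi q) B w) ^+ 2)%:E)%E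
          @ \oo --> 0%E].

(* Y solves, with Y_0 = y0,
     dY_t = - grad F(Y_t) dt + (eta sigma(Y_t, Y_(s m eta)))^(1/2) dW_t
   on each ]s m eta, (s + 1) m eta].  The L^2 integral above suffices: if
   sigma(., y) is bounded for one y, then sigma is bounded on R^d x R^d,
   because its trace is the mean square of v_i(x) - v_i(y) over i, where
   v_i is the difference of the gradients of f_i and F. *)
Definition solves_sdme n (f : 'I_n -> 'cV[R]_d -> R) (m : nat) (eta : R)
    (y0 : 'cV[R]_d) P Ft (W Y : R -> T -> 'cV[R]_d) : Prop :=
  [/\ adapted Ft Y, continuous_paths Y, {ae P, forall w, Y 0 w = y0}
    & forall (s : nat) (t : R),
        let a := (s * m)%:R * eta in
        a < t -> t <= (s.+1 * m)%:R * eta ->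
        exists I : 'I_d -> 'I_d -> T -> R,
          (forall i j, is_ito_integral P Ft (fun u w => W u w j 0)
             (fun u w => sqrtmx (eta *: sigma f (Y u w) (Y a w)) i j)
             a t (I i j)) /\
          {ae P, forall w, forall i,
             Y t w i 0 = Y a w i 0
               - \int[lebesgue_measure]_(u in `[a, t])
                   grad (favg f) (Y u w) i 0
               + \sum_j I i j w}].

End stochastic.

(* Main.v *)
Require Import Defs.
From mathcomp Require Import ring lra.
From mathcomp Require Import measurable_realfun.

Import Order.TTheory GRing.Theory Num.Theory.
Import numFieldNormedType.Exports.

(** At the accuracy O(eta), SVRG and the modified equation are both the same
    deterministic algorithm, namely gradient descent, which iterates the Euler
    map Phi x = x - eta grad F x.  Each of the two processes perturbs Phi by
    centered noise whose covariance is a multiple of the bounded matrix sigma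
    (sigma_diag_bounded).  It is therefore enough to show that both
    expectations differ from g (Phi^(s m) z0) by O(eta).

    Centered noise contributes to the expectation of a smooth function at the
    second order only.  The functions that have to be smooth here are
    v = g o Phi^j with j eta <= T: each has a bounded gradient and a quadratic
    remainder in its first order expansion, with constants that do not depend
    on j and eta (quad_approx_iter_euler).

    For SVRG, replacing a random step by Phi costs O(eta^2), because the noise
    of the step is eta times a variable that has mean zero and bounded variance
    given the past (svrg_step_error).  There are at most T / eta steps, so that
    the total cost is O(eta) (svrg_weak_error).

    For the modified equation whole epochs are replaced by m iterations of Phi.
    Let D be the gap, during an epoch, between the solution and the Euler path
    from the same initial value.  Two properties of the stochastic integral
    suffice: its second moment is O(eta), and it is orthogonal to the bounded
    variables known at the start of the epoch (ito_integral_bounds).  The first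
    one gives E |D|^2 = O(eta) by a Gronwall argument (gap_second_moment).  The
    second one gives E (zeta . D) = O(eta) for each bounded zeta known at the
    start of the epoch (gap_linear), by a Gronwall argument for the supremum
    over zeta.  In the expansion of v along the Euler path the gradient of v is
    such a zeta, so that an epoch costs O(eta) (epoch_weak_error).  Since
    m eta >= 1, there are at most T epochs. *)

Set Implicit Arguments.
Unset Strict Implicit.
Unset Printing Implicit Defensive.

Local Open Scope classical_set_scope.
Local Open Scope ring_scope.

(** * First order expansions with a quadratic remainder *)

Section taylor.
Context {R : realType} {d : nat}.
Implicit Types (f : 'cV[R]_d -> R) (x h : 'cV[R]_d).

Definition nsq x : R := \sum_i x i 0 ^+ 2.

Lemma nsq_ge0 x : 0 <= nsq x.
Proof. by apply: sumr_ge0 => i _; rewrite sqr_ge0. Qed.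

Lemma sum_sqr_le_nsq x : (\sum_i `|x i 0|) ^+ 2 <= d%:R * nsq x.
Proof.
have -> : d%:R * nsq x =
    \sum_(i < d) \sum_(j < d) (x i 0 ^+ 2 + x j 0 ^+ 2) / 2.
  transitivity (\sum_(i < d) (d%:R * x i 0 ^+ 2 + nsq x) / 2).
    rewrite -mulr_suml big_split/= -mulr_sumr -/(nsq x) sumr_const card_ord.
    by rewrite -[nsq x *+ d]mulr_natl; field.
  apply: eq_bigr => i _; rewrite -mulr_suml big_split/= -/(nsq x).
  by rewrite sumr_const card_ord -[x i 0 ^+ 2 *+ d]mulr_natl.
rewrite expr2 mulr_suml; apply: ler_sum => i _; rewrite mulr_sumr.
apply: ler_sum => j _.
rewrite -(real_normK (num_real (x i 0))) -(real_normK (num_real (x j 0))).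
by have := sqr_ge0 (`|x i 0| - `|x j 0|); nra.
Qed.

Lemma nsqD_le x y (c : R) : 0 < c ->
  nsq (x + y) <= (1 + c) * nsq x + (1 + c^-1) * nsq y.
Proof.
move=> c0; rewrite /nsq !mulr_sumr -big_split/=; apply: ler_sum => i _.
rewrite !mxE; set a := x i 0; set b := y i 0.
rewrite -subr_ge0.
rewrite (_ : _ - _ = c^-1 * (c * a - b) ^+ 2); last by field; rewrite gt_eqF.
by rewrite mulr_ge0 ?invr_ge0 ?sqr_ge0 ?ltW.
Qed.

Lemma nsqZ (c : R) x : nsq (c *: x) = c ^+ 2 * nsq x.
Proof.
by rewrite /nsq mulr_sumr; apply: eq_bigr => i _; rewrite mxE exprMn.
Qed.

(** The function classes only control partial derivatives, so increments are
    split into moves along the axes, where the one-dimensional mean value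
    theorem applies. *)
Lemma partial_MVT f (j : 'I_d) x (r : R) :
  (forall y, derivable f y (basis_vec j)) ->
  exists2 c, `|c| <= `|r| &
    f (x + r *: basis_vec j) - f x = partial j f (x + c *: basis_vec j) * r.
Proof.
move=> df; set e := basis_vec j in df *.
pose u := fun s : R => f (x + s *: e).
have du (s : R) : is_derive s 1 u (partial j f (x + s *: e)).
  have E : (fun h : R => h^-1 *: ((u \o shift s) (h *: 1) - u s)) =
           (fun h : R => h^-1 *: ((f \o shift (x + s *: e)) (h *: e) - f (x + s *: e))).
    apply/funext => h; rewrite /u/= [h *: 1]mulr1 scalerDl.
    by rewrite [_ + (h *: e + _)]addrCA.
  have D : derivable u s 1 by rewrite /derivable E; exact: df.
  by apply: DeriveDef => //; rewrite /derive E.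
have cu : continuous u.
  by move=> s; apply/differentiable_continuous/derivable1_diffP; case: (du s).
have [r0|r0] := leP 0 r.
  have [c] := MVT_segment r0 (fun s _ => du s) (continuous_subspaceT cu).
  rewrite in_itv/= => /andP[c0 cr]; rewrite /u scale0r addr0 subr0 => E.
  by exists c => //; rewrite !ger0_norm.
have [c] := MVT_segment (ltW r0) (fun s _ => du s) (continuous_subspaceT cu).
rewrite in_itv/= => /andP[rc c0]; rewrite /u scale0r addr0 sub0r => E.
exists c; first by rewrite !ler0_norm ?lerN2// ltW.
by rewrite -opprB E mulrN opprK.
Qed.

(** The corners of a staircase path from x to x + h. *)
Definition steps x h (k : nat) : 'cV[R]_d :=
  \col_i (x i 0 + if (i < k)%N then h i 0 else 0).

Lemma steps0 x h : steps x h 0 = x.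
Proof. by apply/colP => i; rewrite mxE addr0. Qed.

Lemma stepsn x h : steps x h d = x + h.
Proof. by apply/colP => i; rewrite !mxE ltn_ord. Qed.

Lemma stepsS x h (k : 'I_d) :
  steps x h k.+1 = steps x h k + h k 0 *: basis_vec k.
Proof.
apply/colP => i; rewrite !mxE eqxx andbT -addrA; congr +%R.
rewrite ltnS; case: (ltngtP i k) => ik.
- by rewrite -val_eqE/= ltn_eqF// mulr0 addr0.
- by rewrite -val_eqE/= gtn_eqF// mulr0 addr0.
- by rewrite (val_inj ik) eqxx mulr1 add0r.
Qed.

Lemma steps_telescope f x h :
  f (x + h) - f x = \sum_(k < d) (f (steps x h k.+1) - f (steps x h k)).
Proof.
rewrite -(big_mkord xpredT (fun k => f (steps x h k.+1) - f (steps x h k))).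
by rewrite telescope_sumr// stepsn steps0.
Qed.

Lemma classG_derivable k f j : classG k.+1 f ->
  forall x, derivable f x (basis_vec j).
Proof. by case=> _ _ /(_ j)[]. Qed.

Lemma classG_partial k f j : classG k.+1 f -> classG k (partial j f).
Proof. by case=> _ _ /(_ j)[]. Qed.

Lemma classG_cont k f : classG k f -> continuous f.
Proof. by case: k => [|k] []. Qed.

Lemma classG_bounded k f : classG k f -> exists B : R, forall x, `|f x| <= B.
Proof. by case: k => [|k] []. Qed.

Lemma classG_partial_bounded k f : classG k.+1 f ->
  exists2 B : R, 0 <= B & forall j x, `|partial j f x| <= B.
Proof.
move=> Gf.
have /choice[B HB] : forall j, exists B, forall x, `|partial j f x| <= B.
  by move=> j; have [] := classG_bounded (classG_partial j Gf) => B; exists B.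
exists (\sum_j `|B j|); first exact: sumr_ge0.
move=> j x; rewrite (bigD1 j)//= (le_trans (HB j x))// ler_wpDr ?sumr_ge0//.
exact: ler_norm.
Qed.

Lemma classG1_lipschitz f : classG 1 f ->
  exists2 B : R, 0 <= B & forall x h, `|f (x + h) - f x| <= B * \sum_i `|h i 0|.
Proof.
move=> Gf; have [B B0 HB] := classG_partial_bounded Gf; exists B => // x h.
rewrite steps_telescope (le_trans (ler_norm_sum _ _ _))// mulr_sumr.
apply: ler_sum => k _; rewrite stepsS.
have [c _ ->] := partial_MVT (steps x h k) (h k 0) (@classG_derivable _ _ k Gf).
by rewrite normrM ler_wpM2r.
Qed.

Lemma classG_le k l f : (l <= k)%N -> classG k f -> classG l f.
Proof.
elim: k l f => [|k IH] [|l] f //=; first by move=> _ [? ? _].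
rewrite ltnS => lk [cf bf Hf]; split=> // j; have [dj Gj] := Hf j.
by split=> //; exact: IH.
Qed.

(** Along the staircase each move produces a partial derivative at a point
    that differs from x by at most h in each coordinate.  Partial derivatives
    are Lipschitz, so that moving them back to x costs a second factor of the
    size of h. *)
Lemma classG2_taylor f : classG 2 f ->
  exists2 K : R, 0 <= K & forall x h,
    `|f (x + h) - f x - \sum_i partial i f x * h i 0| <= K * nsq h.
Proof.
move=> Gf.
have /choice[B HB] : forall j, exists B, 0 <= B /\
    forall x h, `|partial j f (x + h) - partial j f x| <= B * \sum_i `|h i 0|.
  move=> j; have [B B0 H] := classG1_lipschitz (classG_partial j Gf).
  by exists B.
exists ((\sum_j B j) * d%:R).
  by rewrite mulr_ge0// sumr_ge0// => j _; case: (HB j).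
move=> x h; rewrite steps_telescope -sumrB.
rewrite (le_trans (ler_norm_sum _ _ _))//.
apply: (@le_trans _ _ (\sum_j B j * (\sum_i `|h i 0|) ^+ 2)); last first.
  rewrite -mulr_suml -mulrA ler_wpM2l ?sum_sqr_le_nsq//.
  by rewrite sumr_ge0// => j _; case: (HB j).
apply: ler_sum => k _; rewrite stepsS.
have [c ch ->] := partial_MVT (steps x h k) (h k 0) (@classG_derivable _ _ k Gf).
rewrite -mulrBl normrM expr2 mulrA.
have [Bk0 HBk] := HB k.
apply: ler_pM => //; last by rewrite (bigD1 k)//= lerDl sumr_ge0.
set y := steps x h k + _; rewrite -{1}(subrK x y) [y - x + x]addrC.
rewrite (le_trans (HBk _ _))// ler_wpM2l//; apply: ler_sum => i _.
rewrite /y !mxE eqxx andbT.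
rewrite (_ : _ - _ = (if (i < k)%N then h i 0 else 0) + c * (i == k)%:R); last by ring.
case: ltngtP => ik.
- by rewrite -val_eqE/= ltn_eqF// mulr0 addr0.
- by rewrite -val_eqE/= gtn_eqF// mulr0 addr0 normr0.
- by rewrite (val_inj ik) eqxx mulr1 add0r.
Qed.

(** The regularity carried through all compositions below.  It keeps exactly
    what a weak error estimate uses of a bound on two derivatives: the linear
    term cancels against centered noise, and the remainder sees its variance. *)
Definition quad_approx f (p : 'cV[R]_d -> 'cV[R]_d) (G K : R) : Prop :=
  [/\ continuous f, forall i, continuous (fun x => p x i 0),
      exists B : R, forall x, `|f x| <= B, forall x i, `|p x i 0| <= G
    & forall x h, `|f (x + h) - f x - \sum_i p x i 0 * h i 0| <= K * nsq h].

Lemma classG2_quad_approx f : classG 2 f ->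
  exists G K : R, [/\ 0 <= G, 0 <= K & quad_approx f (grad f) G K].
Proof.
move=> Gf; have [G G0 HG] := classG_partial_bounded Gf.
have [K K0 HK] := classG2_taylor Gf; exists G, K; split => //; split.
- exact: classG_cont Gf.
- move=> i; rewrite (_ : (fun x => _) = partial i f); last first.
    by apply/funext => x; rewrite mxE.
  exact/classG_cont/classG_partial/Gf.
- exact: classG_bounded Gf.
- by move=> x i; rewrite mxE.
- move=> x h; under eq_bigr do rewrite mxE.
  exact: HK.
Qed.

Lemma quad_approx_le f p G K G' K' : quad_approx f p G K ->
  G <= G' -> K <= K' -> quad_approx f p G' K'.
Proof.
move=> [cf cp bf Gp Kf] GG KK; split => //.
- by move=> x i; rewrite (le_trans (Gp x i)).
- by move=> x h; rewrite (le_trans (Kf x h))// ler_wpM2r// nsq_ge0.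
Qed.

Lemma col_continuous {T : topologicalType} (u : 'I_d -> T -> R) :
  (forall i, continuous (u i)) -> continuous (fun t => \col_i u i t : 'cV[R]_d).
Proof.
move=> cu t; apply/cvgrPdist_lt => e e0.
have : \forall s \near t, forall i, `|u i t - u i s| < e.
  apply: filter_forall => i; have /cvgrPdist_lt := cu i t; exact.
apply: filterS => s Hs; rewrite [ltLHS]/Num.norm/= mx_normrE.
apply/bigmax_ltP; split => // -[i j] _ /=; rewrite !mxE; exact: Hs.
Qed.

End taylor.

(** * Iterates of the Euler map *)

Section euler.
Context {R : realType} {d : nat}.
Implicit Types (b : 'cV[R]_d -> 'cV[R]_d) (v : 'cV[R]_d -> R).

(** A single constant serves all the estimates on a drift, so that error
    constants depend on the drift through L alone. *)
Definition tame_field b (L : R) : Prop :=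
  [/\ 0 <= L,
      forall i, quad_approx (fun x => b x i 0) (grad (fun x => b x i 0)) L L,
      forall x i, `|b x i 0| <= L
    & forall x y, nsq (b x - b y) <= L * nsq (x - y)].

Lemma classG_vec_tame b : classG_vec 2 b -> exists L, tame_field b L.
Proof.
move=> Gb.
have /choice[C HC] : forall i, exists C, [/\ 0 <= C,
    quad_approx (fun x => b x i 0) (grad (fun x => b x i 0)) C C,
    forall x, `|b x i 0| <= C
    & forall x h, `|b (x + h) i 0 - b x i 0| <= C * \sum_j `|h j 0|].
  move=> i; have [G [K [G0 K0 Q]]] := classG2_quad_approx (Gb i).
  have [B B0 HB] := classG1_lipschitz (classG_le (isT : (1 <= 2)%N) (Gb i)).
  have [B' HB'] := classG_bounded (Gb i).
  exists (G + K + B + `|B'|); split.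
  - by rewrite !addr_ge0.
  - by apply: quad_approx_le Q _ _; have := normr_ge0 B'; lra.
  - move=> x; rewrite (le_trans (HB' x))//; have := ler_norm B'; lra.
  - move=> x h; rewrite (le_trans (HB x h))// ler_wpM2r ?sumr_ge0//.
    by have := normr_ge0 B'; lra.
pose S := \sum_i C i; pose S2 := \sum_i C i ^+ 2.
have C0 i : 0 <= C i by case: (HC i).
have S0 : 0 <= S by exact: sumr_ge0.
have S20 : 0 <= S2 by apply: sumr_ge0 => i _; exact: sqr_ge0.
have CS i : C i <= S by rewrite /S (bigD1 i)//= lerDl sumr_ge0.
have D0 : 0 <= d%:R * S2 by rewrite mulr_ge0.
exists (S + d%:R * S2); split.
- by rewrite addr_ge0.
- move=> i; have [_ Q _ _] := HC i.
  by apply: quad_approx_le Q _ _; rewrite (le_trans (CS i)) ?lerDl.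
- move=> x i; have [_ _ Q _] := HC i.
  by rewrite (le_trans (Q x))// (le_trans (CS i)) ?lerDl.
- move=> x y; rewrite -{1}(subrK y x) [x - y + y]addrC; move: (x - y) => h.
  apply: (@le_trans _ _ (d%:R * S2 * nsq h)); last first.
    by rewrite ler_wpM2r ?nsq_ge0// lerDr.
  rewrite mulrAC mulrC /S2 mulr_suml; apply: ler_sum => i _; rewrite !mxE.
  have [_ _ _ Q] := HC i.
  rewrite -(real_normK (num_real (_ - _))).
  apply: (@le_trans _ _ ((C i * \sum_j `|h j 0|) ^+ 2)).
    by rewrite lerXn2r ?nnegrE ?mulr_ge0 ?sumr_ge0.
  by rewrite exprMn ler_wpM2l ?sqr_ge0// sum_sqr_le_nsq.
Qed.

Lemma tame_field_continuous b L : tame_field b L ->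
  forall i, continuous (fun x => b x i 0).
Proof. by move=> [_ Q _ _] i; case: (Q i). Qed.

Definition euler (eta : R) b (x : 'cV[R]_d) : 'cV[R]_d := x - eta *: b x.

Lemma euler_continuous (eta : R) b (L : R) : tame_field b L -> continuous (euler eta b).
Proof.
move=> tb; rewrite (_ : euler eta b =
    fun x => \col_i (x i 0 - eta * b x i 0)); last first.
  by apply/funext => y; apply/colP => i; rewrite !mxE.
suff H i : continuous (fun x : 'cV[R]_d => x i 0 - eta * b x i 0).
  exact: (col_continuous H).
move=> x; apply: (@continuousB _ _ _ (fun x : 'cV[R]_d => x i 0) (fun x => eta * b x i 0)).
  exact: coord_continuous.
apply: (@continuousM _ _ (cst eta) (fun x => b x i 0)).
  exact: cst_continuous.
exact: (tame_field_continuous tb).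
Qed.

(** By the chain rule the gradient p becomes p - eta Db^T p at the image
    point.  The remainder consists of K times the squared displacement of the
    images, which is at most 1 + O(eta) times that of the points, and of eta G
    times the remainders of the entries of b.  Both constants thus deteriorate
    by O(eta) in one step. *)
Lemma quad_approx_euler b (L eta : R) v p (G K : R) : tame_field b L ->
  0 < eta -> eta <= 1 -> quad_approx v p G K -> 0 <= G -> 0 <= K ->
  let a := d%:R * L + 1 + 2 * L in
  exists p', quad_approx (v \o euler eta b) p' (G * (1 + eta * a))
    (K * (1 + eta * a) + eta * (d%:R * L * G)).
Proof.
move=> tb e0 e1 [cv cp bv pG vK] G0 K0 a; have [L0 Q bL bLip] := tb.
have cE := euler_continuous (eta := eta) tb.
pose p' (x : 'cV[R]_d) : 'cV[R]_d := \col_j (p (euler eta b x) j 0 -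
  eta * \sum_i p (euler eta b x) i 0 * grad (fun y => b y i 0) x j 0).
exists p'; split.
- by move=> x; apply: (cvg_comp (euler eta b) v); [exact: cE|exact: cv].
- move=> j; rewrite (_ : (fun x => _) = fun x => p (euler eta b x) j 0 -
    eta * \sum_i p (euler eta b x) i 0 * grad (fun y => b y i 0) x j 0); last first.
    by apply/funext => x; rewrite mxE.
  have cpe i : continuous (fun x => p (euler eta b x) i 0).
    by move=> y; apply: (cvg_comp (euler eta b) (fun x => p x i 0));
      [exact: cE|exact: cp].
  move=> x; apply: (@continuousB _ _ _ (fun x => p (euler eta b x) j 0)
    (fun x => eta * \sum_i p (euler eta b x) i 0 *
                grad (fun y => b y i 0) x j 0)); first exact: cpe.
  apply: (@continuousM _ _ (cst eta) (fun x => \sum_i p (euler eta b x) i 0 *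
                grad (fun y => b y i 0) x j 0)); first exact: cst_continuous.
  apply: continuous_big => [|i _]; first exact: add_continuous.
  move=> y; apply: (@continuousM _ _ (fun x => p (euler eta b x) i 0)
    (fun x => grad (fun y => b y i 0) x j 0)); first exact: cpe.
  by have [_ + _ _ _] := Q i; exact.
- by have [B HB] := bv; exists B => x; exact: HB.
- move=> x j; rewrite mxE mulrDr mulr1 (le_trans (ler_normB _ _))// lerD//.
  rewrite normrM (gtr0_norm e0) mulrCA ler_wpM2l ?(ltW e0)//.
  rewrite (le_trans (ler_norm_sum _ _ _))//.
  apply: (@le_trans _ _ (\sum_(i < d) G * L)).
    apply: ler_sum => i _; rewrite normrM ler_pM//.
    by have [_ _ _ + _] := Q i; exact.
  rewrite sumr_const card_ord -mulr_natl mulrCA ler_wpM2l//.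
  by rewrite /a -addrA lerDl; lra.
- move=> x h; set y := euler eta b x; set k := euler eta b (x + h) - y.
  pose r i := b (x + h) i 0 - b x i 0 - \sum_j grad (fun y => b y i 0) x j 0 * h j 0.
  have Ek i : k i 0 = h i 0 - eta * (b (x + h) i 0 - b x i 0).
    by rewrite /k /y /euler !mxE; ring.
  have Ep : \sum_i p' x i 0 * h i 0 =
      \sum_i p y i 0 * k i 0 + eta * \sum_i p y i 0 * r i.
    under eq_bigr do rewrite mxE -/y mulrBl.
    rewrite sumrB mulr_sumr -big_split/=.
    under [X in _ - X]eq_bigr do rewrite -mulrA mulr_suml mulr_sumr.
    rewrite [X in _ - X]exchange_big/= -sumrB; apply: eq_bigr => i _.
    rewrite Ek /r.
    have -> : \sum_j eta * (p y i 0 * grad (fun y => b y i 0) x j 0 * h j 0) =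
       eta * (p y i 0 * \sum_j grad (fun y => b y i 0) x j 0 * h j 0).
      rewrite -mulr_sumr; congr (_ * _); rewrite mulr_sumr.
      by apply: eq_bigr => j _; rewrite mulrA.
    by ring.
  have nk : nsq k <= (1 + eta * a) * nsq h.
    have -> : k = h + (- eta) *: (b (x + h) - b x).
      by apply/colP => i; rewrite Ek !mxE; ring.
    rewrite (le_trans (nsqD_le _ _ e0))// nsqZ.
    have := bLip (x + h) x; rewrite [x + h - x]addrAC subrr add0r.
    have := nsq_ge0 h; move: (nsq h) (nsq (_ - _)) => u w u0 wu.
    have -> : (1 + eta^-1) * ((- eta) ^+ 2 * w) = eta * ((1 + eta) * w).
      by field; rewrite gt_eqF.
    have wL : (1 + eta) * w <= 2 * (L * u).
      have : (1 + eta) * w <= (1 + eta) * (L * u) by rewrite ler_wpM2l//; lra.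
      have Lu : 0 <= L * u by rewrite mulr_ge0.
      by move/le_trans; apply; rewrite ler_wpM2r//; lra.
    have dLu : 0 <= eta * (d%:R * L * u) by rewrite !mulr_ge0// ltW.
    have := ler_wpM2l (ltW e0) wL; rewrite /a; nra.
  rewrite Ep /= opprD addrA; apply: (le_trans (ler_normB _ _)).
  rewrite mulrDl lerD//.
    have := vK y k; rewrite [y + k]addrC /k subrK => /le_trans; apply.
    by rewrite -mulrA ler_wpM2l.
  rewrite normrM (gtr0_norm e0) -mulrA ler_wpM2l ?(ltW e0)//.
  rewrite (le_trans (ler_norm_sum _ _ _))//.
  apply: (@le_trans _ _ (\sum_(i < d) G * (L * nsq h))).
    apply: ler_sum => i _; rewrite normrM ler_pM//.
    by have [_ _ _ _ ] := Q i; exact.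
  by rewrite sumr_const card_ord -mulr_natl le_eqVlt; apply/orP; left; apply/eqP; ring.
Qed.

(** A deterioration by O(eta) per step amounts to a bounded factor over
    T / eta steps, since (1 + eta a)^j <= exp (a T).  The functions v o Phi^j
    are therefore regular uniformly in eta and j. *)
Lemma quad_approx_iter_euler b (L : R) v p (G K T : R) : tame_field b L ->
  quad_approx v p G K -> 0 <= G -> 0 <= K ->
  exists G' K' : R, [/\ 0 <= G', 0 <= K' & forall (eta : R) j, 0 < eta -> eta <= 1 ->
    j%:R * eta <= T ->
    exists p', quad_approx (v \o iter j (euler eta b)) p' G' K'].
Proof.
move=> tb Qv G0 K0; have [L0 _ _ _] := tb.
set a := d%:R * L + 1 + 2 * L; set c := d%:R * L.
have a0 : 0 <= a by rewrite /a !addr_ge0// !mulr_ge0.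
have c0 : 0 <= c by rewrite mulr_ge0.
exists (G * expR (a * T)), ((K + `|T| * c * G) * expR (a * T) ^+ 2); split.
- by rewrite mulr_ge0// expR_ge0.
- by rewrite mulr_ge0 ?sqr_ge0// addr_ge0// !mulr_ge0.
move=> eta j e0 e1 jT; set A := 1 + eta * a.
have A1 : 1 <= A by rewrite lerDl mulr_ge0// ltW.
have A0 : 0 <= A by exact: le_trans A1.
have AT : A ^+ j <= expR (a * T).
  rewrite (@le_trans _ _ (expR (eta * a) ^+ j))//.
    by rewrite lerXn2r ?nnegrE ?expR_ge0 ?expR_ge1Dx.
  rewrite -expRM_natl ler_expR (_ : _ * _ = a * (j%:R * eta)) ?ler_wpM2l//.
  by rewrite [eta * a]mulrC mulrCA.
have [p' Q'] : exists p', quad_approx (v \o iter j (euler eta b)) p'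
    (G * A ^+ j) ((K + j%:R * eta * c * G) * A ^+ (2 * j)).
  elim: j {jT AT} => [|j [p' IH]].
    by exists p; rewrite /= !mul0r muln0 !expr0 !mulr1 addr0.
  have [||p'' H] := quad_approx_euler tb e0 e1 IH _ _.
  - by rewrite mulr_ge0// exprn_ge0.
  - by rewrite mulr_ge0 ?exprn_ge0// addr_ge0// !mulr_ge0// ltW.
  exists p''; rewrite (_ : v \o _ = (v \o iter j (euler eta b)) \o euler eta b).
    apply: quad_approx_le H _ _; rewrite -/a -/c -/A.
      by rewrite exprSr mulrA.
    rewrite mulnS exprD expr2 -natr1.
    have AA : A ^+ j <= A * A * A ^+ (2 * j).
      rewrite -mulrA -!exprS; apply: ler_weXn2l => //.
      by rewrite mul2n -addnn -!addnS leq_addr.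
    have KA : 0 <= (K + j%:R * eta * c * G) * A ^+ (2 * j).
      by rewrite mulr_ge0 ?exprn_ge0// addr_ge0// !mulr_ge0// ltW.
    have cA : 0 <= eta * c * G by rewrite !mulr_ge0// ltW.
    have -> : (K + (j%:R + 1) * eta * c * G) * (A * A * A ^+ (2 * j)) =
      (K + j%:R * eta * c * G) * A ^+ (2 * j) * A * A +
      eta * c * G * (A * A * A ^+ (2 * j)) by ring.
    apply: lerD; first by rewrite ler_peMr// mulr_ge0.
    by rewrite (_ : eta * _ = eta * c * G * A ^+ j) ?ler_wpM2l//; ring.
  by apply/funext => x; rewrite /comp -iterSr.
apply: (ex_intro _ p'); apply: quad_approx_le Q' _ _.
  by rewrite ler_wpM2l.
apply: ler_pM; rewrite ?exprn_ge0// ?addr_ge0// ?mulr_ge0// ?(ltW e0)//.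
  rewrite lerD2l !ler_wpM2r//.
  by rewrite (le_trans jT) ?ler_norm.
by rewrite mulnC exprM lerXn2r// nnegrE ?exprn_ge0 ?expR_ge0.
Qed.

End euler.

(** * Measurability of composed functions *)

Section measurability.
Context {R : realType} {disp : measure_display} {T : measurableType disp}.

Lemma measurable_glue {disp' : measure_display} {U : measurableType disp'}
    {K : countType} (k : T -> K) (F : K -> T -> U) :
  (forall i, measurable (k @^-1` [set i])) ->
  (forall i, measurable_fun setT (F i)) ->
  measurable_fun setT (fun w => F (k w) w).
Proof.
move=> mk mF _ B mB; rewrite setTI.
rewrite (_ : _ @^-1` _ = \bigcup_n (if unpickle n is Some i then
    k @^-1` [set i] `&` F i @^-1` B else set0)).
  apply: bigcupT_measurable => n; case: unpickle => // i.
  by apply: measurableI => //; rewrite -[_ @^-1` B]setTI; exact: mF.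
apply/seteqP; split => [w Bw|w [n _]].
  by exists (pickle (k w)) => //; rewrite pickleK.
by case: unpickle => // i [<-].
Qed.

Lemma measurable_floor_fiber (X : T -> R) (k : int) :
  measurable_fun setT X -> measurable ((fun w => Num.floor (X w)) @^-1` [set k]).
Proof.
move=> mX; rewrite (_ : _ @^-1` _ = X @^-1` `[k%:~R, (k + 1)%:~R[%classic).
  by rewrite -[_ @^-1` _]setTI; exact: mX.
apply/seteqP; split => w /=; rewrite in_itv/=.
  by move=> <-; exact: floor_itv.
exact: floor_def.
Qed.

Lemma cvg_floor_grid (x : R) :
  (Num.floor (x * n.+1%:R))%:~R / n.+1%:R @[n --> \oo] --> x.
Proof.
apply/cvgrPdist_lt => e e0; near=> n.
have n0 : (0 : R) < n.+1%:R by [].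
have /andP[H1 H2] := floor_itv (x * n.+1%:R).
rewrite ger0_norm; last by rewrite subr_ge0 ler_pdivrMr.
apply: (@lt_trans _ _ n.+1%:R^-1).
  by rewrite ltrBlDr -[X in X + _]mul1r -mulrDl ltr_pdivlMr// addrC; rewrite intrD in H2.
by near: n; exact: near_infty_natSinv_lt (PosNum e0).
Unshelve. all: by end_near. Qed.

(** Rounding X to a grid of mesh 1 / (n + 1) glues countably many sections of
    h; continuity in the first variable gives the limit. *)
Lemma measurable_caratheodory (X : T -> R) (h : R -> T -> R) :
  measurable_fun setT X -> (forall c, measurable_fun setT (h c)) ->
  (forall w, continuous (h^~ w)) -> measurable_fun setT (fun w => h (X w) w).
Proof.
move=> mX mh ch.
apply: (@measurable_fun_cvg _ _ _ _ (fun n w =>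
   h ((Num.floor (X w * n.+1%:R))%:~R / n.+1%:R) w)).
  move=> n; apply: (@measurable_glue _ _ _ (fun w => Num.floor (X w * n.+1%:R))
    (fun k => h (k%:~R / n.+1%:R))) => // k.
  by apply: measurable_floor_fiber; exact: measurable_funM.
move=> w _; apply: (cvg_comp (fun n => (Num.floor (X w * n.+1%:R))%:~R / n.+1%:R) (h^~ w)).
  exact: cvg_floor_grid.
exact: ch.
Qed.

(** The coordinates of X are substituted one at a time, each substitution
    being an instance of the previous lemma. *)
Lemma measurable_continuous_col {d : nat} (phi : 'cV[R]_d -> R)
    (X : T -> 'cV[R]_d) : continuous phi ->
  (forall i, measurable_fun setT (fun w => X w i 0)) ->
  measurable_fun setT (fun w => phi (X w)).
Proof.
move=> cphi mX.
pose mix k (y : 'cV[R]_d) w : 'cV[R]_d :=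
  \col_i (if (i < k)%N then X w i 0 else y i 0).
suff H k y : measurable_fun setT (fun w => phi (mix k y w)).
  have := H d 0; congr measurable_fun; apply/funext => w; congr phi.
  by apply/colP => i; rewrite mxE ltn_ord.
elim: k y => [|k IH] y.
  rewrite (_ : (fun w => _) = cst (phi y)); first exact: measurable_cst.
  by apply/funext => w; congr phi; apply/colP => i; rewrite mxE.
have [dk|kd] := leqP d k.
  have := IH y; congr measurable_fun; apply/funext => w; congr phi.
  apply/colP => i; rewrite !mxE.
  by rewrite (leq_trans (ltn_ord i) dk) (leq_trans (ltn_ord i) (leqW dk)).
pose o := Ordinal kd.
pose z c : 'cV[R]_d := \col_i (if i == o then c else y i 0).
have := @measurable_caratheodory (fun w => X w o 0)
  (fun c w => phi (mix k (z c) w)) (mX o) (fun c => IH (z c)).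
rewrite (_ : (fun w => phi (mix k (z (X w o 0)) w)) =
  (fun w => phi (mix k.+1 y w))); last first.
  apply/funext => w; congr phi; apply/colP => i; rewrite !mxE ltnS.
  case: ltngtP => // ik.
    by rewrite -val_eqE/= gtn_eqF.
  by rewrite (_ : i = o) ?eqxx//; exact: val_inj.
apply => w c; apply: (cvg_comp (fun c => mix k (z c) w) phi); last exact: cphi.
apply: (@col_continuous _ _ _ (fun i c => if (i < k)%N then X w i 0 else z c i 0)).
move=> i; case: (i < k)%N; first exact: cst_continuous.
rewrite (_ : (fun _ => _) = fun c' => if i == o then c' else y i 0); last first.
  by apply/funext => c'; rewrite mxE.
by case: eqP => _ c'; [exact: cvg_id|exact: cst_continuous].
Qed.

Lemma measurable_wrtP (G : set (set T)) (X : T -> R) : sigma_algebra setT G ->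
  measurable_wrt G X <->
  measurable_fun setT (X : g_sigma_algebraType G -> R).
Proof.
move=> sG; split => [GX _ B mB|mX B mB].
  by rewrite setTI; apply: sub_gen_smallest; exact: GX.
have := mX measurableT B mB; rewrite setTI.
by rewrite -[X in X -> _]/(G.-sigma.-measurable _) measurable_g_measurableTypeE.
Qed.

Lemma measurable_wrt_measurable (G : set (set T)) (X : T -> R) :
  G `<=` measurable -> measurable_wrt G X -> measurable_fun setT X.
Proof. by move=> Gm GX _ B mB; rewrite setTI; exact/Gm/GX. Qed.

End measurability.

(** * Expectations and conditional means *)

Section expectation.
Context {R : realType} {disp : measure_display} {T : measurableType disp}.
Variable P : probability T R.
Implicit Types X Y : T -> R.

Local Notation Ex X := (\int[P]_w X w)%R.

Definition L1 X := P.-integrable setT (EFin \o X).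

Lemma L1_measurable X : L1 X -> measurable_fun setT X.
Proof. by move=> /measurable_int/measurable_EFinP. Qed.

Lemma expectationE X : L1 X -> ('E_P[X])%E = (Ex X)%:E.
Proof. by move=> iX; rewrite unlock /Rintegral fineK//; exact: integrable_fin_num. Qed.

Lemma L1_le X Y : measurable_fun setT X -> (forall w, `|X w| <= Y w) -> L1 Y ->
  L1 X.
Proof.
move=> mX XY; apply: le_integrable => //; first exact/measurable_EFinP.
move=> w _ /=; rewrite lee_fin (le_trans (XY w))//; exact: ler_norm.
Qed.

Lemma L1_cst c : L1 (cst c).
Proof. exact: finite_measure_integrable_cst. Qed.

Lemma L1_bounded X c : measurable_fun setT X -> (forall w, `|X w| <= c) -> L1 X.
Proof. by move=> mX Xc; apply: (@L1_le _ (cst c)) => //; exact: L1_cst. Qed.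

Lemma L1D X Y : L1 X -> L1 Y -> L1 (fun w => X w + Y w).
Proof.
move=> iX iY; rewrite /L1 (_ : _ \o _ = (EFin \o X) \+ (EFin \o Y))%E.
  exact: integrableD.
by apply/funext => w.
Qed.

Lemma L1Z c X : L1 X -> L1 (fun w => c * X w).
Proof.
move=> iX; rewrite /L1 (_ : _ \o _ = (fun w => c%:E * (EFin \o X) w)%E).
  exact: integrableZl.
by apply/funext => w.
Qed.

Lemma L1N X : L1 X -> L1 (fun w => - X w).
Proof.
by move=> iX; rewrite (_ : (fun w => _) = (fun w => -1 * X w)); [exact: L1Z|
  apply/funext => w; rewrite mulN1r].
Qed.

Lemma L1B X Y : L1 X -> L1 Y -> L1 (fun w => X w - Y w).
Proof. by move=> iX iY; apply: L1D => //; exact: L1N. Qed.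

Lemma L1_abs X : L1 X -> L1 (fun w => `|X w|).
Proof. exact: integrable_norm. Qed.

Lemma L1_sum {I : Type} (s : seq I) (F : I -> T -> R) :
  (forall i, L1 (F i)) -> L1 (fun w => \sum_(i <- s) F i w).
Proof.
move=> iF; elim: s => [|i s IH].
  by rewrite (_ : (fun w => _) = cst 0); [exact: L1_cst|
    apply/funext => w; rewrite big_nil].
rewrite (_ : (fun w => _) = (fun w => F i w + \sum_(j <- s) F j w)).
  exact: L1D.
by apply/funext => w; rewrite big_cons.
Qed.

Lemma ExD X Y : L1 X -> L1 Y -> Ex (fun w => X w + Y w) = Ex X + Ex Y.
Proof. exact: RintegralD. Qed.

Lemma ExB X Y : L1 X -> L1 Y -> Ex (fun w => X w - Y w) = Ex X - Ex Y.
Proof. exact: RintegralB. Qed.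

Lemma ExZ c X : L1 X -> Ex (fun w => c * X w) = c * Ex X.
Proof. exact: RintegralZl. Qed.

Lemma Ex_cst c : Ex (cst c) = c.
Proof.
by rewrite Rintegral_cst// (_ : fine _ = 1) ?mulr1//
  [X in fine X](@probability_setT _ _ _ P).
Qed.

Lemma Ex_sum {I : Type} (s : seq I) (F : I -> T -> R) : (forall i, L1 (F i)) ->
  Ex (fun w => \sum_(i <- s) F i w) = \sum_(i <- s) Ex (F i).
Proof.
move=> iF; elim: s => [|i s IH].
  rewrite big_nil -[RHS](Ex_cst 0); congr Rintegral.
  by apply/funext => w; rewrite big_nil.
rewrite big_cons -IH -ExD//; last exact: L1_sum.
by congr Rintegral; apply/funext => w; rewrite big_cons.
Qed.

Lemma Ex_le X Y : L1 X -> L1 Y -> (forall w, X w <= Y w) -> Ex X <= Ex Y.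
Proof. by move=> iX iY XY; apply: le_Rintegral. Qed.

Lemma Ex_ge0 X : (forall w, 0 <= X w) -> 0 <= Ex X.
Proof. by move=> X0; apply: Rintegral_ge0. Qed.

Lemma Ex_abs_le X Y : L1 X -> L1 Y -> (forall w, `|X w| <= Y w) ->
  `|Ex X| <= Ex Y.
Proof.
move=> iX iY XY; rewrite (le_trans (le_normr_Rintegral _ iX))//.
by apply: Ex_le => //; exact: L1_abs.
Qed.

Lemma Ex_ae_eq X Y : measurable_fun setT X -> measurable_fun setT Y ->
  {ae P, forall w, X w = Y w} -> Ex X = Ex Y.
Proof.
move=> mX mY XY; congr fine; apply: ae_eq_integral => //.
- exact/measurable_EFinP.
- exact/measurable_EFinP.
- by apply: filterS XY => w /= -> .
Qed.

Lemma L1_ae_eq X Y : L1 X -> measurable_fun setT Y ->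
  {ae P, forall w, X w = Y w} -> L1 Y.
Proof.
move=> iX mY XY; have /integrableP[mX Xoo] := iX.
apply/integrableP; split; first exact/measurable_EFinP.
rewrite (@ge0_ae_eq_integral _ _ _ P setT _ (fun w => `|(X w)%:E|)%E)//.
- by apply: measurableT_comp => //; exact/measurable_EFinP.
- exact: measurableT_comp.
- by apply: filterS XY => w /= -> .
Qed.

Lemma L1_lee X (c : \bar R) : measurable_fun setT X -> (forall w, 0 <= X w) ->
  (\int[P]_w (X w)%:E <= c)%E -> (c < +oo)%E -> L1 X /\ ((Ex X)%:E <= c)%E.
Proof.
move=> mX X0 Xc cy.
have iX : L1 X.
  apply/integrableP; split; first exact/measurable_EFinP.
  under eq_integral do rewrite /= ger0_norm//.
  exact: le_lt_trans cy.
by split=> //; rewrite -expectationE// unlock.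
Qed.

Lemma Ex_dominated_cvg (X_ : (T -> R)^nat) X Y :
  (forall n, measurable_fun setT (X_ n)) -> measurable_fun setT X ->
  (forall w, X_ n w @[n --> \oo] --> X w) -> L1 Y ->
  (forall n w, `|X_ n w| <= Y w) -> Ex (X_ n) @[n --> \oo] --> Ex X.
Proof.
move=> mX_ mX XX iY XY.
have [||||iX _ H] := @dominated_convergence _ T R P setT measurableT
  (fun n => EFin \o X_ n) (EFin \o X) (EFin \o Y) _ _ _ iY _.
- by move=> n; exact/measurable_EFinP.
- exact/measurable_EFinP.
- by apply: aeW => w _; apply: cvg_EFin; [exact: nearW|exact: XX].
- by apply: aeW => w n _; rewrite /= lee_fin.
apply: fine_cvg; move: H; rewrite [X in _ --> X]fineK//.
  exact: integrable_fin_num.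
Qed.

Definition L2 X := measurable_fun setT X /\ L1 (fun w => X w ^+ 2).

Lemma L2_L1 X : L2 X -> L1 X.
Proof.
move=> [mX iX]; apply: (L1_le mX) (L1D (L1_cst 1) iX) => w.
rewrite -(real_normK (num_real (X w))).
by have := sqr_ge0 (`|X w| - 1); have := normr_ge0 (X w); rewrite /cst; nra.
Qed.

Lemma L1M X Y : L2 X -> L2 Y -> L1 (fun w => X w * Y w).
Proof.
move=> [mX iX] [mY iY]; apply: (L1_le _ _ (L1D iX iY)).
  exact: measurable_funM.
move=> w; rewrite normrM.
rewrite -(real_normK (num_real (X w))) -(real_normK (num_real (Y w))).
have := sqr_ge0 (`|X w| - `|Y w|); have := normr_ge0 (X w).
by have := normr_ge0 (Y w); nra.
Qed.

Lemma L2Z c X : L2 X -> L2 (fun w => c * X w).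
Proof.
move=> [mX iX]; split; first exact: measurable_funM.
rewrite (_ : (fun w => _) = (fun w => c ^+ 2 * X w ^+ 2)); first exact: L1Z.
by apply/funext => w; rewrite exprMn.
Qed.

Lemma L2D X Y : L2 X -> L2 Y -> L2 (fun w => X w + Y w).
Proof.
move=> iX iY; have [mX jX] := iX; have [mY jY] := iY.
split; first exact: measurable_funD.
rewrite (_ : (fun w => _) =
    (fun w => X w ^+ 2 + Y w ^+ 2 + 2 * (X w * Y w))).
  by apply: L1D; [exact: L1D|apply: L1Z; exact: L1M].
by apply/funext => w; ring.
Qed.

Lemma L2N X : L2 X -> L2 (fun w => - X w).
Proof.
move=> iX; rewrite (_ : (fun w => _) = (fun w => -1 * X w)); first exact: L2Z.
by apply/funext => w; rewrite mulN1r.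
Qed.

Lemma L2M_bounded X Y c : L2 X -> measurable_fun setT Y ->
  (forall w, `|Y w| <= c) -> L2 (fun w => Y w * X w).
Proof.
move=> [mX iX] mY Yc; split; first exact: measurable_funM.
apply: (L1_le _ _ (L1Z (c ^+ 2) iX)).
  by apply: measurable_funX; exact: measurable_funM.
move=> w; rewrite exprMn normrM ger0_norm ?sqr_ge0// ger0_norm ?sqr_ge0//.
rewrite ler_wpM2r ?sqr_ge0// -(real_normK (num_real (Y w))).
by rewrite lerXn2r ?nnegrE// (le_trans _ (Yc w)).
Qed.

Lemma L2_cst c : L2 (cst c).
Proof. by split=> //; exact: (L1_cst (c ^+ 2)). Qed.

Lemma L2_bounded X c : measurable_fun setT X -> (forall w, `|X w| <= c) -> L2 X.
Proof.
move=> mX Xc; rewrite (_ : X = fun w => X w * cst 1 w).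
  by apply: L2M_bounded Xc => //; exact: L2_cst.
by apply/funext => w; rewrite mulr1.
Qed.

Lemma L2_sum {I : Type} (s : seq I) (F : I -> T -> R) :
  (forall i, L2 (F i)) -> L2 (fun w => \sum_(i <- s) F i w).
Proof.
move=> iF; elim: s => [|i s IH].
  by rewrite (_ : (fun w => _) = cst 0); [exact: L2_cst|
    apply/funext => w; rewrite big_nil].
rewrite (_ : (fun w => _) = (fun w => F i w + \sum_(j <- s) F j w)).
  exact: L2D.
by apply/funext => w; rewrite big_cons.
Qed.

Lemma L2_ae_eq X Y : L2 X -> measurable_fun setT Y ->
  {ae P, forall w, X w = Y w} -> L2 Y.
Proof.
move=> [mX iX] mY XY; split => //; apply: (L1_ae_eq iX).
  exact: measurable_funX.
by apply: filterS XY => w ->.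
Qed.

Import HBNNSimple.

(** The hypothesis says that U has the constant conditional mean m given G.
    It passes from events to weights along simple functions, their limits, and
    positive and negative parts. *)
Lemma Ex_weight (G : set (set T)) U m zeta : sigma_algebra setT G ->
  G `<=` measurable -> L1 U ->
  (forall A, G A -> Ex (fun w => \1_A w * U w) = m * Ex (\1_A)) ->
  measurable_wrt G zeta -> L1 zeta -> L1 (fun w => zeta w * U w) ->
  Ex (fun w => zeta w * U w) = m * Ex zeta.
Proof.
move=> sG Gm iU HU.
have mwrt X : measurable_wrt G X -> measurable_fun setT X.
  exact: measurable_wrt_measurable.
have L1_1 A : G A -> L1 (\1_A : T -> R).
  move=> GA; apply: (@L1_bounded _ 1); first exact/measurable_indic/Gm.
  by move=> w; rewrite indicE; case: (_ \in _); rewrite ?normr1 ?normr0.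
have L1_1U A : G A -> L1 (fun w => \1_A w * U w).
  move=> GA; apply: (L1_le _ _ (L1_abs iU)).
    by apply: measurable_funM; [exact/measurable_indic/Gm|exact: L1_measurable].
  move=> w; rewrite normrM indicE ler_piMl//.
  by case: (_ \in _); rewrite ?normr1 ?normr0.
have simple (h : {nnsfun (g_sigma_algebraType G) >-> R}) :
    L1 h /\ L1 (fun w => h w * U w) /\ Ex (fun w => h w * U w) = m * Ex h.
  have Gh y : G (h @^-1` [set y]).
    have : measurable_fun setT (h : g_sigma_algebraType G -> R) by [].
    by move/(measurable_wrtP _ sG); apply; exact: measurable_set1.
  pose s := finmap.enum_fset (fset_set (range h)).
  have hE w : h w = \sum_(y <- s) y * \1_(h @^-1` [set y]) w.
    by rewrite fimfunE fsbig_finite.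
  have hE' : (h : T -> R) = fun w => \sum_(y <- s) y * \1_(h @^-1` [set y]) w.
    by apply/funext => w.
  have hU : (fun w => h w * U w) =
      fun w => \sum_(y <- s) y * (\1_(h @^-1` [set y]) w * U w).
    apply/funext => w; rewrite hE mulr_suml.
    by apply: eq_bigr => y _; rewrite mulrA.
  have GU y := L1Z y (L1_1U _ (Gh y)); have GI y := L1Z y (L1_1 _ (Gh y)).
  split; first by rewrite hE'; exact: (L1_sum _ GI).
  split; first by rewrite hU; exact: (L1_sum _ GU).
  have -> : Ex h = \sum_(y <- s) y * Ex (\1_(h @^-1` [set y])).
    rewrite [in LHS]hE' (Ex_sum _ GI); apply: eq_bigr => y _.
    by rewrite ExZ//; exact: L1_1.
  rewrite hU (Ex_sum _ GU) mulr_sumr; apply: eq_bigr => y _.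
  by rewrite ExZ; [rewrite HU// mulrCA|exact: L1_1U].
have nneg Z : (forall w, 0 <= Z w) -> measurable_wrt G Z -> L1 Z ->
    L1 (fun w => Z w * U w) -> Ex (fun w => Z w * U w) = m * Ex Z.
  move=> Z0 /[dup] GZ /(measurable_wrtP _ sG) mZ iZ iZU.
  have mZ' : measurable_fun setT (EFin \o Z : g_sigma_algebraType G -> \bar R).
    exact/measurable_EFinP.
  pose h := nnsfun_approx measurableT mZ'.
  have hZ w : h n w @[n --> \oo] --> Z w.
    have Z0' x : setT x -> (0 <= (EFin \o Z) x)%E by rewrite lee_fin.
    by have /fine_cvg := @cvg_nnsfun_approx _ _ _ _ measurableT _ mZ' Z0' w Logic.I.
  have hleZ n w : `|h n w| <= `|Z w|.
    rewrite !ger0_norm//.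
    have := @nondecreasing_cvgn_le _ (fun n => h n w).
    move=> /(_ _ _ n); rewrite (cvg_lim _ (hZ w))//; apply.
      by move=> a b ab; exact/lefP/nd_nnsfun_approx.
    exact: hZ.
  have H1 := @Ex_dominated_cvg (fun n => h n : T -> R) Z (fun w => `|Z w|)
    (fun n => L1_measurable (simple (h n)).1) (mwrt _ GZ) hZ (L1_abs iZ) hleZ.
  have H2 : Ex (fun w => h n w * U w) @[n --> \oo] --> Ex (fun w => Z w * U w).
    apply: (@Ex_dominated_cvg _ _ (fun w => `|Z w * U w|)).
    - by move=> n; exact: L1_measurable (simple (h n)).2.1.
    - exact: L1_measurable.
    - by move=> w; apply: cvgM; [exact: hZ|exact: cvg_cst].
    - exact: L1_abs.
    - by move=> n w; rewrite !normrM ler_wpM2r.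
  have H3 : m * Ex (h n) @[n --> \oo] --> m * Ex Z.
    by apply: cvgM => //; exact: cvg_cst.
  have E : (fun n => m * Ex (h n)) = (fun n => Ex (fun w => h n w * U w)).
    by apply/funext => n; rewrite (simple (h n)).2.2.
  by rewrite E in H3; exact: (cvg_unique _ H2 H3).
move=> Gz iz izU.
have /(measurable_wrtP _ sG) mz := Gz.
have iU' := L1_measurable iU.
have part z : measurable_wrt G z -> (forall w, `|z w| <= `|zeta w|) ->
    L1 z /\ L1 (fun w => z w * U w).
  move=> /mwrt mz' le; split; first exact: (L1_le mz' le (L1_abs iz)).
  apply: (L1_le _ _ (L1_abs izU)); first exact: measurable_funM.
  by move=> w; rewrite !normrM ler_wpM2r.
have absE w : `|zeta w| = zeta^\+ w + zeta^\- w.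
  exact: (esym (congr1 (fun f => f w) (funrposDneg zeta))).
have [ip ipU] : L1 (zeta^\+) /\ L1 (fun w => (zeta^\+) w * U w).
  apply: part; first by apply/(measurable_wrtP _ sG); exact: measurable_funrpos.
  by move=> w; rewrite absE ger0_norm ?funrpos_ge0// lerDl funrneg_ge0.
have [im imU] : L1 (zeta^\-) /\ L1 (fun w => (zeta^\-) w * U w).
  apply: part; first by apply/(measurable_wrtP _ sG); exact: measurable_funrneg.
  by move=> w; rewrite absE ger0_norm ?funrneg_ge0// lerDr funrpos_ge0.
rewrite (_ : (fun w => zeta w * U w) =
    (fun w => (zeta^\+) w * U w - (zeta^\-) w * U w)); last first.
  by apply/funext => w; rewrite -mulrBl -[in LHS](funrposBneg zeta).
rewrite [in RHS](_ : zeta = (fun w => (zeta^\+) w - (zeta^\-) w)); last first.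
  by rewrite -[in LHS](funrposBneg zeta).
rewrite !ExB// mulrBr; congr (_ - _); apply: nneg => //.
- by apply/(measurable_wrtP _ sG); exact: measurable_funrpos.
- by apply/(measurable_wrtP _ sG); exact: measurable_funrneg.
Qed.

End expectation.

(** * Moments of Gaussian variables *)

Section normal_moments.
Context {R : realType}.
Local Notation mu := (@lebesgue_measure R).

Import HBNNSimple.

(** The bound holds on the simple functions below f, whose integrals have the
    left-hand side as their supremum. *)
Lemma ge0_integral_le_density (nu : {measure set (measurableTypeR R) -> \bar R})
    (rho : R -> R) (f : R -> \bar R) :
  (forall x, 0 <= rho x) -> measurable_fun setT rho ->
  (forall B, measurable B -> nu B = \int[mu]_(x in B) (rho x)%:E)%E ->
  (forall x, 0 <= f x)%E -> measurable_fun setT f ->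
  (\int[nu]_x f x <= \int[mu]_x (f x * (rho x)%:E))%E.
Proof.
move=> rho0 mrho nuE f0 mf; rewrite [leLHS]ge0_integralTE//.
apply: ge_ereal_sup => _ [h /= hf <-].
have mh : measurable_fun setT (EFin \o h) by exact/measurable_EFinP.
have mr : measurable_fun setT (EFin \o rho) by exact/measurable_EFinP.
apply: (@le_trans _ _ (\int[mu]_x ((h x)%:E * (rho x)%:E))%E); last first.
  apply: ge0_le_integral => //.
  - by move=> x _; rewrite mule_ge0 ?lee_fin.
  - exact: emeasurable_funM.
  - exact: emeasurable_funM.
  - by move=> x _; rewrite lee_wpmul2r ?lee_fin.
rewrite sintegralE.
have -> : (\int[mu]_x ((h x)%:E * (rho x)%:E) =
    \int[mu]_x (\sum_(y \in range h) (y * \1_(h @^-1` [set y]) x)%:E * (rho x)%:E))%E.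
  apply: eq_integral => x _; rewrite -ge0_mule_fsuml; last first.
    by move=> y; rewrite EFinM nnfun_muleindic_ge0.
  by rewrite fsumEFin// -fimfunE.
rewrite ge0_integral_fsum//; last 2 first.
- move=> y; apply: emeasurable_funM => //; apply/measurable_EFinP.
  exact: measurable_funM.
- move=> y x _; apply: mule_ge0; last by rewrite lee_fin.
  by rewrite EFinM nnfun_muleindic_ge0.
rewrite le_eqVlt; apply/orP; left; apply/eqP; apply: eq_fsbigr => y.
rewrite inE => -[z _ <-].
have y0 : (0 <= (h z)%:E)%E by rewrite lee_fin.
rewrite nuE// -ge0_integralZl//.
- rewrite [LHS]integral_mkcond; apply: eq_integral => x _; rewrite patchE indicE.
  by case: ifPn => _; rewrite ?mulr1 ?mulr0 ?mul0e ?mule0.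
- exact: measurable_funTS.
- by move=> x _; rewrite lee_fin.
Qed.

(** The factor y = (x / s)^2 is absorbed by a part of the Gaussian weight,
    since y <= 4 exp (3 y / 8); what remains is a Gaussian with twice the
    deviation.  A second moment is thereby bounded by a total mass. *)
Lemma sqr_normal_pdf_le (s x : R) : 0 < s ->
  x ^+ 2 * normal_pdf 0 s x <= 8 * s ^+ 2 * normal_pdf 0 (2 * s) x.
Proof.
move=> s0; have s0' : s != 0 by rewrite gt_eqF.
have s20 : 2 * s != 0 by rewrite mulf_neq0.
rewrite !normal_pdfE// /normal_peak /normal_fun !subr0.
have -> : Num.sqrt ((2 * s) ^+ 2 * pi *+ 2) = 2 * Num.sqrt (s ^+ 2 * pi *+ 2).
  by rewrite exprMn -mulrA -mulrnAr sqrtrM ?sqr_ge0// sqrtr_sqr ger0_norm.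
have k0 : 0 < Num.sqrt (s ^+ 2 * pi *+ 2).
  by rewrite sqrtr_gt0 pmulrn_lgt0// mulr_gt0 ?pi_gt0// exprn_gt0.
set k := Num.sqrt _ in k0 *; rewrite invfM.
set y := x ^+ 2 / (s ^+ 2).
have -> : - x ^+ 2 / (s ^+ 2 *+ 2) = - (y / 2) by rewrite /y; field.
have -> : - x ^+ 2 / ((2 * s) ^+ 2 *+ 2) = 3 / 8 * y - (y / 2).
  by rewrite /y; field.
rewrite expRD; set e := expR (- _).
have -> : x ^+ 2 = s ^+ 2 * y by rewrite /y; field.
have y0 : 0 <= y by rewrite /y divr_ge0 ?sqr_ge0.
have H : y <= 4 * expR (3 / 8 * y).
  by have := expR_ge1Dx (3 / 8 * y); lra.
have c0 : 0 <= s ^+ 2 * (k^-1 * e).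
  by rewrite !mulr_ge0 ?sqr_ge0 ?invr_ge0 ?expR_ge0// ltW.
have -> : s ^+ 2 * y * (k^-1 * e) = s ^+ 2 * (k^-1 * e) * y by ring.
have -> : 8 * s ^+ 2 * (2^-1 * k^-1 * (expR (3 / 8 * y) * e)) =
   s ^+ 2 * (k^-1 * e) * (4 * expR (3 / 8 * y)) by field; rewrite gt_eqF.
by rewrite ler_wpM2l.
Qed.

Lemma normal_probN (s : R) (B : set R) : s != 0 -> measurable B ->
  normal_prob 0 s (-%R @^-1` B) = normal_prob 0 s B.
Proof.
move=> s0 mB; rewrite /normal_prob.
have mN : measurable_fun setT (-%R : measurableTypeR R -> measurableTypeR R) by [].
have pdfN x : normal_pdf 0 s (- x) = normal_pdf 0 s x.
  by rewrite !normal_pdfE// /normal_fun !subr0 sqrrN.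
have -> : (\int[mu]_(x in B) (normal_pdf 0 s x)%:E =
    \int[pushforward mu (-%R : _ -> measurableTypeR R)]_(x in B) (normal_pdf 0 s x)%:E)%E.
  by apply: eq_measure_integral => A mA _; exact/esym/lebesgue_measureN.
rewrite ge0_integral_pushforward//; last 2 first.
- by apply/measurable_EFinP/measurable_funTS; exact: measurable_normal_pdf.
- by move=> x _; rewrite lee_fin normal_pdf_ge0.
by apply: eq_integral => x _; rewrite /= pdfN.
Qed.

Context {disp : measure_display} {T : measurableType disp}.
Variables (P : probability T R) (X : T -> R) (s : R).
Hypotheses (mX : measurable_fun setT X) (s0 : 0 < s).
Hypothesis lawX : forall B, measurable B -> P (X @^-1` B) = normal_prob 0 s B.

(** The exact value is s^2; only the order of magnitude matters below. *)
Lemma normal_L2 : L2 P X /\ \int[P]_w (X w ^+ 2) <= 8 * s ^+ 2.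
Proof.
have s0' : s != 0 by rewrite gt_eqF.
have mX2 : measurable_fun setT (fun w => X w ^+ 2) by exact: measurable_funX.
suff H : (\int[P]_w (X w ^+ 2)%:E <= (8 * s ^+ 2)%:E)%E.
  have [iX] := L1_lee mX2 (fun w => sqr_ge0 (X w)) H (ltry _).
  by rewrite lee_fin.
have mpdf t : measurable_fun setT (normal_pdf 0 t : R -> R).
  exact: measurable_normal_pdf.
have msq : measurable_fun setT (fun x : measurableTypeR R => x ^+ 2).
  exact: measurable_funX.
have -> : (\int[P]_w (X w ^+ 2)%:E =
    \int[pushforward P (X : T -> measurableTypeR R)]_x (x ^+ 2)%:E)%E.
  rewrite ge0_integral_pushforward//; first by exact/measurable_EFinP.
  by move=> x _; rewrite lee_fin sqr_ge0.
apply: (@le_trans _ _ (\int[mu]_x ((x ^+ 2)%:E * (normal_pdf 0 s x)%:E))%E).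
  apply: ge0_integral_le_density => //.
  - by move=> x; rewrite normal_pdf_ge0.
  - by move=> x; rewrite lee_fin sqr_ge0.
  - exact/measurable_EFinP.
apply: (@le_trans _ _ (\int[mu]_x ((8 * s ^+ 2)%:E * (normal_pdf 0 (2 * s) x)%:E))%E).
  apply: ge0_le_integral => //.
  - by move=> x _; rewrite mule_ge0 ?lee_fin ?sqr_ge0 ?normal_pdf_ge0.
  - by apply: emeasurable_funM; apply/measurable_EFinP; [exact: msq|exact: mpdf].
  - apply: emeasurable_funM; first exact: measurable_cst.
    by apply/measurable_EFinP; exact: mpdf.
  - by move=> x _; rewrite -!EFinM lee_fin sqr_normal_pdf_le.
rewrite ge0_integralZl//.
- by rewrite integral_normal_pdf mule1.
- by apply/measurable_EFinP; exact: mpdf.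
- by move=> x _; rewrite lee_fin normal_pdf_ge0.
- by rewrite lee_fin mulr_ge0 ?sqr_ge0.
Qed.

(** X and - X have the same law. *)
Lemma normal_mean0 : \int[P]_w X w = 0.
Proof.
have s0' : s != 0 by rewrite gt_eqF.
have iX := L2_L1 normal_L2.1.
have mNX : measurable_fun setT (fun w => - X w) by exact: measurableT_comp.
suff H : \int[P]_w X w = \int[P]_w (- X w).
  move: H; have -> : \int[P]_w (- X w) = - \int[P]_w X w.
    by rewrite -mulN1r -ExZ//; apply: eq_Rintegral => w _; rewrite mulN1r.
  by move/eqP; rewrite -subr_eq0 opprK -mulr2n mulrn_eq0/= => /eqP.
have mid : measurable_fun setT (fun x : measurableTypeR R => x%:E).
  exact/measurable_EFinP.
have E1 := @integral_pushforward _ _ _ _ R X mX P setT (fun x => x%:E) mid iX measurableT.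
have E2 := @integral_pushforward _ _ _ _ R _ mNX P setT (fun x => x%:E)
  mid (L1N iX) measurableT.
rewrite /Rintegral; congr fine.
rewrite !preimage_setT in E1 E2.
rewrite -[LHS]E1 -[RHS]E2.
apply: eq_measure_integral => A mA _; rewrite /pushforward.
rewrite [LHS]lawX// -normal_probN// -lawX//.
have mN : measurable_fun setT (-%R : R -> R) by [].
by rewrite -[_ @^-1` A]setTI; exact: mN.
Qed.

End normal_moments.

(** * Brownian increments *)

Section brownian_increments.
Context {R : realType} {d : nat} {disp : measure_display}
  {T : measurableType disp}.
Variables (P : probability T R) (Ft : R -> set (set T)) (W : R -> T -> 'cV[R]_d).
Hypotheses (fF : is_filtration Ft) (bW : brownian P Ft W).

Lemma measurable_wrtM (G : set (set T)) (X Y : T -> R) : sigma_algebra setT G ->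
  measurable_wrt G X -> measurable_wrt G Y -> measurable_wrt G (fun w => X w * Y w).
Proof.
move=> sG /(measurable_wrtP _ sG) mX /(measurable_wrtP _ sG) mY.
by apply/(measurable_wrtP _ sG); exact: measurable_funM.
Qed.

Lemma measurable_wrtD (G : set (set T)) (X Y : T -> R) : sigma_algebra setT G ->
  measurable_wrt G X -> measurable_wrt G Y -> measurable_wrt G (fun w => X w + Y w).
Proof.
move=> sG /(measurable_wrtP _ sG) mX /(measurable_wrtP _ sG) mY.
by apply/(measurable_wrtP _ sG); exact: measurable_funD.
Qed.

Lemma measurable_wrtB (G : set (set T)) (X Y : T -> R) : sigma_algebra setT G ->
  measurable_wrt G X -> measurable_wrt G Y -> measurable_wrt G (fun w => X w - Y w).
Proof.
move=> sG /(measurable_wrtP _ sG) mX /(measurable_wrtP _ sG) mY.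
by apply/(measurable_wrtP _ sG); exact: measurable_funB.
Qed.

Lemma measurable_wrt_cst (G : set (set T)) (c : R) : sigma_algebra setT G ->
  measurable_wrt G (cst c).
Proof. by move=> sG; apply/(measurable_wrtP _ sG); exact: measurable_cst. Qed.

Lemma measurable_wrtS (G G' : set (set T)) (X : T -> R) : G `<=` G' ->
  measurable_wrt G X -> measurable_wrt G' X.
Proof. by move=> GG' GX B mB; exact/GG'/GX. Qed.

Lemma filtration_sigma t : 0 <= t -> sigma_algebra setT (Ft t).
Proof. by have [+ _ _] := fF; exact. Qed.

Lemma filtration_measurable t : 0 <= t -> Ft t `<=` measurable.
Proof. by have [_ + _] := fF; exact. Qed.

Lemma filtration_setT t : 0 <= t -> Ft t setT.
Proof. by move=> /filtration_sigma[G0 /(_ set0 G0)]; rewrite setD0. Qed.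

Definition incr (j : 'I_d) (s t : R) (w : T) : R := W t w j 0 - W s w j 0.

Lemma measurable_incr j s t : 0 <= s -> s <= t -> measurable_fun setT (incr j s t).
Proof.
move=> s0 st; have t0 := le_trans s0 st; have [_ aW _ _] := bW.
apply: measurable_funB.
  exact: measurable_wrt_measurable (filtration_measurable t0) (aW t j t0).
exact: measurable_wrt_measurable (filtration_measurable s0) (aW s j s0).
Qed.

Lemma incr_wrt j r s t : 0 <= s -> s <= t -> t <= r ->
  measurable_wrt (Ft r) (incr j s t).
Proof.
move=> s0 st tr; have t0 := le_trans s0 st; have [_ aW _ _] := bW.
have [_ _ Fmono] := fF; have r0 := le_trans t0 tr.
apply: measurable_wrtB; first exact: filtration_sigma.
  exact: measurable_wrtS (Fmono _ _ t0 tr) (aW t j t0).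
exact: measurable_wrtS (Fmono _ _ s0 (le_trans st tr)) (aW s j s0).
Qed.

(** The other coordinates of the increment are left free, and their factors
    have mass 1. *)
Lemma incr_indep j s t A B : 0 <= s -> s < t -> Ft s A -> measurable B ->
  P (A `&` incr j s t @^-1` B) = (P A * normal_prob 0 (Num.sqrt (t - s)) B)%E.
Proof.
move=> s0 st FA mB; have [_ _ _ +] := bW.
move=> /(_ s t A (fun i => if i == j then B else setT) s0 st FA).
have -> : [set w | forall i, (if i == j then B else setT) (W t w i 0 - W s w i 0)]
    = incr j s t @^-1` B.
  apply/seteqP; split => w /= H; first by have := H j; rewrite eqxx.
  by move=> i; case: eqP => // ->.
move=> -> //; last by move=> i; case: ifP.
rewrite (bigD1 j)//= eqxx big1 ?mule1// => i /negPf ->.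
exact: (probability_setT (normal_prob 0 (Num.sqrt (t - s)))).
Qed.

Lemma incr_law j s t B : 0 <= s -> s < t -> measurable B ->
  P (incr j s t @^-1` B) = normal_prob 0 (Num.sqrt (t - s)) B.
Proof.
move=> s0 st mB; rewrite -[X in P X]setTI incr_indep//; last exact: filtration_setT.
by rewrite probability_setT mul1e.
Qed.

Lemma incr_moments j s t : 0 <= s -> s < t ->
  [/\ L2 P (incr j s t), \int[P]_w (incr j s t w ^+ 2) <= 8 * (t - s)
    & \int[P]_w incr j s t w = 0].
Proof.
move=> s0 st; have ts : 0 < t - s by rewrite subr_gt0.
have sq : 0 < Num.sqrt (t - s) by rewrite sqrtr_gt0.
have mI := measurable_incr j s0 (ltW st).
have lI B (mB : measurable B) := incr_law j s0 st mB.
have [H1 H2] := normal_L2 mI sq lI.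
split => //; last exact: normal_mean0 mI sq lI.
by rewrite sqr_sqrtr ?(ltW ts) in H2.
Qed.

(** Independence is used from the side of the increment: given the
    sigma-algebra that it generates, the indicator of A has the constant
    conditional mean P A, and f of the increment is a weight. *)
Lemma Ex_indic_incr j s t A (f : R -> R) : 0 <= s -> s < t -> Ft s A ->
  measurable_fun setT f -> L1 P (fun w => f (incr j s t w)) ->
  \int[P]_w (\1_A w * f (incr j s t w)) =
  fine (P A) * \int[P]_w f (incr j s t w).
Proof.
move=> s0 st FA mf iD; set D := incr j s t.
have mD : measurable_fun setT D := measurable_incr j s0 (ltW st).
have mA : measurable A := filtration_measurable s0 FA.
pose G := preimage_set_system setT D measurable.
have sG : sigma_algebra setT G.
  apply: sigma_algebra_preimage; exact: sigma_algebra_measurable.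
have mI (B : set T) : measurable B -> L1 P (\1_B).
  move=> mB; apply: (@L1_bounded _ _ _ _ _ 1); first exact: measurable_indic.
  by move=> w; rewrite indicE; case: (_ \in _); rewrite ?normr1 ?normr0.
have Gm : G `<=` measurable.
  by move=> _ [B mB <-]; exact: mD.
under eq_Rintegral do rewrite mulrC.
apply: (Ex_weight sG Gm (mI _ mA)) => //.
- move=> _ [B mB <-]; rewrite setTI.
  have mDB : measurable (D @^-1` B) by rewrite -[_ @^-1` _]setTI; exact: mD.
  have IE (C : set T) : measurable C -> \int[P]_w \1_C w = fine (P C).
    by move=> mC; rewrite /Rintegral integral_indic// setIT.
  rewrite IE// (_ : (fun w => _) = \1_(A `&` D @^-1` B)); last first.
    by apply/funext => w; rewrite indicI mulrC.
  rewrite IE; last exact: measurableI.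
  by rewrite incr_indep// -(incr_law j)// fineM// fin_num_measure.
- move=> B mB; exists (f @^-1` B); last by rewrite setTI.
  by rewrite -[_ @^-1` _]setTI; exact: mf.
- apply: (L1_le _ _ (L1_abs iD)).
    apply: measurable_funM; last exact: measurable_indic.
    exact: measurableT_comp.
  move=> w; rewrite normrM indicE ler_piMr//.
  by case: (_ \in _); rewrite ?normr1 ?normr0.
Qed.

Lemma Ex_weight_incr j s t zeta : 0 <= s -> s <= t ->
  measurable_wrt (Ft s) zeta -> L2 P zeta ->
  \int[P]_w (zeta w * incr j s t w) = 0.
Proof.
move=> s0; rewrite le_eqVlt => /predU1P[<- _ _|st Fz iz].
  under eq_Rintegral do rewrite /incr subrr mulr0.
  exact: (Ex_cst P 0).
have [iD _ D0] := incr_moments j s0 st.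
rewrite (Ex_weight (m := 0) (filtration_sigma s0) (filtration_measurable s0)
  (L2_L1 iD)) ?mul0r//.
- move=> A FA; rewrite mul0r.
  have := Ex_indic_incr s0 st FA (@measurable_id _ _ setT) (L2_L1 iD).
  by rewrite D0 mulr0.
- exact: L2_L1.
- exact: L1M.
Qed.

Lemma Ex_weight_incr_sqr j s t zeta c : 0 <= s -> s <= t ->
  measurable_wrt (Ft s) zeta -> (forall w, `|zeta w| <= c) ->
  L2 P (fun w => zeta w * incr j s t w) /\
  \int[P]_w ((zeta w * incr j s t w) ^+ 2) <= 8 * (t - s) * \int[P]_w (zeta w ^+ 2).
Proof.
move=> s0; rewrite le_eqVlt => /predU1P[<- _ _|st Fz zc].
  rewrite (_ : (fun w => _) = cst 0); last first.
    by apply/funext => w; rewrite /incr subrr mulr0.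
  split; first exact: L2_cst.
  rewrite subrr mulr0 mul0r; under eq_Rintegral do rewrite /incr subrr mulr0 expr0n/=.
  by rewrite (Ex_cst P 0).
have [iD D2 D0] := incr_moments j s0 st.
have mz := measurable_wrt_measurable (filtration_measurable s0) Fz.
have izD : L2 P (fun w => zeta w * incr j s t w) by exact: L2M_bounded iD mz zc.
have iz : L2 P zeta by exact: L2_bounded mz zc.
split => //.
under eq_Rintegral do rewrite exprMn.
rewrite (Ex_weight (m := \int[P]_w (incr j s t w ^+ 2)) (filtration_sigma s0)
  (filtration_measurable s0) iD.2).
- by rewrite ler_wpM2r// Ex_ge0// => w; exact: sqr_ge0.
- move=> A FA; rewrite (Ex_indic_incr (f := fun x => x ^+ 2))//.
  + rewrite mulrC; congr (_ * _).
    by rewrite /Rintegral integral_indic ?setIT//; exact: filtration_measurable FA.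
  + exact: iD.2.
- rewrite (_ : (fun w => _) = (fun w => zeta w * zeta w)).
    exact: (measurable_wrtM (filtration_sigma s0) Fz Fz).
  by apply/funext => w; rewrite expr2.
- exact: iz.2.
- rewrite (_ : (fun w => _) = (fun w => (zeta w * incr j s t w) ^+ 2)); first exact: izD.2.
  by apply/funext => w; rewrite exprMn.
Qed.

End brownian_increments.

(** * Stochastic integrals of bounded integrands *)

Section monotone_integral.
Local Open Scope ereal_scope.

(** The integral of a nonnegative function is the supremum over the simple
    functions below it, hence is monotone for arbitrary functions.  This gives
    access to integrands that are known pathwise only. *)
Lemma ge0_le_integral_nonmeasurable {d0 : measure_display}
    {U : measurableType d0} {R : realType}
    (mu : {measure set U -> \bar R}) (D : set U) (f g : U -> \bar R) :
  (forall x, D x -> 0 <= f x) -> (forall x, D x -> f x <= g x) ->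
  \int[mu]_(x in D) f x <= \int[mu]_(x in D) g x.
Proof.
move=> f0 fg; rewrite !ge0_integralE//; last first.
  by move=> x Dx; exact: le_trans (f0 x Dx) (fg x Dx).
apply: le_ereal_sup => _ [h hf <-]; exists h => // x.
by rewrite (le_trans (hf x))// lee_restrict.
Qed.

End monotone_integral.

Section ito.
Context {R : realType} {d : nat} {disp : measure_display}
  {T : measurableType disp}.
Variables (P : probability T R) (Ft : R -> set (set T)) (W : R -> T -> 'cV[R]_d).
Hypotheses (fF : is_filtration Ft) (bW : brownian P Ft W).
Variables (j : 'I_d) (a b : R).
Hypotheses (a0 : 0 <= a).
Local Notation B := (fun u w => W u w j 0).

Section simple.
Variables (p : nat) (t : nat -> R) (xi : nat -> T -> R).
Hypothesis sp : is_simple Ft a b p t xi.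

Lemma simple_times k l : (k <= l)%N -> (l <= p)%N -> t k <= t l.
Proof.
have [_ _ tS _ _] := sp.
elim: l => [|l IH]; first by rewrite leqn0 => /eqP->.
rewrite leq_eqVlt => /predU1P[->//|]; rewrite ltnS => kl lp.
exact: le_trans (IH kl (ltnW lp)) (tS l lp).
Qed.

Lemma simple_times_ge k : (k <= p)%N -> a <= t k.
Proof. by move=> kp; have [<- _ _ _ _] := sp; exact: simple_times. Qed.

Lemma simple_times_le k : (k <= p)%N -> t k <= b.
Proof. by move=> kp; have [_ <- _ _ _] := sp; exact: simple_times. Qed.

Lemma simple_term_moments k (kp : (k < p)%N) :
  L2 P (fun w => xi k w * incr W j (t k) (t k.+1) w) /\
  \int[P]_w ((xi k w * incr W j (t k) (t k.+1) w) ^+ 2) <=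
    8 * (t k.+1 - t k) * \int[P]_w (xi k w ^+ 2).
Proof.
have [_ _ tS Fxi bxi] := sp; have [c xic] := bxi k kp.
apply: (Ex_weight_incr_sqr fF bW) (tS k kp) (Fxi k kp) xic.
by rewrite (le_trans a0)// simple_times_ge// ltnW.
Qed.

(** The increments are orthogonal: in the cross term the last increment has a
    weight known at time t n.  This is why measurability of the partial sum is
    part of the induction. *)
Lemma simple_partial_moments n : (n <= p)%N ->
  [/\ L2 P (fun w => \sum_(k < n) xi k w * incr W j (t k) (t k.+1) w),
      measurable_wrt (Ft (t n))
        (fun w => \sum_(k < n) xi k w * incr W j (t k) (t k.+1) w)
    & \int[P]_w ((\sum_(k < n) xi k w * incr W j (t k) (t k.+1) w) ^+ 2) <=
      8 * \sum_(k < n) (t k.+1 - t k) * \int[P]_w (xi k w ^+ 2)].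
Proof.
have [_ _ tS Fxi bxi] := sp; have [_ _ Fmono] := fF.
elim: n => [|n IH] np.
  have E : (fun w => \sum_(k < 0) xi k w * incr W j (t k) (t k.+1) w) = cst 0.
    by apply/funext => w; rewrite big_ord0.
  rewrite E; split.
  - exact: L2_cst.
  - apply: measurable_wrt_cst; apply: (filtration_sigma fF).
    by rewrite (le_trans a0)// simple_times_ge.
  - rewrite big_ord0 mulr0.
    under eq_Rintegral do rewrite big_ord0 expr0n/=.
    by rewrite (Ex_cst P 0).
have [L2S FS S2] := IH (ltnW np).
set S := fun w => \sum_(k < n) _ in L2S FS S2.
have [iD D2] := simple_term_moments np.
set D := fun w => xi n w * _ in iD.
have tn0 : 0 <= t n by rewrite (le_trans a0)// simple_times_ge// ltnW.
have tn10 : 0 <= t n.+1 by rewrite (le_trans a0)// simple_times_ge.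
have E w : \sum_(k < n.+1) xi k w * incr W j (t k) (t k.+1) w = S w + D w.
  by rewrite big_ord_recr.
rewrite (_ : (fun w => \sum_(k < n.+1) _) = (fun w => S w + D w)); last exact/funext.
have [c xic] := bxi n np.
have mxi := measurable_wrt_measurable (filtration_measurable fF tn0) (Fxi n np).
have L2xS : L2 P (fun w => xi n w * S w) by exact: L2M_bounded L2S mxi xic.
have cross : \int[P]_w (S w * D w) = 0.
  have -> : (fun w => S w * D w) =
      (fun w => xi n w * S w * incr W j (t n) (t n.+1) w).
    by apply/funext => w; rewrite /D; ring.
  apply: (Ex_weight_incr fF bW) => //; first exact: tS.
  by apply: measurable_wrtM (Fxi n np) FS; exact: filtration_sigma.
split.
- exact: L2D.
- apply: measurable_wrtD; first exact: (filtration_sigma fF).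
    by apply: measurable_wrtS FS; apply: Fmono => //; exact: tS.
  apply: measurable_wrtM; first exact: (filtration_sigma fF).
    by apply: measurable_wrtS (Fxi n np); apply: Fmono => //; exact: tS.
  by apply: (incr_wrt fF bW) => //; exact: tS.
- under eq_Rintegral do rewrite E sqrrD.
  rewrite ExD; last 2 first.
  + by apply: L1D; [exact: L2S.2|rewrite (_ : (fun w => _) = (fun w => 2 * (S w * D w)));
      [apply: L1Z; exact: L1M|apply/funext => w; rewrite mulr_natl]].
  + exact: iD.2.
  rewrite ExD; last 2 first.
  + exact: L2S.2.
  + by rewrite (_ : (fun w => _) = (fun w => 2 * (S w * D w)));
      [apply: L1Z; exact: L1M|apply/funext => w; rewrite mulr_natl].
  have -> : \int[P]_w (S w * D w *+ 2) = 2 * \int[P]_w (S w * D w).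
    rewrite -ExZ; last exact: L1M.
    by apply: eq_Rintegral => w _; rewrite mulr_natl.
  rewrite cross mulr0 addr0 big_ord_recr/= mulrDr lerD//.
  by rewrite (le_trans D2)// mulrA.
Qed.

Lemma simple_integral_weight zeta c : measurable_wrt (Ft a) zeta ->
  (forall w, `|zeta w| <= c) ->
  \int[P]_w (zeta w * simple_integral p t xi B w) = 0.
Proof.
move=> Fz zc; have [_ _ tS Fxi bxi] := sp; have [_ _ Fmono] := fF.
have mz := measurable_wrt_measurable (filtration_measurable fF a0) Fz.
under eq_Rintegral do rewrite mulr_sumr.
rewrite Ex_sum; last first.
  move=> k; apply: L1M; first exact: L2_bounded mz zc.
  by have [] := simple_term_moments (ltn_ord k).
apply: big1 => k _; have [c' xic] := bxi k (ltn_ord k).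
have ak : a <= t k by rewrite simple_times_ge// ltnW.
have tk0 := le_trans a0 ak.
under eq_Rintegral do rewrite mulrA.
have Fzx : measurable_wrt (Ft (t k)) (fun w => zeta w * xi k w).
  apply: measurable_wrtM (Fxi k (ltn_ord k)).
    exact: filtration_sigma.
  exact: measurable_wrtS (Fmono _ _ a0 ak) Fz.
apply: (Ex_weight_incr fF bW) => //; first exact: tS.
apply: (@L2_bounded _ _ _ _ _ (c * c')).
  exact: measurable_wrt_measurable (filtration_measurable fF tk0) Fzx.
by move=> w; rewrite normrM ler_pM.
Qed.

Lemma simple_disjoint (u : R) k l : (k < p)%N -> (l < p)%N ->
  t k < u <= t k.+1 -> t l < u <= t l.+1 -> k = l.
Proof.
move=> kp lp /andP[k1 k2] /andP[l1 l2].
have [kl|lk|//] := ltngtP k l.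
  by have := lt_le_trans l1 (le_trans k2 (simple_times kl (ltnW lp))); rewrite ltxx.
by have := lt_le_trans k1 (le_trans l2 (simple_times lk (ltnW kp))); rewrite ltxx.
Qed.

(** Since xi^2 / 2 <= H^2 + (H - xi)^2, whatever xi^2 / 2 has in excess of a
    bound of H^2 is paid for by the distance to H.  Simple processes close to
    a bounded H may be large, and this is how their second moments are
    controlled. *)
Lemma simple_excess_le (H : R -> T -> R) kappa w :
  (forall u, a <= u -> u <= b -> H u w ^+ 2 <= kappa) -> 0 <= kappa ->
  ((\sum_(k < p) Num.max 0 (xi k w ^+ 2 / 2 - kappa) * (t k.+1 - t k))%:E <=
  \int[lebesgue_measure]_(u in `[a, b])
    ((H u w - simple_process p t xi u w) ^+ 2)%:E)%E.
Proof.
move=> Hk k0; set c := fun k => Num.max 0 (xi k w ^+ 2 / 2 - kappa).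
have c0 k : 0 <= c k by rewrite /c le_max lexx.
have Ik (k : 'I_p) : (\int[lebesgue_measure]_(u in `[a, b])
    (c k * \1_(`]t k, t k.+1]%classic) u)%:E = (c k * (t k.+1 - t k))%:E)%E.
  under eq_integral do rewrite EFinM.
  rewrite ge0_integralZl_EFin//; last first.
    by apply/measurable_EFinP; exact: measurable_indic.
  rewrite integral_indic//= setIidl; last first.
    move=> u /=; rewrite !in_itv/= => /andP[u1 u2].
    rewrite (le_trans (simple_times_ge (ltnW (ltn_ord k))) (ltW u1)).
    by rewrite (le_trans u2)// simple_times_le.
  rewrite lebesgue_measure_itv/= lte_fin; case: ltP => [_|].
    by rewrite -EFinB -EFinM.
  have [_ _ tS _ _] := sp; have := tS k (ltn_ord k) => t1 t2.
  by rewrite (le_anti (introT andP (conj t1 t2))) subrr mulr0 mule0.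
rewrite -sumEFin; under eq_bigr do rewrite -Ik.
rewrite -ge0_integral_sum//; last 2 first.
- by move=> k; apply/measurable_EFinP/measurable_funM => //; exact: measurable_indic.
- by move=> k u _; rewrite lee_fin mulr_ge0.
apply: ge0_le_integral_nonmeasurable.
  by move=> u _; rewrite sume_ge0// => k _; rewrite lee_fin mulr_ge0.
move=> u; rewrite /= in_itv/= => /andP[au ub].
rewrite sumEFin lee_fin.
have [[k kin]|nk] := pselect (exists k : 'I_p, t k < u <= t k.+1).
  have kE (l : 'I_p) : (\1_(`]t l, t l.+1]%classic) u : R) = (l == k)%:R.
    rewrite indicE; congr (_%:R); congr nat_of_bool; apply/idP/idP.
      rewrite inE/= in_itv/= => lin; apply/eqP/val_inj.
      exact: simple_disjoint lin kin.
    by move=> /eqP ->; rewrite inE/= in_itv.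
  have sE (e : nat -> R) : \sum_(l < p) e l * \1_(`]t l, t l.+1]%classic) u = e k.
    rewrite (bigD1 k)//= kE eqxx mulr1 big1 ?addr0// => l lk.
    by rewrite kE (negbTE lk) mulr0.
  rewrite sE /simple_process (sE (fun l => xi l w)) /c ge_max sqr_ge0/=.
  have := Hk u au ub; have := sqr_ge0 (2 * H u w - xi k w).
  by nra.
rewrite big1 ?sqr_ge0// => k _; rewrite indicE (_ : _ \in _ = false) ?mulr0//.
by apply/negP; rewrite inE/= in_itv/= => H1; apply: nk; exists k.
Qed.

Lemma simple_integral_sqr_le (H : R -> T -> R) kappa e :
  (forall u w, a <= u -> u <= b -> H u w ^+ 2 <= kappa) -> 0 <= kappa ->
  (\int[P]_w \int[lebesgue_measure]_(u in `[a, b])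
    ((H u w - simple_process p t xi u w) ^+ 2)%:E <= e%:E)%E ->
  L2 P (simple_integral p t xi B) /\
  \int[P]_w (simple_integral p t xi B w ^+ 2) <= 16 * kappa * (b - a) + 16 * e.
Proof.
move=> Hk k0 He; have [iS _ S2] := simple_partial_moments (leqnn p).
split; first exact: iS.
apply: (le_trans S2).
have [t0 tp tS Fxi bxi] := sp.
have mxi (k : 'I_p) : measurable_fun setT (xi k).
  apply: measurable_wrt_measurable (Fxi k (ltn_ord k)).
  apply: (filtration_measurable fF).
  by rewrite (le_trans a0)// simple_times_ge// ltnW.
have ixi2 (k : 'I_p) : L1 P (fun w => xi k w ^+ 2).
  have [c xic] := bxi k (ltn_ord k).
  exact: (L2_bounded P (mxi k) xic).2.
pose V w := \sum_(k < p) Num.max 0 (xi k w ^+ 2 / 2 - kappa) * (t k.+1 - t k).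
have mV : measurable_fun setT V.
  apply: measurable_sum => k; apply: measurable_funM => //.
  apply: measurable_maxr => //; apply: measurable_funB => //.
  by apply: measurable_funM => //; exact: measurable_funX.
have V0 w : 0 <= V w.
  apply: sumr_ge0 => k _; rewrite mulr_ge0 ?le_max ?lexx//.
  by rewrite subr_ge0; exact: tS.
have [iV Ve] : L1 P V /\ ((\int[P]_w V w)%:E <= e%:E)%E.
  apply: L1_lee => //; last exact: ltry.
  apply: le_trans He; apply: ge0_le_integral_nonmeasurable => w _.
    by rewrite lee_fin.
  by apply: simple_excess_le => // u au ub; exact: Hk.
rewrite lee_fin in Ve.
have -> : \sum_(k < p) (t k.+1 - t k) * \int[P]_w (xi k w ^+ 2) =
    \int[P]_w (\sum_(k < p) (t k.+1 - t k) * xi k w ^+ 2).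
  rewrite Ex_sum; last by move=> k; exact: L1Z.
  by apply: eq_bigr => k _; rewrite ExZ.
have tel : \sum_(k < p) (t k.+1 - t k) = b - a.
  by rewrite -t0 -tp -(big_mkord xpredT (fun k => t k.+1 - t k)) telescope_sumr.
have : \int[P]_w (\sum_(k < p) (t k.+1 - t k) * xi k w ^+ 2) <=
    \int[P]_w (cst (2 * kappa * (b - a)) w + 2 * V w).
  apply: Ex_le.
  - by apply: L1_sum => k; exact: L1Z.
  - by apply: L1D; [exact: L1_cst|exact: L1Z].
  - move=> w; rewrite /cst -tel /V !mulr_sumr -big_split/=.
    apply: ler_sum => k _.
    have D0 : 0 <= t k.+1 - t k by rewrite subr_ge0; exact: tS.
    set m := Num.max _ _.
    have mk : xi k w ^+ 2 <= 2 * kappa + 2 * m.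
      have : xi k w ^+ 2 / 2 - kappa <= m by rewrite /m le_max lexx orbT.
      by lra.
    by rewrite (le_trans (ler_wpM2l D0 mk))// le_eqVlt; apply/orP; left; apply/eqP; ring.
rewrite ExD; [|exact: L1_cst|exact: L1Z].
rewrite (Ex_cst P) ExZ//; lra.
Qed.

End simple.

Lemma cvge0_near_le (u : nat -> \bar R) (e : R) : 0 < e -> u @ \oo --> 0%E ->
  \forall q \near \oo, (u q <= e%:E)%E.
Proof.
move=> e0 /fine_cvgP[ufin u0].
near=> q.
have uq : u q \is a fin_num by near: q.
by rewrite -(fineK uq) lee_fin ltW//; near: q; exact: (cvgr_lt _ u0).
Unshelve. all: by end_near. Qed.

(** Both properties hold for the integrals of simple processes and pass to
    the L^2 limit.  The bound of the second moment has the order of the Ito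
    isometry, with a larger constant. *)
Lemma ito_integral_bounds (H : R -> T -> R) (I : T -> R) kappa : a <= b ->
  is_ito_integral P Ft B H a b I ->
  (forall u w, a <= u -> u <= b -> H u w ^+ 2 <= kappa) -> 0 <= kappa ->
  [/\ L2 P I, \int[P]_w (I w ^+ 2) <= 32 * kappa * (b - a)
    & forall zeta c, measurable_wrt (Ft a) zeta -> (forall w, `|zeta w| <= c) ->
        \int[P]_w (zeta w * I w) = 0].
Proof.
move=> ab [mI [p [t [xi [sp Hcvg Icvg]]]]] Hk k0.
have approx e : 0 < e -> exists S : T -> R,
    [/\ L2 P S, L2 P (fun w => I w - S w),
        \int[P]_w (S w ^+ 2) <= 16 * kappa * (b - a) + 16 * e,
        \int[P]_w ((I w - S w) ^+ 2) <= e
      & forall zeta c, measurable_wrt (Ft a) zeta -> (forall w, `|zeta w| <= c) ->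
        \int[P]_w (zeta w * S w) = 0].
  move=> e0.
  have [q [Hq Iq]] : exists q,
     (\int[P]_w \int[lebesgue_measure]_(u in `[a, b])
      ((H u w - simple_process (p q) (t q) (xi q) u w) ^+ 2)%:E <= e%:E)%E /\
     (\int[P]_w ((I w - simple_integral (p q) (t q) (xi q) B w) ^+ 2)%:E <= e%:E)%E.
    near \oo => q; exists q; split; near: q; exact: cvge0_near_le.
  have [iS S2] := simple_integral_sqr_le (sp q) Hk k0 Hq.
  exists (simple_integral (p q) (t q) (xi q) B).
  have mIS : measurable_fun setT
      (fun w => I w - simple_integral (p q) (t q) (xi q) B w).
    by apply: measurable_funB => //; case: iS.
  have [iIS IS2] := L1_lee (measurable_funX 2 mIS) (fun w => sqr_ge0 _) Iq (ltry _).
  split => //.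
  by move=> zeta c Fz zc; apply: (simple_integral_weight (sp q) Fz zc).
have iI : L2 P I.
  have [S [iS iIS _ _ _]] := approx 1 ltr01.
  rewrite (_ : I = fun w => (I w - S w) + S w); first exact: L2D.
  by apply/funext => w; rewrite subrK.
split => //.
- apply/ler_addgt0Pl => e e0.
  (* splitting I as (I - S) + S loses 2 e' + 2 (16 e') = 34 e' *)
  have e34 : 0 < e / 34 by rewrite divr_gt0.
  have [S [iS iIS S2 IS2 _]] := approx _ e34.
  have : \int[P]_w (I w ^+ 2) <=
      \int[P]_w (2 * (I w - S w) ^+ 2 + 2 * S w ^+ 2).
    apply: Ex_le; first exact: iI.2.
      by apply: L1D; apply: L1Z; [exact: iIS.2|exact: iS.2].
    by move=> w; have := sqr_ge0 (I w - 2 * S w); nra.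
  rewrite ExD; last 2 first.
  + by apply: L1Z; exact: iIS.2.
  + by apply: L1Z; exact: iS.2.
  by rewrite !ExZ; [lra|exact: iS.2|exact: iIS.2].
- move=> zeta c Fz zc.
  have mz := measurable_wrt_measurable (filtration_measurable fF a0) Fz.
  have iz : L2 P zeta by exact: L2_bounded mz zc.
  have c0 : 0 <= c by rewrite (le_trans _ (zc point)).
  apply/eqP; rewrite -normr_le0; apply/ler_addgt0Pl => e e0; rewrite addr0.
  pose g := e / (2 * c + 1).
  have g0 : 0 < g by rewrite divr_gt0//; lra.
  have [S [iS iIS _ IS2 zS]] := approx (g ^+ 2) (exprn_gt0 _ g0).
  have -> : \int[P]_w (zeta w * I w) = \int[P]_w (zeta w * (I w - S w)).
    under [RHS]eq_Rintegral do rewrite mulrBr.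
    by rewrite ExB ?(zS _ _ Fz zc) ?subr0//; exact: L1M.
  have : `|\int[P]_w (zeta w * (I w - S w))| <=
      \int[P]_w (cst (c * g) w + c / g * (I w - S w) ^+ 2).
    apply: Ex_abs_le; first exact: L1M.
      by apply: L1D; [exact: L1_cst|apply: L1Z; exact: iIS.2].
    (* y <= g + y^2 / g turns closeness in L^2 into closeness in L^1 *)
    move=> w; rewrite normrM /cst.
    apply: (@le_trans _ _ (c * `|I w - S w|)); first by rewrite ler_wpM2r.
    rewrite -mulrA -mulrDr ler_wpM2l// -(real_normK (num_real (I w - S w))).
    set y := `|_|; have y0 : 0 <= y by exact: normr_ge0.
    have -> : g + g^-1 * y ^+ 2 = y + g^-1 * ((y - g) ^+ 2 + g * y).
      by field; rewrite gt_eqF.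
    rewrite lerDl mulr_ge0 ?invr_ge0 ?(ltW g0)//.
    by rewrite addr_ge0 ?sqr_ge0// mulr_ge0 ?(ltW g0).
  rewrite ExD; [|exact: L1_cst|by apply: L1Z; exact: iIS.2].
  rewrite (Ex_cst P) ExZ; last exact: iIS.2.
  move=> /le_trans; apply.
  apply: (@le_trans _ _ (c * g + c / g * g ^+ 2)).
    by rewrite lerD2l ler_wpM2l// divr_ge0 ?(ltW g0).
  rewrite (_ : c * g + _ = 2 * c * g); last by field; rewrite gt_eqF.
  rewrite /g mulrCA ler_piMr ?(ltW e0)//.
  by rewrite ler_pdivrMr; lra.
Unshelve. all: by end_near. Qed.

End ito.

(** * Integrals over time *)

Section time_integral.
Context {R : realType}.
Local Notation mu := (@lebesgue_measure R).
Implicit Types (f g : R -> R) (a t c : R).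

Definition tint a t f : R := \int[mu]_(u in `[a, t]) f u.

Lemma tint_integrable a t f c : measurable_fun setT f ->
  (forall u, a <= u <= t -> `|f u| <= c) ->
  mu.-integrable `[a, t] (EFin \o f).
Proof.
move=> mf fc; apply: measurable_bounded_integrable => //.
- have : (mu `[a, t]%classic < +oo)%E; last by [].
  rewrite lebesgue_measure_itv/=; case: ifP => _; last by rewrite ltry.
  by rewrite -EFinB ltry.
- exact: measurable_funTS.
- exists c; split; first exact: num_real.
  move=> M cM u /=; rewrite in_itv/= => aut.
  by rewrite (le_trans (fc u aut))// ltW.
Qed.

Lemma tint_cst a t c : a <= t -> tint a t (cst c) = c * (t - a).
Proof.
move=> at_; rewrite /tint Rintegral_cst//=.
have -> : fine (mu `[a, t]%classic) = t - a; last by [].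
rewrite lebesgue_measure_itv/= lte_fin.
by case: ltgtP at_ => //= -> _; rewrite subrr.
Qed.

Lemma tint_le a t f g c : measurable_fun setT f -> measurable_fun setT g ->
  (forall u, a <= u <= t -> `|f u| <= c) ->
  (forall u, a <= u <= t -> `|g u| <= c) ->
  (forall u, a <= u <= t -> f u <= g u) -> tint a t f <= tint a t g.
Proof.
move=> mf mg fc gc fg; apply: le_Rintegral => //.
- exact: tint_integrable fc.
- exact: tint_integrable gc.
Qed.

Lemma tint_abs_le a t f c : a <= t -> measurable_fun setT f ->
  (forall u, a <= u <= t -> `|f u| <= c) -> `|tint a t f| <= c * (t - a).
Proof.
move=> at_ mf fc.
have c0 : 0 <= c by rewrite (le_trans _ (fc a _))// lexx.
rewrite (le_trans (le_normr_Rintegral _ (tint_integrable mf fc)))//.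
rewrite -(tint_cst c at_); apply: (@tint_le _ _ _ _ c) => //.
- exact: measurableT_comp.
- by move=> u aut; rewrite normr_id; exact: fc.
- by move=> u _; rewrite /cst ger0_norm.
Qed.

Lemma tintD a t f g c : measurable_fun setT f -> measurable_fun setT g ->
  (forall u, a <= u <= t -> `|f u| <= c) ->
  (forall u, a <= u <= t -> `|g u| <= c) ->
  tint a t (fun u => f u + g u) = tint a t f + tint a t g.
Proof.
move=> mf mg fc gc; apply: RintegralD => //.
- exact: tint_integrable fc.
- exact: tint_integrable gc.
Qed.

Lemma tintZ a t f k c : measurable_fun setT f ->
  (forall u, a <= u <= t -> `|f u| <= c) ->
  tint a t (fun u => k * f u) = k * tint a t f.
Proof. by move=> mf fc; apply: RintegralZl => //; exact: tint_integrable fc. Qed.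

Lemma tint_sum {I : Type} (s : seq I) a t (f : I -> R -> R) c :
  (forall i, measurable_fun setT (f i)) -> (forall i u, `|f i u| <= c) ->
  tint a t (fun u => \sum_(i <- s) f i u) = \sum_(i <- s) tint a t (f i).
Proof.
move=> mf fc; elim: s => [|i s IH].
  rewrite big_nil /tint (_ : (fun u => _) = cst 0).
    by rewrite Rintegral_cst// mul0r.
  by apply/funext => u; rewrite big_nil.
rewrite big_cons -IH.
have nn (j : I) : 0 <= c by exact: (le_trans (normr_ge0 _) (fc j 0)).
rewrite -(@tintD _ _ _ _ (c + \sum_(j <- s) c)).
- by congr Rintegral; apply/funext => u; rewrite big_cons.
- exact: mf.
- exact: measurable_sum.
- move=> u _; rewrite (le_trans (fc i u))// lerDl; apply: sumr_ge0 => j _.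
  exact: nn j.
- move=> u _; rewrite ler_wpDl ?(nn i)// (le_trans (ler_norm_sum _ _ _))//.
  exact: ler_sum.
Qed.

Lemma tintB a t f g c : measurable_fun setT f -> measurable_fun setT g ->
  (forall u, a <= u <= t -> `|f u| <= c) ->
  (forall u, a <= u <= t -> `|g u| <= c) ->
  tint a t (fun u => f u - g u) = tint a t f - tint a t g.
Proof.
move=> mf mg fc gc; apply: RintegralB => //.
- exact: tint_integrable fc.
- exact: tint_integrable gc.
Qed.

Lemma tint_norm_le a t f g c : measurable_fun setT f -> measurable_fun setT g ->
  (forall u, a <= u <= t -> `|f u| <= g u) ->
  (forall u, a <= u <= t -> `|g u| <= c) -> `|tint a t f| <= tint a t g.
Proof.
move=> mf mg fg gc.
have fc u : a <= u <= t -> `|f u| <= c.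
  by move=> aut; rewrite (le_trans (fg u aut))// (le_trans (ler_norm _) (gc u aut)).
rewrite (le_trans (le_normr_Rintegral _ (tint_integrable mf fc)))//.
apply: (@tint_le _ _ _ _ c) => //; first exact: measurableT_comp.
by move=> u aut; rewrite normr_id; exact: fc.
Qed.

(** Cauchy-Schwarz, from the integral of the square of f minus its mean. *)
Lemma tint_sqr_le a t f c : a <= t -> measurable_fun setT f ->
  (forall u, a <= u <= t -> `|f u| <= c) ->
  tint a t f ^+ 2 <= (t - a) * tint a t (fun u => f u ^+ 2).
Proof.
move=> at_ mf fc; have c0 : 0 <= c by rewrite (le_trans _ (fc a _))// lexx.
move: (at_); rewrite le_eqVlt => /predU1P[E|lt].
  have := tint_abs_le at_ mf fc.
  by rewrite -E subrr mulr0 mul0r normr_le0 => /eqP ->; rewrite expr0n.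
have l0 : 0 < t - a by rewrite subr_gt0.
have [mean Em] : exists mean, tint a t f = mean * (t - a).
  by exists (tint a t f / (t - a)); rewrite divfK// gt_eqF.
have mf2 : measurable_fun setT (fun u => f u ^+ 2) by exact: measurable_funX.
have f2c u : a <= u <= t -> `|f u ^+ 2| <= c ^+ 2.
  by move=> aut; rewrite normrX lerXn2r ?nnegrE// fc.
pose k := c ^+ 2 + `|2 * mean| * c + `|2 * mean| * c + mean ^+ 2 + mean ^+ 2.
have q0 : 0 <= tint a t (fun u => (f u - mean) ^+ 2).
  by apply: Rintegral_ge0 => u _; exact: sqr_ge0.
have E : (fun u => (f u - mean) ^+ 2) =
    (fun u => f u ^+ 2 - (2 * mean * f u - cst (mean ^+ 2) u)).
  by apply/funext => u; rewrite /cst; ring.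
have mc0 : 0 <= `|2 * mean| * c by rewrite mulr_ge0.
have fk u : a <= u <= t -> `|2 * mean * f u| <= `|2 * mean| * c + mean ^+ 2.
  by move=> aut; rewrite normrM ler_wpDr ?sqr_ge0// ler_wpM2l// fc.
have mm : `|mean ^+ 2| <= `|2 * mean| * c + mean ^+ 2.
  by rewrite ger0_norm ?sqr_ge0// lerDr.
have mg : measurable_fun setT (fun u => 2 * mean * f u) by exact: measurable_funM.
rewrite E (@tintB _ _ _ _ k) // in q0; last 3 first.
- by apply: measurable_funB.
- move=> u aut; rewrite (le_trans (f2c u aut))// /k -!addrA lerDl.
  by rewrite !addr_ge0 ?sqr_ge0.
- move=> u aut; rewrite (le_trans (ler_normB _ _))//.
  have := fk u aut; have := mm; have := sqr_ge0 c; rewrite /k /cst; lra.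
rewrite (@tintB _ _ _ _ (`|2 * mean| * c + mean ^+ 2)) ?(@tintZ a t f (2 * mean) c)// in q0.
rewrite tint_cst// in q0.
rewrite Em in q0 *.
rewrite -subr_ge0; move: q0; set s := tint a t _; set l := t - a in l0 * => q0.
have -> : l * s - (mean * l) ^+ 2 =
  l * (s - (2 * mean * (mean * l) - mean ^+ 2 * l)) by ring.
by rewrite mulr_ge0 ?(ltW l0).
Qed.

(** With respect to the weights exp (lam (u - a)), integration over time is a
    contraction with factor 1 / lam. *)
Lemma tint_exp_le a t lam : 0 < lam -> a <= t ->
  tint a t (fun u => expR (lam * (u - a))) <= expR (lam * (t - a)) / lam.
Proof.
move=> lam0; rewrite le_eqVlt => /predU1P[<-|at_].
  rewrite /tint set_itv1 Rintegral_set1 divr_ge0 ?expR_ge0// ltW//.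
pose F u := expR (lam * (u - a)).
have cF : continuous F.
  move=> u; apply: (cvg_comp (fun u => lam * (u - a)) expR); last exact: continuous_expR.
  apply: cvgM; first exact: cvg_cst.
  by apply: (@cvgB _ R^o); [exact: cvg_id|exact: cvg_cst].
have dF (u : R) : is_derive u 1 F (lam * F u).
  have dE : is_derive u 1 (fun u => lam * (u - a)) lam.
    by apply: is_derive_eq; rewrite ?scaler0 ?add0r ?addr0 ?subr0 ?scaler1 ?mulr1.
  have := @is_derive1_comp _ expR (fun u => lam * (u - a)) u _ _
    (is_derive_expR (lam * (u - a))) dE.
  by move=> H; rewrite mulrC.
have FTC : tint a t (fun u => lam * F u) = F t - F a.
  rewrite /tint /Rintegral (@continuous_FTC2 _ (fun u => lam * F u) F a t at_)//.
  - apply: continuous_subspaceT => u; apply: cvgM; [exact: cvg_cst|exact: cF].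
  - split.
    + by move=> u _; case: (dF u).
    + by apply/cvg_at_right_filter; exact: cF.
    + by apply/cvg_at_left_filter; exact: cF.
  - by move=> u _; rewrite derive1E; case: (dF u).
have mF : measurable_fun setT F by exact: continuous_measurable_fun.
rewrite ler_pdivlMr// mulrC -(@tintZ _ _ _ _ (F t))//.
  by rewrite FTC lerBlDr lerDl expR_ge0.
move=> u /andP[au ut]; rewrite ger0_norm ?expR_ge0// ler_expR.
by rewrite ler_wpM2l ?(ltW lam0)// lerD2r.
Qed.

Lemma tint_split a x t f c : a <= x -> x <= t -> measurable_fun setT f ->
  (forall u, `|f u| <= c) -> tint a t f = tint a x f + tint x t f.
Proof.
move=> ax xt mf fc.
have itf y z : mu.-integrable `[y, z] (EFin \o f) by exact: tint_integrable (fun u _ => fc u).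
apply/eqP; rewrite addrC -subr_eq; apply/eqP.
rewrite /tint Rintegral_itvB ?bnd_simp//.
apply: Rintegral_itv_obnd_cbnd.
by apply: integrableS (itf x t) => //; apply: subset_itvr; rewrite bnd_simp.
Qed.

(** The index k of the cell [a + k eta, a + (k + 1) eta[ of u, when a <= u. *)
Definition tick a (eta : R) (u : R) : nat := Num.truncn ((u - a) / eta).

Lemma measurable_tick_fiber a eta k : measurable (tick a eta @^-1` [set k]).
Proof.
have mX : measurable_fun setT (fun u : R => (u - a) / eta).
  by apply: measurable_funM => //; exact: measurable_funB.
have E : tick a eta @^-1` [set k] = (fun u : R => (u - a) / eta) @^-1`
    (`[k%:R, k.+1%:R[%classic `|` (if k == 0%N then `]-oo, 0[%classic else set0)).
  apply/seteqP; split => u; rewrite /tick /=; set x := _ / _.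
    move=> <-; case: (leP 0 x) => x0.
      by left; rewrite in_itv/= truncn_itv.
    have -> : Num.truncn x = 0%N by apply/truncn0Pn; rewrite -ltNge (lt_trans x0).
    by right; rewrite /= in_itv.
  case=> [|]; first by rewrite in_itv/=; exact: truncn_def.
  case: eqP => // ->; rewrite /= in_itv/= => x0.
  by apply/truncn0Pn; rewrite -ltNge (lt_trans x0).
rewrite E -[_ @^-1` _]setTI; apply: mX => //.
by apply: measurableU; [exact: measurable_itv|case: ifP].
Qed.

Lemma measurable_tick (beta : nat -> R) a eta :
  measurable_fun setT (fun u : R => beta (tick a eta u)).
Proof.
apply: (@measurable_glue _ _ _ _ _ (tick a eta) (fun k _ => beta k)) => k.
  exact: measurable_tick_fiber.
exact: measurable_cst.
Qed.

Lemma tickE a eta k u : 0 < eta -> a + k%:R * eta <= u < a + k.+1%:R * eta ->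
  tick a eta u = k.
Proof.
move=> e0 /andP[u1 u2]; apply: truncn_def.
by rewrite ler_pdivlMr// ltr_pdivrMr// lerBrDl u1/= ltrBlDl.
Qed.

Lemma tick_bounds a eta u : 0 < eta -> a <= u ->
  a + (tick a eta u)%:R * eta <= u < a + (tick a eta u).+1%:R * eta.
Proof.
move=> e0 au; have : 0 <= (u - a) / eta by rewrite divr_ge0 ?(ltW e0)// subr_ge0.
by move=> /truncn_itv; rewrite ler_pdivlMr// ltr_pdivrMr// lerBrDl ltrBlDl.
Qed.

(** Complete cells are integrated exactly, and the incomplete one at the end
    contributes at most c eta. *)
Lemma tint_step (beta : nat -> R) a eta t c : 0 < eta -> a <= t ->
  (forall k, `|beta k| <= c) ->
  `|tint a t (fun u => beta (tick a eta u)) -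
    eta * \sum_(k < tick a eta t) beta k| <= c * eta.
Proof.
move=> e0 at_ bc; set f := fun u => beta _.
have mf : measurable_fun setT f by exact: measurable_tick.
have fc u : `|f u| <= c by exact: bc.
have ge k : a <= a + k%:R * eta by rewrite lerDl mulr_ge0// ltW.
have geS k : a + k%:R * eta <= a + k.+1%:R * eta.
  by rewrite lerD2l ler_wpM2r ?(ltW e0)// ler_nat.
have cell k : tint (a + k%:R * eta) (a + k.+1%:R * eta) f = beta k * eta.
  transitivity (tint (a + k%:R * eta) (a + k.+1%:R * eta) (cst (beta k))).
    rewrite /tint -[LHS]Rintegral_itv_bndo_bndc; last first.
      apply: (integrableS _ _ _ (tint_integrable mf (fun u _ => fc u))) => //.
      by apply: subset_itvl; rewrite bnd_simp.
    rewrite -[RHS]Rintegral_itv_bndo_bndc; last first.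
      apply: (integrableS _ _ _ (tint_integrable (c := c)
        (measurable_cst (beta k)) (fun u _ => bc k))) => //.
      by apply: subset_itvl; rewrite bnd_simp.
    apply: eq_Rintegral => u; rewrite inE/= in_itv/= => uin.
    by rewrite /f (tickE e0 uin).
  by rewrite tint_cst// -natr1; ring.
have grid j : tint a (a + j%:R * eta) f = eta * \sum_(k < j) beta k.
  elim: j => [|j IH].
    by rewrite big_ord0 mulr0 mul0r addr0 /tint set_itv1 Rintegral_set1.
  rewrite (@tint_split _ (a + j%:R * eta) _ _ c)// IH cell big_ord_recr/= mulrDr.
  by rewrite [beta j * _]mulrC.
have /andP[t1 t2] := tick_bounds e0 at_.
rewrite -grid (@tint_split _ (a + (tick a eta t)%:R * eta) _ _ c)//.
rewrite addrC addKr (le_trans (tint_abs_le t1 mf (fun u _ => fc u)))//.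
have c0 : 0 <= c by exact: le_trans (fc 0).
by rewrite ler_wpM2l// lerBlDr (le_trans (ltW t2))// -natr1; lra.
Qed.

Lemma tint_fubini {disp : measure_display} {T : measurableType disp}
    (P : probability T R) (psi : R -> T -> R) a t c :
  measurable_fun setT (fun x : measurableTypeR R * T => psi x.1 x.2) ->
  (forall u w, `|psi u w| <= c) ->
  [/\ measurable_fun setT (fun w => tint a t (psi^~ w)),
      measurable_fun setT (fun u => \int[P]_w psi u w)
    & \int[P]_w tint a t (psi^~ w) = tint a t (fun u => \int[P]_w psi u w)].
Proof.
move=> mpsi pc.
have c0 : 0 <= c by exact: le_trans (pc 0 point).
pose m1 := (fun u : measurableTypeR R => \1_(`[a, t]%classic) u : R).
have mI : measurable_fun setT m1 by exact: measurable_indic.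
pose f (x : measurableTypeR R * T) := (psi x.1 x.2 * m1 x.1)%:E.
have mf : measurable_fun setT f.
  apply/measurable_EFinP; apply: measurable_funM => //.
  exact: (measurableT_comp mI measurable_fst).
have mpsiu u : measurable_fun setT (psi u).
  exact: (measurableT_comp mpsi (measurable_pair1 u)).
have mpsiw w : measurable_fun setT (psi^~ w).
  exact: (measurableT_comp mpsi (measurable_pair2 w)).
have iu u : L1 P (psi u) by apply: (L1_bounded P (mpsiu u)) => w; exact: pc.
have FE u : (\int[P]_w f (u, w) = ((\int[P]_w psi u w)%R * m1 u)%:E)%E.
  rewrite /f /= -[RHS]/((\int[P]_w psi u w)%R%:E * (m1 u)%:E)%E.
  rewrite -(expectationE (iu u)) unlock -integralZr//.
  exact: iu.
have GE w : (\int[mu]_u f (u, w) = (tint a t (psi^~ w))%:E)%E.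
  rewrite /tint /Rintegral fineK; last first.
    apply: integrable_fin_num => //.
    exact: tint_integrable (mpsiw w) (fun u _ => pc u w).
  rewrite [RHS]integral_mkcond; apply: eq_integral => u _.
  rewrite /f /m1 /= patchE indicE; case: ifPn => _; first by rewrite mulr1.
  by rewrite mulr0.
have intf : (mu \x P)%E.-integrable setT f.
  apply/integrable12ltyP => //.
  apply: (@le_lt_trans _ _ (\int[mu]_u (c%:E * (m1 u)%:E))%E).
    apply: ge0_le_integral_nonmeasurable => u _; first exact: integral_ge0.
    apply: (@le_trans _ _ (\int[P]_w (c * m1 u)%:E)%E).
      apply: ge0_le_integral_nonmeasurable => w _; first by [].
      rewrite /f /= lee_fin normrM /m1 indicE ler_pM//.
      by case: (_ \in _); rewrite ?normr1 ?normr0.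
    by rewrite integral_cst// [X in (_ * X)%E](@probability_setT _ _ _ P) mule1 EFinM.
  rewrite ge0_integralZl_EFin//; last 2 first.
  - by move=> x _; rewrite lee_fin /m1 indicE; case: (_ \in _).
  - by apply/measurable_EFinP; exact: mI.
  rewrite integral_indic// setIT.
  have H : mu `[a, t]%classic = (if (a < t)%R then (t - a)%:E else 0)%E.
    by rewrite lebesgue_measure_itv/= lte_fin EFinB.
  rewrite [X in (_ * X)%E](_ : _ = if (a < t)%R then (t - a)%:E else 0%E)//.
  by case: ifP => _; rewrite ?mule0 -?EFinM ltry.
split.
- apply/measurable_EFinP.
  have := measurable_fubini_G intf; congr measurable_fun.
  by apply/funext => w; rewrite /fubini_G GE.
- have mg : measurable_fun setT
      (fun x : measurableTypeR R * T => (c + psi x.1 x.2)%:E).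
    by apply/measurable_EFinP; exact: measurable_funD.
  have g0 x : (0 <= (c + psi x.1 x.2)%:E)%E.
    by rewrite lee_fin -lerBlDl sub0r; have := pc x.1 x.2; rewrite ler_norml => /andP[].
  have := measurable_fun_fubini_tonelli_F (m2 := P) _ mg g0.
  have -> : fubini_F P (fun x : measurableTypeR R * T => (c + psi x.1 x.2)%:E) =
      (fun u => (c + \int[P]_w psi u w)%:E).
    apply/funext => u; rewrite /fubini_F /=.
    have iD : L1 P (fun w => cst c w + psi u w) by apply: L1D; [exact: L1_cst|exact: iu].
    have := expectationE iD; rewrite unlock => ->.
    by rewrite ExD ?(Ex_cst P)//; exact: L1_cst.
  move=> /measurable_EFinP H.
  rewrite (_ : (fun u => _) = fun u => (c + \int[P]_w psi u w) - c).
    by apply: measurable_funB => //; exact: H.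
  by apply/funext => u; rewrite addrC addKr.
- have := Fubini intf => E; rewrite /Rintegral; congr fine.
  under eq_integral do rewrite -GE.
  rewrite -E [RHS]integral_mkcond; apply: eq_integral => u _.
  rewrite FE patchE /m1 indicE; case: ifPn => _; first by rewrite mulr1.
  by rewrite mulr0.
Qed.

End time_integral.

(** * One epoch of the modified equation *)

(** The map S -> C + S / 2 has the fixed point 2 C, and its iterates bring any
    initial bound S0 within C of it.  This plays the part of Gronwall's lemma:
    an integral inequality halves a bound in a weighted norm at each use, so
    that an a priori bound, however bad, is forgotten. *)
Lemma halving_iteration {R : realType} (Q : R -> Prop) (C S0 : R) :
  0 < C -> 0 <= S0 -> Q S0 ->
  (forall S S', S <= S' -> Q S -> Q S') ->
  (forall S, 0 <= S -> Q S -> Q (C + S / 2)) -> Q (3 * C).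
Proof.
move=> C0 S00 QS0 Qle Qhalf.
have H k : Q (2 * C + S0 / 2 ^+ k).
  elim: k => [|k IH]; first by apply: Qle QS0; rewrite expr0 divr1 lerDr; lra.
  rewrite (_ : _ + _ = C + (2 * C + S0 / 2 ^+ k) / 2); last first.
    by rewrite exprS; field; rewrite expf_neq0.
  by apply: Qhalf => //; rewrite addr_ge0 ?divr_ge0 ?exprn_ge0//; lra.
have [k Hk] : exists k, S0 / 2 ^+ k <= C.
  have [k Hk] : exists k : nat, S0 / C <= k%:R.
    by exists (Num.truncn (S0 / C)).+1; rewrite ltW// truncnS_gt.
  exists k; rewrite ler_pdivrMr ?exprn_gt0//.
  move: Hk; rewrite ler_pdivrMr// => /le_trans; apply.
  rewrite mulrC ler_wpM2l ?(ltW C0)//.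
  by rewrite -natrX ler_nat ltnW// ltn_expl.
by apply: Qle (H k); lra.
Qed.

Section epoch.
Context {R : realType} {d : nat} {disp : measure_display}
  {T : measurableType disp}.
Variables (P : probability T R) (G : set (set T)) (Y : R -> T -> 'cV[R]_d).
Variables (b : 'cV[R]_d -> 'cV[R]_d) (L eta a cI TT : R) (m : nat).
Hypotheses (sG : sigma_algebra setT G) (Gm : G `<=` measurable).
Hypotheses (tb : tame_field b L) (e0 : 0 < eta) (e1 : eta <= 1).
Hypotheses (mT : m%:R * eta <= TT) (cI0 : 0 <= cI).
Local Notation te := (a + m%:R * eta).
Local Notation Ex X := (\int[P]_w X w).

(** What is retained of a stochastic integral that starts with the epoch: its
    size in L^2 and its orthogonality to the variables known at the start,
    which G represents. *)
Definition centered_noise (I : 'I_d -> T -> R) := forall i,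
  [/\ L2 P (I i), Ex (fun w => I i w ^+ 2) <= cI * eta
    & forall zeta c, measurable_wrt G zeta -> (forall w, `|zeta w| <= c) ->
        Ex (fun w => zeta w * I i w) = 0].

Hypothesis jY : forall i,
  measurable_fun setT (fun x : measurableTypeR R * T => Y x.1 x.2 i 0).
Hypothesis GY : forall i, measurable_wrt G (fun w => Y a w i 0).
Hypothesis Yeq : forall t, a < t -> t <= te -> exists2 I, centered_noise I &
  {ae P, forall w, forall i, Y t w i 0 = Y a w i 0
     - tint a t (fun u => b (Y u w) i 0) + I i w}.

Definition grid k (w : T) : 'cV[R]_d := iter k (euler eta b) (Y a w).
Definition euler_path (u : R) (w : T) := grid (tick a eta u) w.
Definition gap (u : R) (w : T) := Y u w - euler_path u w.
Definition drift_gap i (u : R) (w : T) :=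
  b (Y u w) i 0 - b (euler_path u w) i 0.

Let L0 : 0 <= L. Proof. by case: tb. Qed.
Let TT0 : 0 <= TT.
Proof. by apply: le_trans mT; rewrite mulr_ge0// ltW. Qed.

Let iter_continuous k : continuous (iter k (euler eta b)).
Proof.
elim: k => [|k IH] x; first exact: cvg_id.
rewrite (_ : iter k.+1 _ = euler eta b \o iter k (euler eta b))//.
apply: (cvg_comp (iter k (euler eta b)) (euler eta b)); first exact: IH.
exact: euler_continuous tb _.
Qed.

Let grid_wrt (phi : 'cV[R]_d -> R) k : continuous phi ->
  measurable_wrt G (fun w => phi (grid k w)).
Proof.
move=> cphi; apply/(measurable_wrtP _ sG).
apply: (@measurable_continuous_col _ _ (g_sigma_algebraType G) _
  (phi \o iter k (euler eta b)) (Y a)).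
  move=> x; apply: (cvg_comp (iter k (euler eta b)) phi); last exact: cphi.
  exact: iter_continuous.
by move=> i; apply/(measurable_wrtP _ sG); exact: GY.
Qed.

Let bcont i : continuous (fun x => b x i 0).
Proof. exact: tame_field_continuous tb i. Qed.

Let b_bound x i : `|b x i 0| <= L.
Proof. by case: tb => _ _ + _; exact. Qed.

Let measurable_Y u i : measurable_fun setT (fun w => Y u w i 0).
Proof. exact: (measurableT_comp (jY i) (measurable_pair1 u)). Qed.

Let measurable_grid (phi : 'cV[R]_d -> R) k : continuous phi ->
  measurable_fun setT (fun w => phi (grid k w)).
Proof. by move=> /(grid_wrt k)/measurable_wrt_measurable; exact. Qed.

Let measurable_gap u i : measurable_fun setT (fun w => gap u w i 0).
Proof.
rewrite (_ : (fun w => _) = fun w => Y u w i 0 - (fun x : 'cV[R]_d => x i 0) (euler_path u w)).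
  apply: measurable_funB => //; apply: (@measurable_grid (fun x => x i 0)).
  exact: coord_continuous.
by apply/funext => w; rewrite !mxE.
Qed.

Let joint_bpath i : measurable_fun setT
  (fun x : measurableTypeR R * T => b (euler_path x.1 x.2) i 0).
Proof.
apply: (@measurable_glue _ (measurableTypeR R * T)%type _ _ _
  (fun x => tick a eta x.1) (fun k x => b (grid k x.2) i 0)) => k.
  rewrite (_ : _ @^-1` _ = fst @^-1` (tick a eta @^-1` [set k]))//.
  rewrite -[X in measurable X]setTI; apply: measurable_fst => //.
  exact: measurable_tick_fiber.
apply: (@measurableT_comp _ _ _ _ _ _ (fun w => b (grid k w) i 0)) => //.
exact: (@measurable_grid (fun x => b x i 0)).
Qed.

Let joint_bY i : measurable_fun setT
  (fun x : measurableTypeR R * T => b (Y x.1 x.2) i 0).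
Proof.
exact: (@measurable_continuous_col _ _ (measurableTypeR R * T)%type _
  (fun x => b x i 0) (fun x => Y x.1 x.2)).
Qed.

Let joint_drift_gap i : measurable_fun setT
  (fun x : measurableTypeR R * T => drift_gap i x.1 x.2).
Proof. exact: measurable_funB. Qed.

Let drift_gap_bound i u w : `|drift_gap i u w| <= 2 * L.
Proof.
rewrite (le_trans (ler_normB _ _))// (_ : 2 * L = L + L); last by ring.
by rewrite lerD.
Qed.

Let sec2 (psi : R -> T -> R) w :
  measurable_fun setT (fun x : measurableTypeR R * T => psi x.1 x.2) ->
  measurable_fun setT (psi^~ w).
Proof. by move=> mp; exact: (measurableT_comp mp (measurable_pair2 w)). Qed.

(** The Euler path is the integral of its own drift, up to the incomplete
    cell of the grid that contains t; this is the term rho. *)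
Lemma gap_decomposition t : a <= t -> t <= te ->
  exists I rho : 'I_d -> T -> R, [/\ centered_noise I,
    forall i, measurable_fun setT (rho i),
    forall i w, `|rho i w| <= L * eta
    & {ae P, forall w, forall i,
        gap t w i 0 = - tint a t (drift_gap i ^~ w) + I i w + rho i w}].
Proof.
rewrite le_eqVlt => /predU1P[<- _|at_ tte].
  exists (fun=> cst 0), (fun=> cst 0); split => //.
  - move=> i; split.
    + exact: L2_cst.
    + rewrite (_ : (fun w => _) = cst 0); last by apply/funext => w; rewrite /cst expr0n.
      by rewrite (Ex_cst P) mulr_ge0// ltW.
    + move=> zeta c _ _; rewrite (_ : (fun w => _) = cst 0); last first.
        by apply/funext => w; rewrite /cst mulr0.
      exact: (Ex_cst P).
  - by move=> i w; rewrite normr0 mulr_ge0// ltW.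
  - apply: aeW => w i; rewrite /tint set_itv1 Rintegral_set1 /gap /euler_path /tick.
    by rewrite subrr mul0r truncn0 /grid/= subrr mxE /cst !addr0 oppr0.
have [I cI' HY] := Yeq at_ tte.
pose rho i w := - (tint a t (fun u => b (euler_path u w) i 0) -
  eta * \sum_(k < tick a eta t) b (grid k w) i 0).
exists I, rho; split => //.
- move=> i; apply: measurableT_comp => //; apply: measurable_funB.
    by have [] := tint_fubini P a t (joint_bpath i) (fun u w => b_bound (euler_path u w) i).
  apply: measurable_funM => //; apply: measurable_sum => k.
  exact: (@measurable_grid (fun x => b x i 0)).
- move=> i w; rewrite /rho normrN.
  exact: (@tint_step _ (fun k => b (grid k w) i 0)) e0 (ltW at_) (fun k => b_bound _ _).
- apply: filterS HY => w HY i; rewrite [LHS]mxE HY.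
  have gE k : grid k w i 0 = Y a w i 0 - eta * \sum_(l < k) b (grid l w) i 0.
    elim: k => [|k IH]; first by rewrite big_ord0 mulr0 subr0.
    by rewrite /grid iterS -/(grid k w) /euler !mxE IH big_ord_recr/= mulrDr; ring.
  rewrite mxE /euler_path gE /rho /drift_gap (@tintB _ _ _ _ _ L).
  + by ring.
  + exact: (@sec2 (fun u w => b (Y u w) i 0) w (joint_bY i)).
  + exact: (@sec2 (fun u w => b (euler_path u w) i 0) w (joint_bpath i)).
  + by move=> u _; exact: b_bound.
  + by move=> u _; exact: b_bound.
Qed.

(** The drift part is bounded by Cauchy-Schwarz in time, and the two others
    are O(eta) in mean square. *)
Lemma gap_second_moment_step t : a <= t -> t <= te ->
  (forall i, L2 P (fun w => gap t w i 0)) /\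
  Ex (fun w => nsq (gap t w)) <=
    3 * TT * tint a t (fun u => Ex (fun w => \sum_i drift_gap i u w ^+ 2)) +
    3 * (d%:R * (cI + L ^+ 2)) * eta.
Proof.
move=> at_ tte; have [I [rho [HI mrho rhoL Hgap]]] := gap_decomposition at_ tte.
have ta : t - a <= TT by apply: le_trans mT; rewrite lerBlDl.
pose A i w := tint a t (drift_gap i ^~ w).
have mA i : measurable_fun setT (A i).
  by have [] := tint_fubini P a t (joint_drift_gap i) (drift_gap_bound i).
have A_bd i w : `|A i w| <= 2 * L * (t - a).
  apply: tint_abs_le => //.
  exact: (sec2 w (joint_drift_gap i)).
have iA i : L2 P (A i) by exact: L2_bounded (mA i) (A_bd i).
have irho i : L2 P (rho i) by exact: L2_bounded (mrho i) (rhoL i).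
have iI i : L2 P (I i) by case: (HI i).
have igap i : L2 P (fun w => gap t w i 0).
  apply: (L2_ae_eq (L2D (L2D (L2N (iA i)) (iI i)) (irho i)) (measurable_gap t i)).
  by apply: filterS Hgap => w ->.
split => //.
have sq_bd i u w : `|drift_gap i u w ^+ 2| <= (2 * L) ^+ 2.
  by rewrite normrX lerXn2r ?nnegrE ?mulr_ge0.
have jsq i : measurable_fun setT (fun x : measurableTypeR R * T => drift_gap i x.1 x.2 ^+ 2).
  by apply: measurable_funX; exact: joint_drift_gap.
have iDsq i u : L1 P (fun w => drift_gap i u w ^+ 2).
  apply: (L1_bounded P _ (sq_bd i u)).
  exact: (measurableT_comp (jsq i) (measurable_pair1 u)).
have mExsq i : measurable_fun setT (fun u => Ex (fun w => drift_gap i u w ^+ 2)).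
  by have [] := tint_fubini P a t (jsq i) (sq_bd i).
have Exsq_bd i u : `|Ex (fun w => drift_gap i u w ^+ 2)| <= (2 * L) ^+ 2.
  rewrite -(Ex_cst P ((2 * L) ^+ 2)); apply: Ex_abs_le => //; exact: L1_cst.
have one i : Ex (fun w => gap t w i 0 ^+ 2) <=
    3 * (TT * tint a t (fun u => Ex (fun w => drift_gap i u w ^+ 2))) +
    3 * (cI + L ^+ 2) * eta.
  have -> : Ex (fun w => gap t w i 0 ^+ 2) =
      Ex (fun w => (- A i w + I i w + rho i w) ^+ 2).
    apply: Ex_ae_eq.
    - by apply: measurable_funX.
    - apply: measurable_funX; apply: measurable_funD => //.
      apply: measurable_funD; last by case: (iI i).
      exact: measurableT_comp.
    - by apply: filterS Hgap => w ->.
  apply: (@le_trans _ _ (Ex (fun w => 3 * A i w ^+ 2 +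
      3 * I i w ^+ 2 + cst (3 * (L ^+ 2 * eta)) w))).
    apply: Ex_le.
    - exact: (L2D (L2D (L2N (iA i)) (iI i)) (irho i)).2.
    - apply: L1D; last exact: L1_cst.
      by apply: L1D; apply: L1Z; [exact: (iA i).2|exact: (iI i).2].
    - move=> w; have r2 : rho i w ^+ 2 <= L ^+ 2 * eta.
        rewrite -(real_normK (num_real (rho i w))).
        apply: (@le_trans _ _ ((L * eta) ^+ 2)).
          by rewrite lerXn2r ?nnegrE ?mulr_ge0 ?(ltW e0).
        rewrite exprMn ler_wpM2l ?sqr_ge0// expr2 ler_piMr// ltW//.
      rewrite /cst; move: (A i w) (I i w) (rho i w) r2 => x y z r2.
      have := sqr_ge0 (x + y); have := sqr_ge0 (x + z); have := sqr_ge0 (y - z).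
      by nra.
  rewrite ExD; last 2 first.
  - by apply: L1D; apply: L1Z; [exact: (iA i).2|exact: (iI i).2].
  - exact: L1_cst.
  rewrite ExD; last 2 first.
  - by apply: L1Z; exact: (iA i).2.
  - by apply: L1Z; exact: (iI i).2.
  rewrite (Ex_cst P) ExZ; last exact: (iA i).2.
  rewrite ExZ; last exact: (iI i).2.
  have [_ I2 _] := HI i.
  have A2 : Ex (fun w => A i w ^+ 2) <=
      TT * tint a t (fun u => Ex (fun w => drift_gap i u w ^+ 2)).
    have [mt _ <-] := tint_fubini P a t (jsq i) (sq_bd i).
    have it : L1 P (fun w => tint a t (fun u => drift_gap i u w ^+ 2)).
      apply: (L1_bounded P mt) => w; apply: tint_abs_le => //.
      exact: (@sec2 (fun u w => drift_gap i u w ^+ 2) w (jsq i)).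
    rewrite -ExZ//; apply: Ex_le; [exact: (iA i).2|exact: L1Z|].
    move=> w; apply: (@le_trans _ _ ((t - a) * tint a t (fun u => drift_gap i u w ^+ 2))).
      apply: (@tint_sqr_le _ _ _ _ (2 * L)) => //.
      exact: (sec2 w (joint_drift_gap i)).
    by rewrite ler_wpM2r//; apply: Rintegral_ge0 => u _; exact: sqr_ge0.
  by have := ltW e0; nra.
have -> : Ex (fun w => nsq (gap t w)) = \sum_i Ex (fun w => gap t w i 0 ^+ 2).
  by rewrite -Ex_sum// => i; exact: (igap i).2.
apply: (le_trans (ler_sum _ (fun i _ => one i))).
rewrite big_split/= sumr_const card_ord -!mulr_sumr.
have -> : \sum_i tint a t (fun u => Ex (fun w => drift_gap i u w ^+ 2)) =
   tint a t (fun u => Ex (fun w => \sum_i drift_gap i u w ^+ 2)).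
  have -> : (fun u => Ex (fun w => \sum_i drift_gap i u w ^+ 2)) =
      (fun u => \sum_i Ex (fun w => drift_gap i u w ^+ 2)).
    by apply/funext => u; rewrite Ex_sum.
  exact/esym/tint_sum.
rewrite -mulr_natl le_eqVlt; apply/orP; left; apply/eqP; ring.
Qed.

Let expw_ge1 (lam t : R) : 0 < lam -> a <= t -> 1 <= expR (lam * (t - a)).
Proof.
by move=> l0 at_; rewrite -[leLHS]expR0 ler_expR mulr_ge0 ?(ltW l0)// subr_ge0.
Qed.

Let expw_le (lam u t : R) : 0 < lam -> u <= t -> expR (lam * (u - a)) <= expR (lam * (t - a)).
Proof. by move=> l0 ut; rewrite ler_expR ler_wpM2l ?(ltW l0)// lerD2r. Qed.

Let measurable_expw (lam : R) : measurable_fun setT (fun u : R => expR (lam * (u - a))).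
Proof.
apply: (@measurableT_comp _ _ _ _ _ _ (@expR R)) => //.
by apply: measurable_funM => //; exact: measurable_funB.
Qed.

Let span (t : R) : t <= te -> t - a <= TT.
Proof. by move=> tte; apply: le_trans mT; rewrite lerBlDl. Qed.

Let nsq_gap_L1 t : a <= t -> t <= te -> L1 P (fun w => nsq (gap t w)).
Proof.
move=> at_ tte; have [igap _] := gap_second_moment_step at_ tte.
by apply: L1_sum => i; exact: (igap i).2.
Qed.

Definition noise_const := 3 * (d%:R * (cI + L ^+ 2)) + 1.

Let noise_const_gt0 : 0 < noise_const.
Proof.
have : 0 <= d%:R * (cI + L ^+ 2) by rewrite mulr_ge0// addr_ge0// sqr_ge0.
by rewrite /noise_const; lra.
Qed.

(** The drift being Lipschitz, the previous bound is an integral inequality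
    for the second moment.  For lam >= 6 TT L its integral term at most halves
    a bound in the norm with weight exp (lam (t - a)). *)
Lemma gap_second_moment (lam : R) : 0 < lam -> 6 * TT * L <= lam ->
  forall t, a <= t -> t <= te ->
    Ex (fun w => nsq (gap t w)) <= 3 * (noise_const * eta) * expR (lam * (t - a)).
Proof.
move=> lam0 lamL.
pose E (u : R) := Ex (fun w => \sum_i drift_gap i u w ^+ 2).
have jsum : measurable_fun setT (fun x : measurableTypeR R * T =>
    \sum_i drift_gap i x.1 x.2 ^+ 2).
  by apply: measurable_sum => i; apply: measurable_funX; exact: joint_drift_gap.
have sum_bd u w : `|\sum_i drift_gap i u w ^+ 2| <= d%:R * (2 * L) ^+ 2.
  rewrite (le_trans (ler_norm_sum _ _ _))// mulr_natl -[X in _ *+ X]card_ord -sumr_const.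
  by apply: ler_sum => i _; rewrite normrX lerXn2r ?nnegrE ?mulr_ge0.
have isum u : L1 P (fun w => \sum_i drift_gap i u w ^+ 2).
  apply: (L1_bounded P _ (sum_bd u)).
  exact: (measurableT_comp jsum (measurable_pair1 u)).
have mE : measurable_fun setT E.
  by have [] := @tint_fubini _ _ _ P
    (fun u w => \sum_i drift_gap i u w ^+ 2) a a _ jsum sum_bd.
have E_bd u : `|E u| <= d%:R * (2 * L) ^+ 2.
  by rewrite -(Ex_cst P (d%:R * (2 * L) ^+ 2)); apply: Ex_abs_le => //; exact: L1_cst.
pose Q S := forall t, a <= t -> t <= te ->
  Ex (fun w => nsq (gap t w)) <= S * expR (lam * (t - a)).
pose S0 := 3 * TT * (d%:R * (2 * L) ^+ 2 * TT) + noise_const * eta.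
have D0 : 0 <= d%:R * (2 * L) ^+ 2 by rewrite mulr_ge0 ?sqr_ge0.
have n0 : 0 < noise_const * eta by rewrite mulr_gt0.
have c_le : 3 * (d%:R * (cI + L ^+ 2)) * eta <= noise_const * eta.
  by rewrite ler_wpM2r ?(ltW e0)// /noise_const; lra.
apply: (@halving_iteration _ Q (noise_const * eta) S0) => //.
- by rewrite /S0 addr_ge0 ?(ltW n0)// !mulr_ge0.
- move=> t at_ tte; have [_] := gap_second_moment_step at_ tte.
  move=> /le_trans; apply.
  apply: (@le_trans _ _ S0); last first.
    by rewrite ler_peMr ?expw_ge1// /S0 addr_ge0 ?(ltW n0)// !mulr_ge0.
  rewrite lerD// ler_wpM2l ?mulr_ge0//.
  rewrite (le_trans (ler_norm _))// (le_trans (tint_abs_le at_ mE (fun u _ => E_bd u)))//.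
  by rewrite ler_wpM2l// span.
- move=> S S' SS QS t at_ tte; rewrite (le_trans (QS t at_ tte))//.
  by rewrite ler_wpM2r ?expR_ge0.
- move=> S S_ge0 QS t at_ tte; have [_] := gap_second_moment_step at_ tte.
  move=> /le_trans; apply; rewrite [leRHS]mulrDl addrC lerD//.
    by rewrite (le_trans c_le)// ler_peMr ?expw_ge1 ?(ltW n0).
  have : tint a t E <= L * S * (expR (lam * (t - a)) / lam).
    apply: (@le_trans _ _ (tint a t (fun u => L * S * expR (lam * (u - a))))).
      apply: (@tint_le _ _ _ _ _ (d%:R * (2 * L) ^+ 2 + L * S * expR (lam * (t - a)))) => //.
      + exact: measurable_funM.
      + by move=> u _; rewrite (le_trans (E_bd u))// lerDl !mulr_ge0 ?expR_ge0.
      + move=> u /andP[_ ut]; rewrite ger0_norm ?mulr_ge0 ?expR_ge0//.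
        by rewrite ler_wpDl// ler_wpM2l ?mulr_ge0// expw_le.
      + move=> u /andP[au ut]; have ute := le_trans ut tte.
        apply: (@le_trans _ _ (Ex (fun w => L * nsq (gap u w)))).
          apply: Ex_le => //; first by apply: L1Z; exact: nsq_gap_L1.
          move=> w; have [_ _ _ lip] := tb.
          rewrite (le_trans _ (lip (Y u w) (euler_path u w)))// le_eqVlt.
          by apply/orP; left; apply/eqP; apply: eq_bigr => i _; rewrite !mxE.
        rewrite ExZ; last exact: nsq_gap_L1.
        by rewrite -mulrA ler_wpM2l// QS.
    rewrite (@tintZ _ _ _ _ _ (expR (lam * (t - a))))//.
      by rewrite ler_wpM2l ?mulr_ge0// tint_exp_le.
    by move=> u /andP[_ ut]; rewrite ger0_norm ?expR_ge0// expw_le.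
  move=> /(ler_wpM2l (_ : 0 <= 3 * TT)) => /(_ (mulr_ge0 _ TT0)) H.
  rewrite (le_trans (H _))//.
  set x := expR _; have x0 : 0 <= x by exact: expR_ge0.
  have -> : 3 * TT * (L * S * (x / lam)) = (6 * TT * L / lam) * (S / 2 * x).
    by field; rewrite gt_eqF.
  by rewrite ler_piMl ?mulr_ge0// ler_pdivrMr// mul1r.
Qed.

(** d L bounds the action of the Jacobian of b on weights with entries at most
    1, and the added 1 allows to divide by it. *)
Definition linear_rate : R := d%:R * L + 1.

Definition linear_const lam : R :=
  d%:R * L * (3 * noise_const * expR (lam * TT)) * TT + d%:R * L + 1.

Let unit_family (zeta : 'I_d -> T -> R) :=
  (forall i, measurable_wrt G (zeta i)) /\ (forall i w, `|zeta i w| <= 1).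

(** In mean square the gap has size sqrt eta, but it is O(eta) when tested
    against weights known at the start of the epoch, since the noise is
    orthogonal to them.  The difference of the drifts is the Jacobian of b,
    taken on the Euler path, applied to the gap, up to the squared gap whose
    mean is O(eta).  The Euler path is known at the start of the epoch, so that
    the transposed Jacobian turns the weight into one of the same kind, and the
    integral inequality closes. *)
Lemma gap_linear (lam : R) : 0 < lam -> 6 * TT * L <= lam ->
  2 * linear_rate <= lam ->
  forall t zeta, a <= t -> t <= te ->
    (forall i, measurable_wrt G (zeta i)) -> (forall i w, `|zeta i w| <= 1) ->
    `|Ex (fun w => \sum_i zeta i w * gap t w i 0)| <=
      3 * (linear_const lam * eta) * expR (lam * (t - a)).
Proof.
move=> lam0 lamL lamR.
have Lam0 : 0 < linear_rate by rewrite /linear_rate ltr_wpDl// mulr_ge0.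
have dL0 : 0 <= d%:R * L by rewrite mulr_ge0.
have M2 := gap_second_moment lam0 lamL.
pose M := 3 * noise_const * expR (lam * TT) * eta.
have M0 : 0 <= M by rewrite !mulr_ge0 ?expR_ge0 ?(ltW noise_const_gt0) ?(ltW e0).
have nsqM u : a <= u -> u <= te -> Ex (fun w => nsq (gap u w)) <= M.
  move=> au ute; rewrite (le_trans (M2 u au ute))//.
  have -> : M = 3 * (noise_const * eta) * expR (lam * TT) by rewrite /M; ring.
  rewrite ler_wpM2l//; last by rewrite ler_expR ler_wpM2l ?(ltW lam0)// span.
  by rewrite !mulr_ge0 ?(ltW noise_const_gt0) ?(ltW e0).
pose pairing (zeta : 'I_d -> T -> R) u w := \sum_i zeta i w * drift_gap i u w.
have mz (zeta : 'I_d -> T -> R) : unit_family zeta -> forall i, measurable_fun setT (zeta i).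
  by move=> [Gz _] i; exact: measurable_wrt_measurable (Gz i).
have jpair zeta : unit_family zeta -> measurable_fun setT
    (fun x : measurableTypeR R * T => pairing zeta x.1 x.2).
  move=> uz; apply: measurable_sum => i; apply: measurable_funM => //.
  exact: (measurableT_comp (mz _ uz i) measurable_snd).
have pair_bd zeta : unit_family zeta -> forall u w, `|pairing zeta u w| <= d%:R * (2 * L).
  move=> uz u w; have z1 := uz.2; rewrite (le_trans (ler_norm_sum _ _ _))//.
  rewrite mulr_natl -[X in _ *+ X]card_ord -sumr_const.
  apply: ler_sum => i _; rewrite normrM -[leRHS]mul1r ler_pM//.
have ipair zeta u : unit_family zeta -> L1 P (pairing zeta u).
  move=> uz; apply: (L1_bounded P _ (pair_bd _ uz u)).
  exact: (measurableT_comp (jpair _ uz) (measurable_pair1 u)).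
pose Q S := forall t zeta, a <= t -> t <= te -> unit_family zeta ->
  `|Ex (fun w => \sum_i zeta i w * gap t w i 0)| <= S * expR (lam * (t - a)).
have igapz t zeta i : a <= t -> t <= te -> unit_family zeta ->
    L1 P (fun w => zeta i w * gap t w i 0).
  move=> at_ tte uz; have [igap _] := gap_second_moment_step at_ tte.
  by apply: L2_L1; apply: (L2M_bounded (igap i) (mz _ uz i)); case: uz.
(* the Jacobian is moved onto the weight, rescaled to have entries at most 1 *)
have linearize S u zeta : Q S -> a <= u -> u <= te -> unit_family zeta ->
    `|Ex (pairing zeta u)| <= linear_rate * S * expR (lam * (u - a)) + d%:R * L * M.
  move=> QS au ute uz; have [Gz z1] := uz.
  pose Jac i j w := grad (fun x => b x i 0) (euler_path u w) j 0.
  pose zeta' j w := linear_rate^-1 * \sum_i zeta i w * Jac i j w.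
  have [_ Qa _ _] := tb.
  have uz' : unit_family zeta'.
    split=> [j|j w].
      apply/(measurable_wrtP _ sG); apply: measurable_funM => //.
      apply: measurable_sum => i; apply/(measurable_wrtP _ sG).
      apply: measurable_wrtM => //.
      apply: (@grid_wrt (fun x => grad (fun y => b y i 0) x j 0)).
      by have [_ + _ _ _] := Qa i; exact.
    rewrite /zeta' normrM ger0_norm ?invr_ge0 ?(ltW Lam0)//.
    rewrite mulrC ler_pdivrMr// mul1r (le_trans (ler_norm_sum _ _ _))//.
    apply: (@le_trans _ _ (\sum_(i < d) L)).
      apply: ler_sum => i _; rewrite normrM -[leRHS]mul1r ler_pM//.
      by have [_ _ _ + _] := Qa i; exact.
    by rewrite sumr_const card_ord -mulr_natl /linear_rate lerDl.
  have QS' := QS u zeta' au ute uz'.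
  have is' : L1 P (fun w => \sum_j zeta' j w * gap u w j 0).
    by apply: L1_sum => j; exact: igapz.
  have close : `|Ex (fun w => pairing zeta u w -
      linear_rate * \sum_j zeta' j w * gap u w j 0)| <=
      Ex (fun w => d%:R * L * nsq (gap u w)).
    apply: Ex_abs_le.
    - by apply: L1B; [exact: ipair|exact: L1Z].
    - by apply: L1Z; exact: nsq_gap_L1.
    - move=> w.
      have -> : pairing zeta u w - linear_rate * \sum_j zeta' j w * gap u w j 0 =
          \sum_i zeta i w * (drift_gap i u w - \sum_j Jac i j w * gap u w j 0).
        have -> : linear_rate * \sum_j zeta' j w * gap u w j 0 =
            \sum_i zeta i w * \sum_j Jac i j w * gap u w j 0.
          under [RHS]eq_bigr do rewrite mulr_sumr.
          rewrite [RHS]exchange_big/= mulr_sumr; apply: eq_bigr => j _.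
          rewrite /zeta' !mulrA divff ?gt_eqF// mul1r mulr_suml.
          by apply: eq_bigr => i _; rewrite mulrA.
        by rewrite /pairing -sumrB; apply: eq_bigr => i _; exact/esym/mulrBr.
      rewrite (le_trans (ler_norm_sum _ _ _))//.
      apply: (@le_trans _ _ (\sum_(i < d) L * nsq (gap u w))); last first.
        by rewrite -mulrA mulr_natl sumr_const card_ord.
      apply: ler_sum => i _; rewrite normrM -[leRHS]mul1r ler_pM//.
      have [_ _ _ _ Ta] := Qa i.
      have := Ta (euler_path u w) (gap u w).
      by rewrite /gap [_ + (_ - _)]addrC subrK.
  rewrite ExB ?ExZ// in close; last 3 first.
  - exact: nsq_gap_L1.
  - exact: ipair.
  - exact: L1Z.
  have cM : d%:R * L * Ex (fun w => nsq (gap u w)) <= d%:R * L * M.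
    by rewrite ler_wpM2l// nsqM.
  rewrite -(subrK (linear_rate * Ex (fun w => \sum_j zeta' j w * gap u w j 0))
    (Ex (pairing zeta u))) addrC (le_trans (ler_normD _ _))//.
  rewrite lerD//; last exact: le_trans close cM.
  by rewrite normrM gtr0_norm// -mulrA ler_wpM2l ?(ltW Lam0).
have step S : 0 <= S -> Q S -> Q (linear_const lam * eta + S / 2).
  move=> S0 QS t zeta at_ tte uz; have [Gz z1] := uz.
  have [I [rho [HI mrho rhoL Hgap]]] := gap_decomposition at_ tte.
  have irho i : L1 P (fun w => zeta i w * rho i w).
    apply: (@L1_bounded _ _ _ _ _ (1 * (L * eta))).
      by apply: measurable_funM => //; exact: mz.
    by move=> w; rewrite normrM ler_pM.
  have iI i : L1 P (fun w => zeta i w * I i w).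
    by have [iI _ _] := HI i; apply: L2_L1; exact: (L2M_bounded iI (mz _ uz i)).
  have [mt mEp tE] := tint_fubini P a t (jpair _ uz) (pair_bd _ uz).
  have it : L1 P (fun w => tint a t (pairing zeta ^~ w)).
    apply: (L1_bounded P mt) => w; apply: tint_abs_le => //.
    exact: (@sec2 (pairing zeta) w (jpair _ uz)).
    by move=> u _; exact: pair_bd.
  have -> : Ex (fun w => \sum_i zeta i w * gap t w i 0) =
      Ex (fun w => - tint a t (pairing zeta ^~ w) +
        \sum_i zeta i w * I i w + \sum_i zeta i w * rho i w).
    apply: Ex_ae_eq.
    - by apply: (@L1_measurable _ _ _ P); apply: L1_sum => i; exact: igapz.
    - by apply: (@L1_measurable _ _ _ P); apply: L1D;
        [apply: L1D; [exact: L1N|exact: L1_sum]|exact: L1_sum].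
    - apply: filterS Hgap => w Hw.
      have -> : tint a t (pairing zeta ^~ w) =
          \sum_i zeta i w * tint a t (drift_gap i ^~ w).
        rewrite /pairing (@tint_sum _ _ _ _ _ _ (2 * L)).
        + apply: eq_bigr => i _; rewrite (@tintZ _ _ _ _ _ (2 * L))//.
          exact: (sec2 w (joint_drift_gap i)).
        + move=> i; apply: measurable_funM => //.
          exact: (sec2 w (joint_drift_gap i)).
        + by move=> i u; rewrite normrM -[leRHS]mul1r ler_pM.
      rewrite -sumrN -!big_split/=; apply: eq_bigr => i _; rewrite Hw; ring.
  rewrite ExD; last 2 first.
  - by apply: L1D; [exact: L1N|exact: L1_sum].
  - exact: L1_sum.
  rewrite ExD; last 2 first.
  - exact: L1N.
  - exact: L1_sum.
  rewrite [X in _ + X + _]Ex_sum// [X in _ + X + _]big1; last first.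
    by move=> i _; have [_ _ H] := HI i; exact: H (Gz i) (z1 i).
  rewrite addr0 (le_trans (ler_normD _ _))//.
  have -> : Ex (fun w => - tint a t (pairing zeta ^~ w)) =
      - tint a t (fun u => Ex (pairing zeta u)).
    rewrite -tE -[RHS]mulN1r -ExZ//.
    by apply: eq_Rintegral => w _; rewrite mulN1r.
  rewrite normrN.
  have B1 : `|tint a t (fun u => Ex (pairing zeta u))| <=
      S / 2 * expR (lam * (t - a)) + d%:R * L * M * TT.
    apply: (@le_trans _ _ (tint a t (fun u => linear_rate * S * expR (lam * (u - a)) +
        cst (d%:R * L * M) u))).
      apply: (@tint_norm_le _ _ _ _ _
        (linear_rate * S * expR (lam * (t - a)) + d%:R * L * M)) => //.
      - by apply: measurable_funD => //; exact: measurable_funM.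
      - move=> u /andP[au ut]; apply: linearize => //; exact: le_trans ut tte.
      - move=> u /andP[au ut]; rewrite /cst ger0_norm.
          by rewrite lerD2r ler_wpM2l ?mulr_ge0 ?(ltW Lam0)// expw_le.
        by rewrite addr_ge0 ?(mulr_ge0 dL0)// !mulr_ge0 ?expR_ge0 ?(ltW Lam0).
    rewrite (@tintD _ _ _ _ _
      (linear_rate * S * expR (lam * (t - a)) + d%:R * L * M))//; last 3 first.
    - exact: measurable_funM.
    - move=> u /andP[au ut]; rewrite ger0_norm ?mulr_ge0 ?expR_ge0 ?(ltW Lam0)//.
      by rewrite ler_wpDr ?(mulr_ge0 dL0)// ler_wpM2l ?mulr_ge0 ?(ltW Lam0)// expw_le.
    - move=> u _; rewrite /cst ger0_norm ?(mulr_ge0 dL0 M0)//.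
      by rewrite lerDr !mulr_ge0 ?expR_ge0 ?(ltW Lam0).
    rewrite tint_cst// lerD//; last by rewrite ler_wpM2l ?(mulr_ge0 dL0 M0)// span.
    rewrite (@tintZ _ _ _ _ _ (expR (lam * (t - a))))//; last first.
      by move=> u /andP[_ ut]; rewrite ger0_norm ?expR_ge0// expw_le.
    apply: (@le_trans _ _ (linear_rate * S * (expR (lam * (t - a)) / lam))).
      by rewrite ler_wpM2l ?mulr_ge0 ?(ltW Lam0)// tint_exp_le.
    set x := expR _; have x0 : 0 <= x by exact: expR_ge0.
    have -> : linear_rate * S * (x / lam) = (2 * linear_rate / lam) * (S / 2 * x).
      by field; rewrite gt_eqF.
    by rewrite ler_piMl ?mulr_ge0// ler_pdivrMr// mul1r.
  have B2 : `|Ex (fun w => \sum_i zeta i w * rho i w)| <= d%:R * L * eta.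
    rewrite -(Ex_cst P (d%:R * L * eta)); apply: Ex_abs_le.
    - exact: L1_sum.
    - exact: L1_cst.
    - move=> w; rewrite (le_trans (ler_norm_sum _ _ _))// /cst -mulrA.
      rewrite mulr_natl -[X in _ *+ X]card_ord -sumr_const.
      by apply: ler_sum => i _; rewrite normrM -[leRHS]mul1r ler_pM.
  rewrite (le_trans (lerD B1 B2))// mulrDl -addrA addrC lerD2r.
  have x1 := expw_ge1 lam0 at_.
  apply: (@le_trans _ _ (linear_const lam * eta)).
    rewrite /linear_const /M; have := ltW e0.
    by set X := expR _; lra.
  rewrite ler_peMr// mulr_ge0 ?(ltW e0)// /linear_const.
  by rewrite !addr_ge0// !mulr_ge0 ?expR_ge0 ?(ltW noise_const_gt0).
have QC : Q (3 * (linear_const lam * eta)).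
  apply: (@halving_iteration _ Q (linear_const lam * eta) (d%:R + M)) => //.
  - rewrite mulr_gt0// /linear_const ltr_wpDl// addr_ge0// !mulr_ge0 ?expR_ge0//.
    exact: ltW noise_const_gt0.
  - by rewrite addr_ge0.
  - move=> t zeta at_ tte uz; have [Gz z1] := uz.
    apply: (@le_trans _ _ (d%:R + M)); last by rewrite ler_peMr ?expw_ge1 ?addr_ge0.
    apply: (@le_trans _ _ (Ex (fun w => cst d%:R w + nsq (gap t w)))).
      apply: Ex_abs_le.
      - by apply: L1_sum => i; exact: igapz.
      - by apply: L1D; [exact: L1_cst|exact: nsq_gap_L1].
      - move=> w; rewrite (le_trans (ler_norm_sum _ _ _))//.
        have -> : cst (d%:R : R) w = \sum_(i < d) 1 by rewrite sumr_const card_ord.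
        rewrite /nsq -big_split/=; apply: ler_sum => i _.
        rewrite normrM (@le_trans _ _ (1 * `|gap t w i 0|))//; first by rewrite ler_wpM2r.
        rewrite mul1r -(real_normK (num_real (gap t w i 0))).
        by set y := `|_|; have := sqr_ge0 (y - 1); nra.
    rewrite ExD ?(Ex_cst P) ?lerD2l ?nsqM//; first exact: L1_cst.
    exact: nsq_gap_L1.
  - move=> S S' SS QS t zeta at_ tte uz; rewrite (le_trans (QS t zeta at_ tte uz))//.
    by rewrite ler_wpM2r ?expR_ge0.
by move=> t zeta at_ tte Gz z1; exact: QC.
Qed.

Definition epoch_const (lam Gp K : R) : R :=
  (Gp + 1) * (3 * linear_const lam * expR (lam * TT)) +
  K * (3 * noise_const * expR (lam * TT)).

(** v is expanded at the end of the Euler path: the linear term is the gap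
    tested against the gradient, and the remainder is its second moment. *)
Lemma epoch_weak_error (lam : R) v p (Gp K : R) :
  0 < lam -> 6 * TT * L <= lam -> 2 * linear_rate <= lam ->
  quad_approx v p Gp K -> 0 <= Gp -> 0 <= K ->
  `|Ex (fun w => v (Y te w)) - Ex (fun w => v (iter m (euler eta b) (Y a w)))| <=
  epoch_const lam Gp K * eta.
Proof.
move=> lam0 lamL lamR [cv cp [B vB] pG vK] Gp0 K0.
have ate : a <= te by rewrite lerDl mulr_ge0 ?(ltW e0).
have tick_te : tick a eta te = m.
  by apply: tickE => //; rewrite lexx ltrD2l ltr_pM2r// ltr_nat leqnn.
have Xte w : euler_path te w = grid m w by rewrite /euler_path tick_te.
have Gp1 : 0 < Gp + 1 by rewrite ltr_wpDl.
(* Gp + 1 instead of Gp, which may be 0 *)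
pose zeta i w := (Gp + 1)^-1 * p (grid m w) i 0.
have Gz i : measurable_wrt G (zeta i).
  apply: measurable_wrtM => //; first exact: measurable_wrt_cst.
  exact: (@grid_wrt (fun x => p x i 0)).
have z1 i w : `|zeta i w| <= 1.
  rewrite /zeta normrM ger0_norm ?invr_ge0 ?(ltW Gp1)// mulrC ler_pdivrMr// mul1r.
  by rewrite (le_trans (pG _ _))// lerDl.
have lin := gap_linear lam0 lamL lamR ate (lexx _) Gz z1.
have sq := gap_second_moment lam0 lamL ate (lexx _).
have [igap _] := gap_second_moment_step ate (lexx _).
have iz i : L1 P (fun w => zeta i w * gap te w i 0).
  apply: L2_L1; apply: (L2M_bounded (igap i) _ (z1 i)).
  exact: measurable_wrt_measurable (Gz i).
have izs : L1 P (fun w => \sum_i zeta i w * gap te w i 0) by exact: L1_sum.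
have ivY : L1 P (fun w => v (Y te w)).
  apply: (L1_bounded P _ (fun w => vB (Y te w))).
  exact: measurable_continuous_col.
have ivX : L1 P (fun w => v (grid m w)).
  by apply: (L1_bounded P _ (fun w => vB (grid m w))); exact: measurable_grid.
have nsqI : L1 P (fun w => nsq (gap te w)) by exact: nsq_gap_L1.
rewrite -/(grid m) -ExB//.
have close : `|Ex (fun w => (v (Y te w) - v (grid m w)) -
    (Gp + 1) * \sum_i zeta i w * gap te w i 0)| <= Ex (fun w => K * nsq (gap te w)).
  apply: Ex_abs_le.
  - by apply: L1B; [exact: L1B|exact: L1Z].
  - exact: L1Z.
  - move=> w; have -> : (Gp + 1) * \sum_i zeta i w * gap te w i 0 =
        \sum_i p (grid m w) i 0 * gap te w i 0.
      rewrite mulr_sumr; apply: eq_bigr => i _.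
      by rewrite /zeta !mulrA divff ?gt_eqF// mul1r.
    have := vK (grid m w) (gap te w).
    by rewrite (_ : grid m w + gap te w = Y te w)// /gap Xte addrC subrK.
rewrite ExB in close; [|exact: L1B|exact: L1Z].
rewrite !ExZ// in close.
rewrite -(subrK ((Gp + 1) * Ex (fun w => \sum_i zeta i w * gap te w i 0))
  (Ex (fun w => v (Y te w) - v (grid m w)))) addrC (le_trans (ler_normD _ _))//.
have expT : expR (lam * (te - a)) <= expR (lam * TT).
  by rewrite ler_expR ler_wpM2l ?(ltW lam0)// span.
have n0 := ltW noise_const_gt0.
have l0 : 0 <= linear_const lam.
  by rewrite /linear_const !addr_ge0// !mulr_ge0 ?expR_ge0.
rewrite /epoch_const [leRHS]mulrDl lerD//.
  rewrite normrM gtr0_norm// -mulrA ler_wpM2l ?(ltW Gp1)// (le_trans lin)//.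
  rewrite (_ : 3 * linear_const lam * _ * eta =
    3 * (linear_const lam * eta) * expR (lam * TT)); last by ring.
  by rewrite ler_wpM2l// !mulr_ge0// ltW.
rewrite (le_trans close)// -mulrA ler_wpM2l// (le_trans sq)//.
rewrite (_ : 3 * noise_const * _ * eta =
  3 * (noise_const * eta) * expR (lam * TT)); last by ring.
by rewrite ler_wpM2l// !mulr_ge0// ltW.
Qed.

End epoch.

(** * The gradient noise and one SVRG step *)

Lemma sqrB_le {R : realDomainType} (x y : R) :
  (x - y) ^+ 2 <= 2 * x ^+ 2 + 2 * y ^+ 2.
Proof. by have := sqr_ge0 (x + y); nra. Qed.

Lemma mean_sqrB_le {R : realFieldType} {n : nat} (u v w : 'I_n -> R) :
  (forall i, u i = v i - w i) ->
  n%:R^-1 * \sum_i u i ^+ 2 <=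
  2 * (n%:R^-1 * \sum_i v i ^+ 2) + 2 * (n%:R^-1 * \sum_i w i ^+ 2).
Proof.
move=> uE; rewrite mulrCA [2 * (_ * \sum_i w i ^+ 2)]mulrCA -mulrDr.
rewrite ler_wpM2l ?invr_ge0// !mulr_sumr -big_split/=; apply: ler_sum => i _.
by rewrite uE; exact: sqrB_le.
Qed.

Section gradient_noise.
Context {R : realType} {n d : nat}.
Hypothesis n_gt0 : (0 < n)%N.
Variable f : 'I_n -> 'cV[R]_d -> R.
Hypothesis f_diff : forall i x, differentiable (f i) x.

Let n0 : (n%:R : R) != 0. Proof. by rewrite pnatr_eq0 -lt0n. Qed.

Lemma grad_favg x l : grad (favg f) x l 0 = n%:R^-1 * \sum_i grad (f i) x l 0.
Proof.
rewrite mxE /partial.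
have dfi i : derivable (f i) x (basis_vec l) by exact: diff_derivable.
rewrite (_ : favg f = n%:R^-1 \*: (\sum_i f i)); last first.
  by apply/funext => y; rewrite /favg /= fct_sumE.
rewrite deriveZ; last exact: derivable_sum.
rewrite derive_sum// /GRing.scale/=; congr (_ * _).
by apply: eq_bigr => i _; rewrite mxE.
Qed.

(** The noise of an SVRG step: the deviation of the variance-reduced gradient
    from its mean over i. *)
Definition dev (i : 'I_n) (x y : 'cV[R]_d) : 'cV[R]_d :=
  (grad (f i) x - grad (f i) y) - (grad (favg f) x - grad (favg f) y).

Let dev_entry i x y l : dev i x y l 0 =
  (grad (f i) x l 0 - grad (f i) y l 0) -
  n%:R^-1 * \sum_j (grad (f j) x l 0 - grad (f j) y l 0).
Proof.
rewrite sumrB mulrBr -!grad_favg /dev.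
move: (grad (f i) x) (grad (f i) y) (grad (favg f) x) (grad (favg f) y) => A B C D.
by rewrite !mxE.
Qed.

Lemma dev_chain i x y z l : dev i x y l 0 = dev i x z l 0 - dev i y z l 0.
Proof.
rewrite /dev.
move: (grad (f i) x) (grad (f i) y) (grad (f i) z) => A B C.
move: (grad (favg f) x) (grad (favg f) y) (grad (favg f) z) => A' B' C'.
by rewrite !mxE; ring.
Qed.

Let devE i x y : dev i x y =
  (grad (f i) x - grad (f i) y) - (grad (favg f) x - grad (favg f) y).
Proof. by []. Qed.

#[local] Opaque dev.

Lemma sum_dev x y l : \sum_i dev i x y l 0 = 0.
Proof.
under eq_bigr do rewrite dev_entry.
rewrite sumrB sumr_const card_ord -mulrnAl -mulr_natr mulVf//.
by rewrite mul1r subrr.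
Qed.

Lemma sigma_diagE x y l : sigma f x y l l = n%:R^-1 * \sum_i dev i x y l 0 ^+ 2.
Proof.
pose a i := grad (f i) x l 0 - grad (f i) y l 0; pose A := n%:R^-1 * \sum_j a j.
have entry (u v w z : 'cV[R]_d) : ((u - v) *m (w - z)^T) l l =
    (u l 0 - v l 0) * (w l 0 - z l 0).
  by rewrite mxE big_ord1 !mxE.
have -> : sigma f x y l l = n%:R^-1 * \sum_i a i ^+ 2 - A ^+ 2.
  rewrite /sigma; set F := _ *m _; set S := \sum_i _.
  have -> : A ^+ 2 = F l l.
    by rewrite /F entry (grad_favg x) (grad_favg y) expr2 /A /a sumrB mulrBr.
  have -> : \sum_i a i ^+ 2 = S l l.
    by rewrite /S summxE; apply: eq_bigr => i _; rewrite entry expr2.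
  by move: S F => S F; rewrite !mxE.
have -> : \sum_i dev i x y l 0 ^+ 2 = \sum_i (a i - A) ^+ 2.
  by apply: eq_bigr => i _; rewrite dev_entry.
have sA : \sum_i a i = n%:R * A by rewrite /A mulrA mulfV// mul1r.
transitivity (n%:R^-1 * (\sum_i a i ^+ 2 - 2 * A * \sum_i a i + n%:R * A ^+ 2)).
  by rewrite sA; field.
congr (_ * _); rewrite mulr_sumr -sumrB.
have -> : n%:R * A ^+ 2 = \sum_(i < n) A ^+ 2 by rewrite sumr_const card_ord mulr_natl.
by rewrite -big_split/=; apply: eq_bigr => i _; ring.
Qed.

Lemma dev_variance_le x y z l :
  n%:R^-1 * \sum_i dev i x y l 0 ^+ 2 <=
  2 * (n%:R^-1 * \sum_i dev i x z l 0 ^+ 2) +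
  2 * (n%:R^-1 * \sum_i dev i y z l 0 ^+ 2).
Proof. exact: (mean_sqrB_le (fun i => dev_chain i x y z l)). Qed.

(** The hypothesis bounds sigma in its first argument for each value of the
    second, with bounds that may depend on it.  The deviation at (x, y) is the
    difference of those at (x, 0) and (y, 0), so that the single value 0
    controls all variances. *)
Lemma sigma_diag_bounded : (forall y, classG_mx 2 (fun x => sigma f x y)) ->
  exists2 C : R, 0 <= C & forall x y l, sigma f x y l l <= C.
Proof.
move=> Gs.
have /choice[B HB] : forall l, exists B, forall x, `|sigma f x 0 l l| <= B.
  by move=> l; have [] := classG_bounded (Gs 0 l l) => B HB; exists B.
have BS x l : n%:R^-1 * \sum_i dev i x 0 l 0 ^+ 2 <= \sum_l `|B l|.
  rewrite -sigma_diagE.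
  rewrite (le_trans (ler_norm _))// (le_trans (HB l x))// (le_trans (ler_norm _))//.
  by rewrite (bigD1 l)//= lerDl sumr_ge0.
exists (4 * \sum_l `|B l|); first by rewrite mulr_ge0 ?sumr_ge0.
move=> x y l; rewrite sigma_diagE.
apply: (le_trans (dev_variance_le x y 0 l)).
have two0 : 0 <= 2 :> R by [].
apply: (le_trans (lerD (ler_wpM2l two0 (BS x l)) (ler_wpM2l two0 (BS y l)))).
by rewrite -mulrDl; have -> : 2 + 2 = 4 :> R by ring.
Qed.

(** The squares of the entries in row i of a symmetric root of A add up to
    A i i; the default value 0 of the root satisfies the bound as well. *)
Lemma sqrtmx_entry_sqr_le (A : 'M[R]_d) (c : R) i j : 0 <= c ->
  (forall l, A l l <= c) -> sqrtmx A i j ^+ 2 <= c.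
Proof.
move=> c0 Ac; rewrite /sqrtmx; case: xgetP => [B _ [[symB _] BB]|_]; last first.
  by rewrite mxE expr0n.
apply: (le_trans _ (Ac i)); rewrite -BB mxE (bigD1 j)//=.
have E k : B i k * B k i = B i k ^+ 2 by rewrite expr2 -{2}symB mxE.
by rewrite E lerDl sumr_ge0// => k _; rewrite E sqr_ge0.
Qed.

(** z is the current iterate and y the snapshot at the start of the epoch. *)
Definition svrg_step (eta : R) (y z : 'cV[R]_d) (i : 'I_n) : 'cV[R]_d :=
  z - eta *: (grad (f i) z - grad (f i) y + grad (favg f) y).

(** A step is the Euler step perturbed by - eta dev.  The average over i
    cancels the linear term of v, and the remainder averages to K eta^2 times
    the trace of sigma. *)
Lemma svrg_step_error (eta C : R) v p (G K : R) y z : quad_approx v p G K ->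
  0 <= K -> (forall x y l, sigma f x y l l <= C) ->
  `|n%:R^-1 * \sum_i v (svrg_step eta y z i) - v (euler eta (grad (favg f)) z)| <=
  K * (d%:R * C) * eta ^+ 2.
Proof.
move=> [_ _ _ _ vK] K0 sC; set x := euler _ _ _.
pose h i : 'cV[R]_d := - eta *: dev i z y.
have stepE i : svrg_step eta y z i = x + h i.
  rewrite /svrg_step /x /h /euler devE.
  move: (grad (f i) z) (grad (f i) y) (grad (favg f) z) (grad (favg f) y) => A B C' D.
  by apply/colP => l; rewrite !mxE; ring.
have sh : \sum_i \sum_l p x l 0 * h i l 0 = 0.
  rewrite exchange_big big1// => l _; rewrite -mulr_sumr.
  under eq_bigr do rewrite mxE.
  by rewrite -mulr_sumr sum_dev !mulr0.
have -> : n%:R^-1 * \sum_i v (svrg_step eta y z i) - v x =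
   n%:R^-1 * \sum_i (v (x + h i) - v x - \sum_l p x l 0 * h i l 0).
  rewrite !sumrB sh subr0 sumr_const card_ord mulrBr -[v x *+ n]mulr_natl mulrA mulVf// mul1r.
  by congr (_ * _ - _); apply: eq_bigr => i _; rewrite stepE.
rewrite normrM ger0_norm ?invr_ge0//.
apply: (@le_trans _ _ (n%:R^-1 * \sum_i K * nsq (h i))).
  rewrite ler_wpM2l ?invr_ge0// (le_trans (ler_norm_sum _ _ _))//.
  by apply: ler_sum => i _; exact: vK.
have -> : n%:R^-1 * \sum_i K * nsq (h i) =
    K * eta ^+ 2 * \sum_l sigma f z y l l.
  under [X in _ = _ * X]eq_bigr do rewrite sigma_diagE.
  rewrite -[X in _ = _ * X]mulr_sumr exchange_big/= -mulr_sumr mulrCA -mulrA.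
  congr (_ * _); rewrite [RHS]mulrCA; congr (_ * _).
  by rewrite mulr_sumr; apply: eq_bigr => i _; rewrite nsqZ sqrrN.
rewrite [leRHS]mulrAC ler_wpM2l ?(mulr_ge0 K0 (sqr_ge0 _))//.
apply: (@le_trans _ _ (\sum_(l < d) C)); last first.
  by rewrite sumr_const card_ord mulr_natl.
apply: ler_sum => l _; exact: sC.
Qed.

End gradient_noise.

(** * SVRG against gradient descent *)

Section index_law.
Context {R : realType} {n : nat} {disp : measure_display}
  {T : measurableType disp}.
Variables (P : probability T R) (gam : nat -> T -> 'I_n).
Hypotheses (n_gt0 : (0 < n)%N) (iid : iid_uniform P gam).
Local Notation Ex X := (\int[P]_w X w).

(** The latest index comes first, so that a new draw is a cons. *)
Fixpoint hist k (w : T) : seq 'I_n :=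
  if k is k'.+1 then gam k'.+1 w :: hist k' w else [::].

Lemma size_hist k w : size (hist k w) = k.
Proof. by elim: k => //= k ->. Qed.

Lemma nth_hist (i0 : 'I_n) k w l : (l < k)%N -> nth i0 (hist k w) l = gam (k - l) w.
Proof. by elim: k l => [|k IH] [|l]//= lk; rewrite subSS IH. Qed.

Lemma hist_eqP (i0 : 'I_n) k w (s : seq 'I_n) : size s = k ->
  hist k w = s <-> forall j, j \in iota 1 k -> gam j w = nth i0 s (k - j).
Proof.
move=> sk; split => [<- j|H].
  rewrite mem_iota add1n ltnS => /andP[j0 jk].
  by rewrite nth_hist ?subKn// ltn_subrL j0 (leq_trans j0 jk).
apply: (@eq_from_nth _ i0); first by rewrite size_hist.
move=> l; rewrite size_hist => lk; rewrite nth_hist// H ?subKn ?(ltnW lk)//.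
by rewrite mem_iota add1n ltnS subn_gt0 lk leq_subr.
Qed.

Lemma hist_measurable k (s : seq 'I_n) : size s = k ->
  measurable [set w | hist k w = s].
Proof.
have [mg _ _] := iid.
elim: k s => [|k IH] [|i s]//=.
  by move=> _; rewrite (_ : [set _ | _] = setT)//; apply/seteqP; split.
move=> [sk].
rewrite (_ : [set _ | _] = gam k.+1 @^-1` [set i] `&` [set w | hist k w = s]).
  by apply: measurableI; [exact: mg|exact: IH].
apply/seteqP; split => w /=; first by case.
by case=> -> ->.
Qed.

Lemma hist_law k (s : seq 'I_n) : size s = k ->
  P [set w | hist k w = s] = (n%:R^-1 ^+ k)%:E.
Proof.
move=> sk; have [mg ug ind] := iid.
pose i0 := Ordinal n_gt0.
pose A j : set 'I_n := [set nth i0 s (k - j)].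
have -> : [set w | hist k w = s] =
    \bigcap_(j in [set` iota 1 k]) (gam j @^-1` A j).
  apply/seteqP; split => w /=.
    by move=> /(hist_eqP i0 _ sk) H j jk; exact: H.
  by move=> H; apply/(hist_eqP i0 _ sk) => j jk; exact: H.
rewrite ind ?iota_uniq//; last by move=> j; rewrite mem_iota => /andP[].
rewrite big_seq (eq_bigr (fun=> (n%:R^-1)%:E)); last first.
  by move=> j; rewrite mem_iota => /andP[j0 _]; exact: ug.
rewrite -big_seq prodEFin big_const_seq count_predT size_iota.
by congr EFin; rewrite iter_mulr_1.
Qed.

(** The first k indices form one of finitely many equally likely sequences,
    so that any function of them is a random variable with an explicit mean. *)
Lemma Ex_hist k (phi : seq 'I_n -> R) :
  L1 P (fun w => phi (hist k w)) /\
  Ex (fun w => phi (hist k w)) = n%:R^-1 ^+ k * \sum_(s : k.-tuple 'I_n) phi s.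
Proof.
have sz w : size (hist k w) == k by rewrite size_hist.
pose A (s : k.-tuple 'I_n) := [set w | hist k w = s].
have E : (fun w => phi (hist k w)) = fun w => \sum_(s : k.-tuple 'I_n) phi s * \1_(A s) w.
  apply/funext => w; rewrite (bigD1 (Tuple (sz w)))//= indicE mem_set//.
  rewrite mulr1 big1 ?addr0// => s sw; rewrite indicE memNset ?mulr0//.
  by move=> /= H; move/eqP: sw; apply; apply: val_inj.
have mA s : measurable (A s) by exact: hist_measurable (size_tuple s).
have I1 (s : k.-tuple 'I_n) : L1 P (\1_(A s)).
  apply: (@L1_bounded _ _ _ _ _ 1); first exact: measurable_indic.
  by move=> w; rewrite indicE; case: (_ \in _); rewrite ?normr1 ?normr0.
rewrite E; split; first by apply: L1_sum => s; exact: L1Z.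
rewrite Ex_sum; last by move=> s; exact: L1Z.
rewrite mulr_sumr; apply: eq_bigr => s _; rewrite ExZ// mulrC; congr (_ * _).
rewrite /Rintegral integral_indic// setIT.
exact: (congr1 fine (hist_law (size_tuple s))).
Qed.

Lemma Ex_hist_le k (phi psi : seq 'I_n -> R) (c : R) :
  (forall s, `|phi s - psi s| <= c) ->
  `|Ex (fun w => phi (hist k w)) - Ex (fun w => psi (hist k w))| <= c.
Proof.
move=> H; have [i1 _] := Ex_hist k phi; have [i2 _] := Ex_hist k psi.
rewrite -ExB// -[leRHS](Ex_cst P); apply: Ex_abs_le => //; first exact: L1B.
exact: L1_cst.
Qed.

(** Given the past, the last index is uniform. *)
Lemma Ex_hist_last k (phi : seq 'I_n -> R) :
  Ex (fun w => phi (hist k.+1 w)) =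
  Ex (fun w => n%:R^-1 * \sum_i phi (i :: hist k w)).
Proof.
rewrite (Ex_hist k.+1 phi).2.
rewrite (Ex_hist k (fun s => n%:R^-1 * \sum_i phi (i :: s))).2.
rewrite exprSr -mulrA; congr (_ * _).
rewrite -mulr_sumr; congr (_ * _); rewrite exchange_big/=.
rewrite pair_big/=.
rewrite (reindex (fun x : 'I_n * k.-tuple 'I_n => [tuple of x.1 :: x.2]))/=.
  by [].
exists (fun s : k.+1.-tuple 'I_n => (thead s, [tuple of behead s])) => [[i s] _|s _] /=.
  by congr pair; apply: val_inj.
by rewrite [RHS]tuple_eta; apply: val_inj.
Qed.

End index_law.

Section svrg_error.
Context {R : realType} {n d : nat} {disp : measure_display}
  {T : measurableType disp}.
Variables (P : probability T R) (gam : nat -> T -> 'I_n).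
Variables (f : 'I_n -> 'cV[R]_d -> R) (m : nat) (eta : R) (z0 : 'cV[R]_d).
Variable z : nat -> T -> 'cV[R]_d.
Hypotheses (n_gt0 : (0 < n)%N) (m_gt0 : (0 < m)%N).
Hypotheses (iid : iid_uniform P gam) (zP : is_svrg f m eta z0 gam z).
Hypothesis f_diff : forall i x, differentiable (f i) x.
Local Notation Ex X := (\int[P]_w X w).

(** The iterate and the snapshot as functions of the indices drawn; the
    snapshot is renewed after a multiple of m draws. *)
Fixpoint svrg_run (s : seq 'I_n) : 'cV[R]_d * 'cV[R]_d :=
  if s is i :: s' then
    let: (x, y) := svrg_run s' in
    let x' := svrg_step f eta y x i in
    (x', if (m %| (size s').+1)%N then x' else y)
  else (z0, z0).

Lemma svrg_runE k w :
  svrg_run (hist gam k w) = (z k w, z ((k %/ m) * m)%N w).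
Proof.
have [z00 zS] := zP; elim: k => [|k IH] /=; first by rewrite div0n mul0n z00.
have zk : z k.+1 w = svrg_step f eta (z (k %/ m * m)%N w) (z k w) (gam k.+1 w).
  by apply: (zS (k %/ m)%N); rewrite ltnS leq_trunc_div ltn_ceil.
rewrite IH -zk size_hist; congr pair.
have [mk|mk] := boolP (m %| k.+1)%N; first by rewrite divnK.
by rewrite divnS// (negbTE mk).
Qed.

(** The steps of SVRG are exchanged one by one for Euler steps: when l steps
    are random and the other k - l are Euler steps, exchanging the last random
    one is a step error for the test function v o Phi^(k - l). *)
Lemma svrg_weak_error (v : 'cV[R]_d -> R) (G K C : R) k : 0 <= K ->
  (forall x y l, sigma f x y l l <= C) ->
  (forall j, (j <= k)%N -> exists p,
     quad_approx (v \o iter j (euler eta (grad (favg f)))) p G K) ->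
  L1 P (fun w => v (z k w)) /\
  `|Ex (fun w => v (z k w)) - v (iter k (euler eta (grad (favg f))) z0)| <=
  k%:R * (K * (d%:R * C) * eta ^+ 2).
Proof.
move=> K0 sC vQ; set Phi := euler _ _ in vQ *.
have zE l w : z l w = (svrg_run (hist gam l w)).1 by rewrite svrg_runE.
split.
  have [H _] := Ex_hist n_gt0 iid k (fun s => v (svrg_run s).1).
  by move: H; congr L1; apply/funext => w; rewrite zE.
suff H l : (l <= k)%N ->
    `|Ex (fun w => v (iter (k - l) Phi (z l w))) - v (iter k Phi z0)| <=
    l%:R * (K * (d%:R * C) * eta ^+ 2).
  by have := H k (leqnn k); rewrite subnn.
elim: l => [|l IH] lk.
  under eq_Rintegral do rewrite (proj1 zP) subn0.
  by rewrite (Ex_cst P) subrr normr0 mul0r.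
have klE : (k - l = (k - l.+1).+1)%N by rewrite subnSK.
rewrite -natr1 mulrDl mul1r [leRHS]addrC.
rewrite -(subrK (Ex (fun w => v (iter (k - l) Phi (z l w))))
  (Ex (fun w => v (iter (k - l.+1) Phi (z l.+1 w))))) -addrA.
rewrite (le_trans (ler_normD _ _))// lerD//; last exact: IH (ltnW lk).
pose phi s := v (iter (k - l.+1) Phi (svrg_run s).1).
have -> : (fun w => v (iter (k - l.+1) Phi (z l.+1 w))) = (fun w => phi (hist gam l.+1 w)).
  by apply/funext => w; rewrite zE.
have -> : (fun w => v (iter (k - l) Phi (z l w))) =
    (fun w => v (iter (k - l) Phi (svrg_run (hist gam l w)).1)).
  by apply/funext => w; rewrite zE.
rewrite (Ex_hist_last n_gt0 iid).
apply: (@Ex_hist_le _ _ _ _ _ _ n_gt0 iid l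
  (fun s => n%:R^-1 * \sum_i phi (i :: s))
  (fun s => v (iter (k - l) Phi (svrg_run s).1))) => s.
have [p Qp] := vQ (k - l.+1)%N (leq_subr _ _).
have := svrg_step_error n_gt0 f_diff eta (svrg_run s).2 (svrg_run s).1 Qp K0 sC.
rewrite /phi/=; case: (svrg_run s) => x y /=.
by rewrite klE iterSr.
Qed.

End svrg_error.

(** * The modified equation against gradient descent *)

Section sdme_error.
Context {R : realType} {n d : nat} {disp : measure_display}
  {T : measurableType disp}.
Variables (P : probability T R) (Ft : R -> set (set T)).
Variables (W Y : R -> T -> 'cV[R]_d).
Variables (f : 'I_n -> 'cV[R]_d -> R) (m : nat) (eta : R) (z0 : 'cV[R]_d).
Variables (L C TT : R).
Hypotheses (fF : is_filtration Ft) (bW : brownian P Ft W).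
Hypothesis solY : solves_sdme f m eta z0 P Ft W Y.
Hypotheses (e0 : 0 < eta) (e1 : eta <= 1) (mT : m%:R * eta <= TT).
Hypothesis tb : tame_field (grad (favg f)) L.
Hypotheses (C0 : 0 <= C) (sC : forall x y l, sigma f x y l l <= C).
Local Notation Ex X := (\int[P]_w X w).

Let TT0 : 0 <= TT.
Proof. by apply: le_trans mT; rewrite mulr_ge0// ltW. Qed.

(** Freezing the process before time 0 makes the paths continuous on the whole
    line, hence the process jointly measurable. *)
Definition extend (u : R) : T -> 'cV[R]_d := Y (Num.max 0 u).

Let extendE u : 0 <= u -> extend u = Y u.
Proof. by move=> u0; rewrite /extend; congr Y; apply/max_idPr. Qed.

Let extend_continuous w : continuous (extend^~ w).
Proof.
have [_ /(_ w)/subspace_continuousP cY _ _] := solY => c.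
have m0 : 0 <= Num.max 0 c by rewrite le_max lexx.
have cm : Num.max 0 x @[x --> c] --> Num.max 0 c.
  apply: (@continuous_max _ _ (cst 0 : R -> R) idfun) => //.
  exact: cst_continuous.
move=> A HA; have H2 := cm _ (cY _ m0 A HA).
apply: (@filterS _ (nbhs c) _ _ _ _ H2) => x; apply.
by rewrite /= le_max lexx.
Qed.

Let extend_joint i :
  measurable_fun setT (fun x : measurableTypeR R * T => extend x.1 x.2 i 0).
Proof.
apply: (@measurable_caratheodory _ _ (measurableTypeR R * T)%type fst
  (fun c x => extend c x.2 i 0)).
- exact: measurable_fst.
- move=> c; apply: (measurableT_comp (f := fun w => extend c w i 0)) => //.
  have m0 : 0 <= Num.max 0 c by rewrite le_max lexx.
  have [aY _ _ _] := solY.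
  exact: measurable_wrt_measurable (filtration_measurable fF m0) (aY _ i m0).
- move=> [u w] c /=.
  apply: (cvg_comp (extend^~ w) (fun x : 'cV[R]_d => x i 0)); first exact: extend_continuous.
  exact: coord_continuous.
Qed.

Definition sdme_noise_const : R := 32 * d%:R ^+ 2 * C * TT.

Let noise_const0 : 0 <= sdme_noise_const.
Proof. by rewrite !mulr_ge0. Qed.

Let sigma_scaled_le x y l : (eta *: sigma f x y) l l <= eta * C.
Proof.
have := sC x y l; move: (sigma f x y) => S Sl.
by rewrite mxE ler_wpM2l ?(ltW e0).
Qed.

(** The stochastic integrals of an epoch are centered noise: the entries of
    the root of eta sigma have squares at most eta C. *)
Lemma sdme_integral_form s t : let a := (s * m)%:R * eta in
  a < t -> t <= a + m%:R * eta ->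
  exists2 I, centered_noise P (Ft a) eta sdme_noise_const I &
    {ae P, forall w, forall i, extend t w i 0 = extend a w i 0
       - tint a t (fun u => grad (favg f) (extend u w) i 0) + I i w}.
Proof.
move=> a at_ tte; have a0 : 0 <= a by rewrite mulr_ge0// ltW.
have t0 : 0 <= t by exact: le_trans a0 (ltW at_).
have [_ _ _ /(_ s t at_)] := solY.
case.
  by rewrite mulSn natrD mulrDl addrC.
move=> I [HI eqY].
have eC : 0 <= eta * C by rewrite mulr_ge0 ?(ltW e0).
have bounds i j := ito_integral_bounds fF bW a0 (ltW at_) (HI i j)
  (fun u w _ _ => sqrtmx_entry_sqr_le i j eC
     (sigma_scaled_le (Y u w) (Y a w))) eC.
have ta : t - a <= TT by apply: le_trans mT; rewrite lerBlDl.
exists (fun i w => \sum_j I i j w).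
  move=> i; have iI j : L2 P (I i j) by case: (bounds i j).
  split.
  - exact: L2_sum.
  - apply: (@le_trans _ _ (Ex (fun w => d%:R * \sum_j I i j w ^+ 2))).
      apply: Ex_le; first exact: (L2_sum _ iI).2.
        by apply: L1Z; apply: L1_sum => j; exact: (iI j).2.
      move=> w; have := sum_sqr_le_nsq (\col_j I i j w).
      rewrite /nsq; under [X in _ <= _ * X -> _]eq_bigr do rewrite mxE.
      apply: le_trans; rewrite -(real_normK (num_real (\sum_j I i j w))).
      rewrite lerXn2r ?nnegrE ?sumr_ge0// (le_trans (ler_norm_sum _ _ _))//.
      by apply: ler_sum => j _; rewrite mxE.
    rewrite ExZ; last by apply: L1_sum => j; exact: (iI j).2.
    rewrite Ex_sum; last by move=> j; exact: (iI j).2.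
    have B j : Ex (fun w => I i j w ^+ 2) <= 32 * (eta * C) * TT.
      have [_ H _] := bounds i j; apply: (le_trans H).
      by rewrite ler_wpM2l// mulr_ge0.
    apply: (@le_trans _ _ (d%:R * \sum_(j < d) (32 * (eta * C) * TT))).
      by rewrite ler_wpM2l//; apply: ler_sum.
    rewrite sumr_const card_ord -[_ *+ d]mulr_natl /sdme_noise_const.
    by rewrite le_eqVlt; apply/orP; left; apply/eqP; ring.
  - move=> zeta c Gz zc.
    have mz := measurable_wrt_measurable (filtration_measurable fF a0) Gz.
    under eq_Rintegral do rewrite mulr_sumr.
    rewrite Ex_sum; last by move=> j; apply: L1M => //; exact: L2_bounded mz zc.
    by apply: big1 => j _; have [_ _ H] := bounds i j; exact: H Gz zc.
have driftE w i : tint a t (fun u => grad (favg f) (extend u w) i 0) =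
    \int[lebesgue_measure]_(u in `[a, t]) grad (favg f) (Y u w) i 0.
  apply: eq_Rintegral => u; rewrite inE/= in_itv/= => /andP[au _].
  by rewrite extendE// (le_trans a0).
apply: filterS eqY => w eqY i; rewrite (extendE t0) (extendE a0) driftE.
exact: eqY.
Qed.

(** Large enough for the contraction in both estimates of the gap. *)
Definition sdme_rate : R := 6 * TT * L + 2 * @linear_rate R d L.

Definition sdme_epoch_const (G K : R) : R :=
  @epoch_const R d L sdme_noise_const TT sdme_rate G K.

Lemma sdme_epoch_error s v p (G K : R) : quad_approx v p G K -> 0 <= G -> 0 <= K ->
  `|Ex (fun w => v (Y ((s.+1 * m)%:R * eta) w)) -
    Ex (fun w => v (iter m (euler eta (grad (favg f))) (Y ((s * m)%:R * eta) w)))| <=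
  sdme_epoch_const G K * eta.
Proof.
move=> Qv G0 K0; set a := (s * m)%:R * eta.
have a0 : 0 <= a by rewrite mulr_ge0// ltW.
have te0 : 0 <= a + m%:R * eta by rewrite addr_ge0// mulr_ge0// ltW.
have -> : (s.+1 * m)%:R * eta = a + m%:R * eta by rewrite mulSn natrD mulrDl addrC.
have L0 : 0 <= L by case: tb.
have TL : 0 <= TT * L by rewrite mulr_ge0.
have r0 : 0 < @linear_rate R d L by rewrite /linear_rate ltr_wpDl// mulr_ge0.
have lam0 : 0 < sdme_rate by rewrite /sdme_rate; lra.
have [aY _ _ _] := solY.
have Ga i : measurable_wrt (Ft a) (fun w => extend a w i 0).
  by rewrite extendE//; exact: aY.
have := @epoch_weak_error R d _ T P (Ft a) extend (grad (favg f)) L eta a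
  sdme_noise_const TT m (filtration_sigma fF a0) (filtration_measurable fF a0)
  tb e0 e1 mT noise_const0 extend_joint Ga (@sdme_integral_form s)
  sdme_rate v p G K lam0 _ _ Qv G0 K0.
by rewrite !extendE//; apply; rewrite /sdme_rate; lra.
Qed.

(** The epochs are exchanged one by one, starting from the last, for m Euler
    steps each.  An exchange costs O(eta), whereas a step of SVRG costs
    O(eta^2): the number of epochs has to be bounded independently of eta. *)
Lemma sdme_weak_error v (G K : R) s : 0 <= G -> 0 <= K ->
  (forall j, (j <= s * m)%N -> exists p,
     quad_approx (v \o iter j (euler eta (grad (favg f)))) p G K) ->
  L1 P (fun w => v (Y ((s * m)%:R * eta) w)) /\
  `|Ex (fun w => v (Y ((s * m)%:R * eta) w)) -
    v (iter (s * m) (euler eta (grad (favg f))) z0)| <=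
  s%:R * (sdme_epoch_const G K * eta).
Proof.
move=> G0 K0 vQ; set Phi := euler _ _ in vQ *.
have [aY _ Y0 _] := solY.
have mY (phi : 'cV[R]_d -> R) (t : R) : continuous phi -> 0 <= t ->
    measurable_fun setT (fun w => phi (Y t w)).
  move=> cphi t0; apply: measurable_continuous_col => // i.
  exact: measurable_wrt_measurable (filtration_measurable fF t0) (aY t i t0).
have sm0 k : 0 <= (k * m)%:R * eta by rewrite mulr_ge0// ltW.
split.
  have [p [cv _ [B vB] _ _]] := vQ 0%N (leq0n _).
  by apply: (L1_bounded P _ (fun w => vB (Y _ w))); exact: mY.
suff H k : (k <= s)%N ->
    `|Ex (fun w => v (iter ((s - k) * m) Phi (Y ((k * m)%:R * eta) w))) -
      v (iter (s * m) Phi z0)| <= k%:R * (sdme_epoch_const G K * eta).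
  by have := H s (leqnn s); rewrite subnn mul0n.
elim: k => [|k IH] ks.
  have [p [cv _ _ _ _]] := vQ (s * m)%N (leqnn _).
  rewrite mul0n mul0r subn0 mul0r.
  have -> : Ex (fun w => v (iter (s * m) Phi (Y 0 w))) =
      Ex (cst (v (iter (s * m) Phi z0))).
    apply: Ex_ae_eq => //; first exact: (mY (v \o iter (s * m) Phi)).
    by apply: filterS Y0 => w ->.
  by rewrite (Ex_cst P) subrr normr0.
have skE : ((s - k) * m = (s - k.+1) * m + m)%N by rewrite -subnSK// mulSn addnC.
rewrite -natr1 mulrDl mul1r [leRHS]addrC.
rewrite -(subrK (Ex (fun w => v (iter ((s - k) * m) Phi (Y ((k * m)%:R * eta) w))))
  (Ex (fun w => v (iter ((s - k.+1) * m) Phi (Y ((k.+1 * m)%:R * eta) w))))) -addrA.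
rewrite (le_trans (ler_normD _ _))// lerD//; last exact: IH (ltnW ks).
have [p Qp] : exists p, quad_approx (v \o iter ((s - k.+1) * m) Phi) p G K.
  by apply: vQ; rewrite leq_mul2r leq_subr orbT.
have := sdme_epoch_error k Qp G0 K0; rewrite -/Phi.
by rewrite skE; under [X in _ -> `|_ - X| <= _]eq_Rintegral do rewrite iterD.
Qed.

End sdme_error.

(** * Comparison of SVRG and the modified equation *)

Theorem theorem2p2 (R : realType) (n d : nat) (n_gt0 : (0 < n)%N)
  (f : 'I_n -> 'cV[R]_d -> R) (M T : R) (z0 : 'cV[R]_d)
  (f_diff : forall i x, differentiable (f i) x)
  (M_gt0 : 0 < M) (f_smooth : forall i, smooth M (f i))
  (F_class : classG_vec 2 (grad (favg f)))
  (sigma_class_l : forall y, classG_mx 2 (fun x => sigma f x y))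
  (sigma_class_r : forall x, classG_mx 1 (fun y => sigma f x y))
  (T_gt0 : 0 < T) (g : 'cV[R]_d -> R) (g_class : classG21 g) :
  exists2 C : R, 0 < C &
    forall (m : nat) (eta : R),
      0 < eta -> eta < Num.min 1 (T / m%:R) -> 1 <= m%:R * eta ->
    forall (disp1 : measure_display) (Om1 : measurableType disp1)
      (P1 : probability Om1 R) (gam : nat -> Om1 -> 'I_n)
      (z : nat -> Om1 -> 'cV[R]_d),
      iid_uniform P1 gam -> is_svrg f m eta z0 gam z ->
    forall (disp2 : measure_display) (Om2 : measurableType disp2)
      (P2 : probability Om2 R) (Ft : R -> set (set Om2))
      (W Y : R -> Om2 -> 'cV[R]_d),
      is_filtration Ft -> brownian P2 Ft W ->
      solves_sdme f m eta z0 P2 Ft W Y ->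
    (\big[Order.max/0]_(s < (Num.truncn (T / (m%:R * eta))%R).+1)
       `| 'E_P2[fun w => g (Y ((s * m)%:R * eta)%R w)]
          - 'E_P1[fun w => g (z (s * m)%N w)] | <= (C * eta)%:E)%E.
Proof.
have [L tb] := classG_vec_tame F_class.
have [S S0 sS] := sigma_diag_bounded n_gt0 f_diff sigma_class_l.
have [G2g _ _] := g_class.
have [G0 [K0 [G00 K00 Qg]]] := classG2_quad_approx G2g.
have [G [K [Gge0 Kge0 QG]]] := quad_approx_iter_euler T tb Qg G00 K00.
pose cS := K * (d%:R * S); have cS0 : 0 <= cS by rewrite !mulr_ge0.
pose cY := @sdme_epoch_const R d L S T G K.
exists (T * (`|cY| + cS) + 1); first by rewrite ltr_wpDl// mulr_ge0 ?(ltW T_gt0)// addr_ge0.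
move=> m eta e0; rewrite lt_min => /andP[e1 em] me1.
have m0 : (0 < m)%N by case: m em me1 => // _; rewrite mul0r ler10.
have mR : 0 < m%:R :> R by rewrite ltr0n.
have meT : m%:R * eta <= T by rewrite mulrC -ler_pdivlMr// ltW.
move=> disp1 Om1 P1 gam z iid svrg disp2 Om2 P2 Ft W Y fF bW sdme.
apply: bigmax_le => [|s _].
  by rewrite lee_fin mulr_ge0 ?(ltW e0)// addr_ge0// mulr_ge0 ?(ltW T_gt0)// addr_ge0.
have smT : (s * m)%:R * eta <= T.
  rewrite natrM -mulrA -ler_pdivlMr ?mulr_gt0//.
  apply: (@le_trans _ _ (Num.truncn (T / (m%:R * eta)))%:R).
    by rewrite ler_nat -ltnS.
  by rewrite truncn_le divr_ge0 ?(ltW T_gt0)// ltW// mulr_gt0.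
(* as m eta >= 1, there are at most T epochs *)
have sT : s%:R <= T :> R.
  by apply: le_trans smT; rewrite natrM -mulrA ler_peMr.
have QP j : (j <= s * m)%N -> exists p,
    quad_approx (g \o iter j (euler eta (grad (favg f)))) p G K.
  move=> jsm; apply: QG => //; first exact: ltW.
  by apply: le_trans smT; rewrite ler_wpM2r ?(ltW e0)// ler_nat.
have [lz Ez] := svrg_weak_error n_gt0 m0 iid svrg f_diff Kge0 sS QP.
have [lY EY] := sdme_weak_error fF bW sdme e0 (ltW e1) meT tb S0 sS Gge0 Kge0 QP.
rewrite (expectationE lz) (expectationE lY) -EFinB lee_fin.
rewrite -/cS in Ez; rewrite -/cY in EY.
set c := g _ in Ez EY.
rewrite -[X in `|X - _|](subrK c) -addrA (le_trans (ler_normD _ _))//.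
rewrite mulrDl mul1r -[leLHS]addr0 lerD ?(ltW e0)// mulrDr mulrDl lerD//.
  apply: (le_trans EY); apply: (@le_trans _ _ (s%:R * (`|cY| * eta))).
    by rewrite ler_wpM2l// ler_wpM2r ?(ltW e0)// ler_norm.
  by rewrite -mulrA ler_wpM2r// mulr_ge0 ?(ltW e0).
rewrite distrC (le_trans Ez)//.
have -> : (s * m)%:R * (cS * eta ^+ 2) = (s * m)%:R * eta * (cS * eta) by ring.
by rewrite -[leRHS]mulrA ler_wpM2r// mulr_ge0 ?(ltW e0).
Qed.
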